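(* Let $\Gamma$ be the f.c.c. lattice \[\Gamma=2\mathbb{Z}^3\cup[(1,1,0)+2\mathbb{Z}^3]\cup[(0,1,1)+2\mathbb{Z}^3]\cup[(1,0,1)+2\mathbb{Z}^3]\subset\mathbb{R}^3,\] and let $D_3^+=\Gamma\cup(x+\Gamma)$ be the diamond packing, where $x=\frac12(1,1,1)$. Then the group of linear coincidence isometries of $D_3^+$ is $\mathrm{OC}(\Gamma)$. In particular, each $R=R_q\in\mathrm{SOC}(\Gamma)$ ($q$ a primitive quaternion) is a coincidence rotation of $D_3^+$ with (i) $D_3^+(R)=\Gamma(R)$ and $\Sigma_{D_3^+}(R)=2\Sigma_\Gamma(R)=|q|^2$ if $|q|^2\equiv 2 \pmod 4$; (ii) $D_3^+(R)=\Gamma(R)\cup[(x+\ell)+\Gamma(R)]$, where $\ell\in(Rx-x+R\Gamma)\cap\Gamma$, and $\Sigma_{D_3^+}(R)=\Sigma_\Gamma(R)$, which equals $|q|^2$ if $|q|^2$ is odd and $\frac14|q|^2$ if $|q|^2\equiv 0\pmod 4$. Also, each $T=T_q\in \mathrm{OC}(\Gamma)\setminus\mathrm{SOC}(\Gamma)$ ($q$ a primitive quaternion) is a coincidence rotoreflection of $D_3^+$ with (i) $D_3^+(T)=\Gamma(T)$ and $\Sigma_{D_3^+}(T)=2\Sigma_\Gamma(T)$, which equals $2|q|^2$ if $|q|^2$ is odd and $\frac12|q|^2$ if $|q|^2\equiv0\pmod 4$; (ii) $D_3^+(T)=\Gamma(T)\cup[(x+\ell)+\Gamma(T)]$, where $\ell\in(Tx-x+T\Gamma)\cap\Gamma$,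 and $\Sigma_{D_3^+}(T)=\Sigma_\Gamma(T)=\frac12|q|^2$ if $|q|^2\equiv2\pmod4$. If $f_{D_3^+}(m)$ is the number of coincidence site packings of $D_3^+$ of index $m$, then $f_{D_3^+}$ is multiplicative, and for primes $p$ and $r\in\mathbb{N}$ \[f_{D_3^+}(p^r)=\begin{cases}1,&\text{if }p^r=2\\0,&\text{if }p=2\text{ and }r>1\\(p+1)p^{r-1},&\text{otherwise.}\end{cases}\] The Dirichlet series generating function of $f_{D_3^+}$ is \[\Phi_{D_3^+}(s)=\sum_{m=1}^\infty\frac{f_{D_3^+}(m)}{m^s}=(1+2^{-s})\cdot\Phi_{\mathbb{Z}^3}(s)=\frac{\zeta_{\mathbb{J}}(s/2)}{\zeta(2s)}\] \[=1+\tfrac{1}{2^s}+\tfrac{4}{3^s}+\tfrac{6}{5^s}+\tfrac{4}{6^s}+\tfrac{8}{7^s}+\tfrac{12}{9^s}+\tfrac{6}{10^s}+\tfrac{12}{11^s}+\tfrac{14}{13^s}+\tfrac{8}{14^s}+\tfrac{24}{15^s}+\tfrac{18}{17^s}+\cdots.\] Finally, the number of coincidence site packings of $D_3^+$ with index at most $N$ is asymptotically $\dfrac{9N^2}{2\pi^2}$.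
   Context: Coincidences of lattices: $\mathrm{OC}(\Gamma)$ is the group of all $R\in\mathrm{O}(3)$ such that $\Gamma(R):=\Gamma\cap R\Gamma$ has finite index in both $\Gamma$ and $R\Gamma$; $\mathrm{SOC}(\Gamma)=\mathrm{OC}(\Gamma)\cap\mathrm{SO}(3)$; $\Sigma_\Gamma(R):=[\Gamma:\Gamma(R)]$. For the f.c.c. lattice, $\mathrm{OC}(\Gamma)=\mathrm{OC}(\mathbb{Z}^3)=\mathrm{O}(3,\mathbb{Q})$. Quaternions: $\mathbb{H}$ is the real quaternion algebra, $q=(q_0,q_1,q_2,q_3)$, $|q|^2=q_0^2+q_1^2+q_2^2+q_3^2$. A primitive quaternion is a quaternion with integer components whose greatest common divisor is $1$. $\mathbb{R}^3$ is identified with the purely imaginary quaternions. For primitive $q$, $R_q(y)=qyq^{-1}$ and $T_q(y)=-qyq^{-1}$ for $y\in\mathbb{R}^3$. Every element of $\mathrm{SOC}(\Gamma)=\mathrm{SO}(3,\mathbb{Q})$ is of the form $R_q$, and every element of $\mathrm{OC}(\Gamma)\setminus\mathrm{SOC}(\Gamma)$ is of the form $T_q$, with $q$ primitive. Coincidences of the packing $L=D_3^+$: $R\in\mathrm{O}(3)$ is a linear coincidence isometry of $L$ if $L(R):=L\cap RL$ contains a subset of the form $y+\ell+\Gamma'$ with $y\in\{0,x\}$, $\ell\in\Gamma$, and $\Gamma'$ a finite index subgroup of $\Gamma$. The set $L(R)$ is called the coincidence site packing (CSP) of $L$ generated by $R$, and its index is $\Sigma_L(R)$, the ratio of the density of points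 (average number of points per unit volume) of $L$ to that of $L(R)$. The number $f_{D_3^+}(m)$ counts the distinct sets $D_3^+(R)$, $R\in\mathrm{OC}(\Gamma)$, with $\Sigma_{D_3^+}(R)=m$. $\mathbb{N}$ denotes the positive integers. An arithmetic function $f$ is multiplicative if $f(1)=1$ and $f(mn)=f(m)f(n)$ whenever $m,n$ are relatively prime. $\Phi_{\mathbb{Z}^3}(s)=\sum_{m\ge1}f_{\mathbb{Z}^3}(m)m^{-s}=\prod_{p\neq2}\frac{1+p^{-s}}{1-p^{1-s}}$ (product over odd primes $p$), where $f_{\mathbb{Z}^3}(m)$ is the number of distinct lattices $\mathbb{Z}^3\cap R\mathbb{Z}^3$, $R\in\mathrm{OC}(\mathbb{Z}^3)$, of index $m$ in $\mathbb{Z}^3$. $\zeta$ is Riemann's zeta function and $\zeta_{\mathbb{J}}(s)=(1-2^{1-2s})\zeta(2s)\zeta(2s-1)$ is the zeta function of the ring $\mathbb{J}$ of Hurwitz quaternions (quaternions whose components are all integers or all half-integers, i.e. all in $\frac12+\mathbb{Z}$). ''Asymptotically'' means that the ratio of the two quantities tends to $1$ as $N\to\infty$.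
   Formalization: The number of coincidence site packings of index at most N is shown to be asymptotically 15N^2/(4π^2) instead of 9N^2/(2π^2); the printed constant is false, since the stated Dirichlet series has residue 15/(2π^2) at s = 2. *)

(* Defs.v *)
From HB Require Import structures.
From mathcomp Require Import all_boot all_order all_algebra.
From mathcomp Require Import finmap all_classical all_reals all_analysis.
From mathcomp Require Import ring.
From mathcomp.real_closed Require Import complex.

Set Implicit Arguments.
Unset Strict Implicit.
Unset Printing Implicit Defensive.

Import Order.TTheory GRing.Theory Num.Theory.
Import numFieldNormedType.Exports.

Local Open Scope classical_set_scope.
Local Open Scope ring_scope.

Definition translate (V : zmodType) (v : V) (S : set V) : set V :=
  [set v + y | y in S].

Definition subgroup (V : zmodType) (H : set V) : Prop :=
  H 0 /\ forall u v, H u -> H v -> H (u - v).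

Definition cosets (V : zmodType) (G H : set V) : set (set V) :=
  [set translate g H | g in G].

Definition finite_index (V : zmodType) (G H : set V) : Prop :=
  [/\ subgroup H, H `<=` G & finite_set (cosets G H)].

(* [G : H]; equal to 0 when the index is infinite. *)
Definition group_index (V : zmodType) (G H : set V) : nat :=
  #|` fset_set (cosets G H)|%fset.

Section Isometries.
Variable R : realType.

Definition mximage (A : 'M[R]_3) (S : set 'cV[R]_3) : set 'cV[R]_3 :=
  [set A *m y | y in S].

Definition O3 : set 'M[R]_3 := [set A | A *m A^T = 1%:M].

Definition SO3 : set 'M[R]_3 := [set A | O3 A /\ \det A = 1].

Definition mxgroup (S : set 'M[R]_3) : Prop :=
  [/\ S 1%:M,
      forall A B, S A -> S B -> S (A *m B) &
      forall A, S A -> A \in unitmx /\ S (invmx A)].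

(* S(A) = S \cap A S, both for lattices and for packings. *)
Definition coinc (S : set 'cV[R]_3) (A : 'M[R]_3) : set 'cV[R]_3 :=
  S `&` mximage A S.

Definition OC (G : set 'cV[R]_3) : set 'M[R]_3 :=
  [set A | [/\ O3 A, finite_index G (coinc G A)
             & finite_index (mximage A G) (coinc G A)]].

Definition SOC (G : set 'cV[R]_3) : set 'M[R]_3 := OC G `&` SO3.

Definition Sigma (G : set 'cV[R]_3) (A : 'M[R]_3) : nat :=
  group_index G (coinc G A).

End Isometries.

Section Density.
Variable R : realType.

Definition cube (r : R) : set 'cV[R]_3 := [set y | forall i, `|y i ord0| <= r].

(* S has finitely many points in each cube, and the number of points of S per
   unit volume in the cube [-r, r]^3 tends to d. *)
Definition has_density (S : set 'cV[R]_3) (d : R) : Prop :=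
  (forall r, finite_set (S `&` cube r)) /\
  (#|` fset_set (S `&` cube r)|%fset)%:R / (2 * r) ^+ 3 @[r --> +oo] --> d.

(* "Sigma_L(A) = c": the densities of L and L(A) exist and have ratio c. *)
Definition packing_index (L : set 'cV[R]_3) (A : 'M[R]_3) (c : R) : Prop :=
  exists d d' : R, [/\ has_density L d, has_density (coinc L A) d',
                       d' != 0 & d / d' = c].

End Density.

Section Diamond.
Variable R : realType.

Definition vec3 (a b c : R) : 'cV[R]_3 := \col_i [:: a; b; c]`_i.

Definition Z3 : set 'cV[R]_3 := [set y | forall i, y i ord0 \is a Num.int].

Definition twoZ3 : set 'cV[R]_3 := [set 2 *: y | y in Z3].

Definition fcc : set 'cV[R]_3 :=
  twoZ3 `|` translate (vec3 1 1 0) twoZ3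
        `|` translate (vec3 0 1 1) twoZ3
        `|` translate (vec3 1 0 1) twoZ3.

Definition xD3 : 'cV[R]_3 := 2^-1 *: vec3 1 1 1.

Definition D3plus : set 'cV[R]_3 := fcc `|` translate xD3 fcc.

Definition packing_coincidence : set 'M[R]_3 :=
  [set A | O3 A /\
    exists y l G', [/\ y = 0 \/ y = xD3, fcc l, finite_index fcc G'
                     & translate (y + l) G' `<=` coinc D3plus A]].

Definition packing_shifts (A : 'M[R]_3) : set 'cV[R]_3 :=
  translate (A *m xD3 - xD3) (mximage A fcc) `&` fcc.

Definition D3plus_csps (m : nat) : set (set 'cV[R]_3) :=
  [set S | exists A, [/\ OC fcc A, S = coinc D3plus A
                       & packing_index D3plus A m%:R]].

Definition Z3_csls (m : nat) : set (set 'cV[R]_3) :=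
  [set S | exists A, [/\ OC Z3 A, S = coinc Z3 A & Sigma Z3 A = m]].

Definition fD3plus (m : nat) : nat := #|` fset_set (D3plus_csps m)|%fset.

Definition fZ3 (m : nat) : nat := #|` fset_set (Z3_csls m)|%fset.

End Diamond.

Record quat (K : Type) := Quat { qc0 : K; qc1 : K; qc2 : K; qc3 : K }.

Section Quaternions.
Variable K : pzRingType.
Implicit Types p q : quat K.

Definition qmul p q : quat K :=
  let: Quat a0 a1 a2 a3 := p in let: Quat b0 b1 b2 b3 := q in
  Quat (a0 * b0 - a1 * b1 - a2 * b2 - a3 * b3)
       (a0 * b1 + a1 * b0 + a2 * b3 - a3 * b2)
       (a0 * b2 - a1 * b3 + a2 * b0 + a3 * b1)
       (a0 * b3 + a1 * b2 - a2 * b1 + a3 * b0).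

Definition qnorm2 q : K :=
  qc0 q ^+ 2 + qc1 q ^+ 2 + qc2 q ^+ 2 + qc3 q ^+ 2.

End Quaternions.

Section QuaternionRotations.
Variable R : realType.

(* conjugate of q divided by |q|^2 *)
Definition qinv (q : quat R) : quat R :=
  Quat (qc0 q / qnorm2 q) (- qc1 q / qnorm2 q)
       (- qc2 q / qnorm2 q) (- qc3 q / qnorm2 q).

Definition qint (q : quat int) : quat R :=
  Quat (qc0 q)%:~R (qc1 q)%:~R (qc2 q)%:~R (qc3 q)%:~R.

Definition quat_of_vec (y : 'cV[R]_3) : quat R :=
  Quat 0 (y (inord 0) ord0) (y (inord 1) ord0) (y (inord 2) ord0).

Definition vec_of_quat (q : quat R) : 'cV[R]_3 := vec3 (qc1 q) (qc2 q) (qc3 q).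

Definition qsandwich (q : quat R) (y : 'cV[R]_3) : quat R :=
  qmul (qmul q (quat_of_vec y)) (qinv q).

(* The matrix of R_q : y |-> q y q^-1 in the standard basis; see [rotqE]. *)
Definition rotq (q : quat int) : 'M[R]_3 :=
  \matrix_(i, j) vec_of_quat (qsandwich (qint q) (delta_mx j ord0)) i ord0.

(* The matrix of T_q : y |-> - q y q^-1. *)
Definition rotoreflq (q : quat int) : 'M[R]_3 := - rotq q.

Lemma rotqE (q : quat int) (y : 'cV[R]_3) :
  quat_of_vec (rotq q *m y) = qsandwich (qint q) y.
Proof.
have E (i : nat) (P : (i < 3)%N) (v : 'cV[R]_3) :
    v (Ordinal P) ord0 = v (inord i) ord0.
  by congr (v _ _); apply/val_inj; rewrite /= inordK.
rewrite /qsandwich /quat_of_vec; congr Quat.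
- by rewrite /qinv /qint /=; ring.
all: rewrite !mxE !big_ord_recl big_ord0 !mxE /qsandwich /quat_of_vec /qinv.
all: rewrite /lift /= !mxE -!val_eqE /= ?inordK //= !E /=; ring.
Qed.

End QuaternionRotations.

Definition primitive (q : quat int) : Prop :=
  gcdz (gcdz (qc0 q) (qc1 q)) (gcdz (qc2 q) (qc3 q)) = 1.

Definition arith_multiplicative (f : nat -> nat) : Prop :=
  f 1%N = 1%N /\
  forall m n, (0 < m)%N -> (0 < n)%N -> coprime m n ->
    f (m * n)%N = (f m * f n)%N.

Section DirichletSeries.
Variable R : realType.
Implicit Types s z : R[i].

Definition cexp z : R[i] :=
  (expR (complex.Re z))%:C%C *
  Complex (cos (complex.Im z)) (sin (complex.Im z)).

(* n ^ s for a positive integer n *)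
Definition natcpow (n : nat) s : R[i] := cexp (s * (ln (n%:R : R))%:C%C).

(* R[i]^o is R[i] with the topology of its modulus. *)
Definition dirichlet_partial (f : nat -> nat) s : nat -> R[i]^o :=
  fun N => \sum_(1 <= m < N.+1) (f m)%:R * natcpow m (- s).

Definition dirichlet (f : nat -> nat) s : R[i] :=
  lim (dirichlet_partial f s @ \oo).

(* Only used for Re s > 1, where the series converges. *)
Definition zeta s : R[i] := dirichlet (fun=> 1%N) s.

Definition zetaJ s : R[i] :=
  (1 - natcpow 2 (1 - 2 * s)) * zeta (2 * s) * zeta (2 * s - 1).

End DirichletSeries.

(* Main.v *)
Require Import Defs.
From HB Require Import structures.
From mathcomp Require Import all_boot all_order all_algebra.
From mathcomp Require Import finmap all_classical all_reals all_analysis.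
From mathcomp.real_closed Require Import complex.
From mathcomp Require Import zify ring lra.

Set Implicit Arguments.
Unset Strict Implicit.
Unset Printing Implicit Defensive.

Import Order.TTheory GRing.Theory Num.Theory.
Import numFieldNormedType.Exports.

Local Open Scope classical_set_scope.
Local Open Scope ring_scope.

(** Up to sign, a coincidence isometry is conjugation by a primitive integer
    quaternion [q], so all questions concern the integer matrix [euler q] of
    [z |-> q z conj(q)], which is [|q|^2] times a rotation.

    Lattices. By [primitive_decomposition], [|q|^2 = m c] with [m] odd and
    [c = 1, 2, 4], and the factor of norm [c] acts as a symmetry of the cube. For
    the odd part, the transpose of [euler q] has rank one modulo [m], so that the
    integer points with integral preimage are the kernel modulo [m] of a
    functional [z |-> v.z] with [v] unimodular and [v.v = 0] modulo [m]
    ([euler_kernel_isotropic]). This gives the index [m] of the coincidence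
    lattices of [Z^3] and of [fcc]. Conversely, every such [v] comes from a
    quaternion of norm [m]: a descent in the style of Lagrange splits the pure
    quaternion [v] ([norm_left_factor], [isotropic_quaternion]). So the lattices
    of index [m] correspond to the points of the conic [v.v = 0] over [Z/m].
    Chinese remainders make their number multiplicative, and a parametrization of
    the conic gives [(p + 1) p^(r-1)] at [p^r] ([csl_card_mul],
    [csl_card_pfactor]).

    Packings. The set [x + fcc] consists of the halves of the odd integer vectors
    whose coordinate sum is 3 modulo 4, and [- x + fcc] of those with coordinate
    sum 1. By [euler_parity], [euler q] multiplies the class of the sum by
    [|q|^2]; after division by the norm only a sign remains, the product of the
    sign of the isometry and of a sign that is [-1] exactly when [c = 2]. If the
    total sign is [-1], no point of [x + fcc] comes from [x + fcc], and the packing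
    generated is the coincidence lattice of [fcc], with index [2 m]. If it is [1],
    the multiple [base_point m] of [x] does, the packing is the union of the
    lattice and its translate by that point, and the index is [m]. As the point
    depends on [m] only, packings of odd index [m] and packings of index [2 m] are
    both counted by the lattices of index [m], and no other index occurs
    ([fD3plusE]).

    The group. If the common points of the packing and its image contain a
    coset of a subgroup of finite index, a multiple of every basis vector has
    integral preimage, so the matrix is rational ([packing_coincidence_OC]). A
    rational isometry is a product of at most three rational reflections, and a
    reflection is minus the conjugation by a pure quaternion
    ([O3_rational_pm_rotq]).

    The counting function. Comparing values at prime powers shows that it is the
    Dirichlet convolution of the indicator of the squarefree numbers and of the
    function that is [n] for odd [n] and [0] for even [n] ([fD3plus_csp_coef]).
    Their series are [zeta(s) / zeta(2 s)] and [(1 - 2^(1-s)) zeta(s-1)]. Summing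
    over the second factor first, the summatory function is [N^2 / 4] times the
    sum of [1 / k^2] over squarefree [k], up to [o(N^2)], and that sum is
    [zeta(2) / zeta(4) = 15 / pi^2] ([squarefree_sum]). The two zeta values follow
    from closed forms for the sums of [1 / sin^2] and [1 / sin^4] over the odd
    multiples of [pi / 2^(n+1)], found by halving angles ([sum_invsqr_sin]). *)

(** * Multiplicative functions and Dirichlet convolution *)

Definition dconv (f g : nat -> nat) (n : nat) : nat :=
  (\sum_(d <- divisors n) f d * g (n %/ d))%N.

Lemma divisorsM (m n : nat) : (0 < m)%N -> (0 < n)%N -> coprime m n ->
  perm_eq (divisors (m * n))
    [seq (a * b)%N | a <- divisors m, b <- divisors n].
Proof.
move=> m0 n0 cmn.
have gcdl a b : (a %| m)%N -> (b %| n)%N -> gcdn (a * b) m = a.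
  move=> am bn; rewrite gcdnC Gauss_gcdl ?(gcdn_idPr am) //.
  exact: coprime_dvdr bn _.
have gcdr a b : (a %| m)%N -> (b %| n)%N -> gcdn (a * b) n = b.
  move=> am bn; rewrite gcdnC Gauss_gcdr ?(gcdn_idPr bn) //.
  by rewrite coprime_sym; apply: coprime_dvdl am _.
apply: uniq_perm.
- exact: divisors_uniq.
- apply: allpairs_uniq; try exact: divisors_uniq.
  move=> [a b] [c d] /allpairsP [[a1 b1] [/= Ha Hb [-> ->]]].
  move=> /allpairsP [[c1 d1] [/= Hc Hd [-> ->]]] E.
  move: Ha Hb Hc Hd; rewrite -!dvdn_divisors // => Ha Hb Hc Hd.
  by rewrite -(gcdl a1 b1) // -{2}(gcdr a1 b1) // E gcdl // gcdr.
move=> d; rewrite -dvdn_divisors ?muln_gt0 ?m0 //; apply/idP/allpairsP.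
  move=> dmn; exists (gcdn d m, gcdn d n); split=> /=.
  - by rewrite -dvdn_divisors // dvdn_gcdr.
  - by rewrite -dvdn_divisors // dvdn_gcdr.
  have /gcdn_idPl E := dmn.
  apply/eqP; rewrite eqn_dvd; apply/andP; split; last first.
    rewrite Gauss_dvd ?dvdn_gcdl //.
    exact: coprime_dvdl (dvdn_gcdr _ _) (coprime_dvdr (dvdn_gcdr _ _) cmn).
  rewrite muln_gcdl !muln_gcdr !dvdn_gcd dmn andbT.
  by rewrite (dvdn_mulr d) ?(dvdn_mulr n) ?(dvdn_mull m).
move=> [[a b] [/= Ha Hb ->]]; move: Ha Hb; rewrite -!dvdn_divisors //.
exact: dvdn_mul.
Qed.

Lemma divisors_pfactor (p r : nat) : prime p ->
  perm_eq (divisors (p ^ r)) [seq (p ^ j)%N | j <- iota 0 r.+1].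
Proof.
move=> pp; apply: uniq_perm; first exact: divisors_uniq.
  by rewrite map_inj_uniq ?iota_uniq //; apply: expnI; apply: prime_gt1.
move=> d; rewrite -dvdn_divisors ?expn_gt0 ?prime_gt0 //.
apply/dvdn_pfactor/mapP => // [[j jr ->]|[j]].
  by exists j; rewrite // mem_iota add0n ltnS.
by rewrite mem_iota add0n ltnS => /andP[_ jr] ->; exists j.
Qed.

Lemma dconv_mult (f g : nat -> nat) :
  arith_multiplicative f -> arith_multiplicative g ->
  arith_multiplicative (dconv f g).
Proof.
move=> [f1 fM] [g1 gM]; split.
  by rewrite /dconv /divisors /= big_seq1 divnn f1 g1.
move=> m n m0 n0 cmn; rewrite /dconv (perm_big _ (divisorsM m0 n0 cmn)) /=.
rewrite big_allpairs_dep big_distrlr /=.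
rewrite big_seq [RHS]big_seq; apply: eq_bigr => a; rewrite -dvdn_divisors // => am.
rewrite big_seq [RHS]big_seq; apply: eq_bigr => b; rewrite -dvdn_divisors // => bn.
have a0 := dvdn_gt0 m0 am; have b0 := dvdn_gt0 n0 bn.
have cab : coprime a b := coprime_dvdl am (coprime_dvdr bn cmn).
rewrite fM //.
have -> : (m * n %/ (a * b) = (m %/ a) * (n %/ b))%N.
  by rewrite -{1}(divnK am) -{1}(divnK bn) mulnACA mulnK // muln_gt0 a0.
have ma : (m %/ a %| m)%N by apply/dvdnP; exists a; rewrite mulnC divnK.
have nb : (n %/ b %| n)%N by apply/dvdnP; exists b; rewrite mulnC divnK.
rewrite gM.
- by rewrite mulnACA.
- by rewrite divn_gt0 // dvdn_leq.
- by rewrite divn_gt0 // dvdn_leq.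
exact: coprime_dvdl ma (coprime_dvdr nb cmn).
Qed.

Lemma dconv_pfactor (f g : nat -> nat) (p r : nat) : prime p ->
  dconv f g (p ^ r) = (\sum_(0 <= j < r.+1) f (p ^ j) * g (p ^ (r - j)))%N.
Proof.
move=> pp; rewrite /dconv (perm_big _ (divisors_pfactor r pp)) big_map.
rewrite /index_iota subn0 big_seq [RHS]big_seq.
apply: eq_bigr => j; rewrite mem_iota add0n ltnS => /andP[_ jr].
by rewrite -expnB // prime_gt0.
Qed.

(** Split off the full power of the least prime factor. *)
Lemma arith_multiplicative_ext (f g : nat -> nat) :
  arith_multiplicative f -> arith_multiplicative g ->
  (forall p r, prime p -> (0 < r)%N -> f (p ^ r)%N = g (p ^ r)%N) ->
  forall n, (0 < n)%N -> f n = g n.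
Proof.
move=> [f1 fM] [g1 gM] E; elim/ltn_ind => n IH n0.
have [->|n1] := eqVneq n 1%N; first by rewrite f1 g1.
have pp : prime (pdiv n) by apply: pdiv_prime; rewrite ltn_neqAle eq_sym n1.
have := pfactor_coprime pp n0; move: (pdiv n) pp (pdiv_dvd n) => p pp pn.
case=> k cpk nE.
have l0 : (0 < logn p n)%N by rewrite -pfactor_dvdn // expn1.
have k0 : (0 < k)%N by move: n0; rewrite nE muln_gt0 => /andP[].
have kn : (k < n)%N.
  by rewrite [in ltnRHS]nE ltn_Pmulr // -(exp1n (logn p n)) ltn_exp2r ?prime_gt1.
have ck : coprime k (p ^ logn p n) by rewrite coprime_sym coprimeXl.
have P0 : (0 < p ^ logn p n)%N by rewrite expn_gt0 prime_gt0.
by rewrite nE (fM _ _ k0 P0 ck) (gM _ _ k0 P0 ck) IH // E.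
Qed.

Definition valuations (Q : pred nat) (n : nat) : bool :=
  all (fun p => Q (logn p n)) (primes n).

Lemma valuations_mult (Q : pred nat) :
  arith_multiplicative (fun n => valuations Q n : nat).
Proof.
split=> // m n m0 n0 cmn; rewrite mulnb; congr nat_of_bool.
have lm p : p \in primes m -> logn p (m * n) = logn p m.
  rewrite mem_primes => /and3P[pp _ pm].
  by rewrite lognM // [logn p n]logn_coprime ?addn0 // (coprime_dvdl pm).
have ln p : p \in primes n -> logn p (m * n) = logn p n.
  rewrite mem_primes => /and3P[pp _ pn].
  rewrite lognM // logn_coprime // (coprime_dvdl pn) //.
  by rewrite coprime_sym.
apply/allP/andP => [H|[/allP Hm /allP Hn] p].
  split; apply/allP => p pm.
    by rewrite -lm // H // primesM // pm.
  by rewrite -ln // H // primesM // pm orbT.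
rewrite primesM // => /orP[pm|pn]; first by rewrite lm // Hm.
by rewrite ln // Hn.
Qed.

Lemma valuations_pfactor (Q : pred nat) (p r : nat) : prime p -> (0 < r)%N ->
  valuations Q (p ^ r) = Q r.
Proof.
by move=> pp r0; rewrite /valuations primesX // primes_prime //= pfactorK // andbT.
Qed.

Definition squarefree (n : nat) : bool := valuations (fun e => e <= 1)%N n.

Definition square_ind (n : nat) : nat := valuations (fun e => ~~ odd e) n.

Lemma square_indE (n : nat) : (0 < n)%N ->
  square_ind n = [exists d : 'I_n.+1, (d * d == n)%N].
Proof.
move=> n0; congr nat_of_bool; apply/allP/existsP => [H|[d /eqP <-] p _]; last first.
  case: (posnP d) => [->|d0]; first by rewrite logn0.
  by rewrite lognM // addnn odd_double.
pose d := (\prod_(p <- primes n) p ^ (logn p n)./2)%N.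
have dd : (d * d = n)%N.
  rewrite -big_split /= [RHS](prod_prime_decomp n0) prime_decompE big_map /=.
  rewrite !big_seq; apply: eq_bigr => p pn.
  by rewrite -expnD addnn even_halfK // H.
have dn : (d < n.+1)%N.
  by rewrite ltnS -[leqRHS]dd leq_pmulr //; case: (posnP d) dd n0 => // -> <-.
by exists (Ordinal dn) => /=; apply/eqP.
Qed.

(** Every positive integer is in exactly one way a squarefree number times a
    square. *)
Lemma squarefree_square_dconv (n : nat) : (0 < n)%N ->
  dconv (fun m => squarefree m : nat) square_ind n = 1%N.
Proof.
move: n; apply: (@arith_multiplicative_ext _ (fun=> 1%N)) => //.
  by apply: dconv_mult; apply: valuations_mult.
move=> p r pp r0; rewrite dconv_pfactor //.
rewrite big_ltn // expn0 subn0 big_ltn //.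
rewrite big_nat_cond big1 ?addn0; last first.
  move=> j; rewrite andbT => /andP[j2 _].
  by rewrite /squarefree valuations_pfactor ?(ltn_trans _ j2) // leqNgt j2.
rewrite /squarefree {1}/valuations /= mul1n valuations_pfactor //= mul1n.
rewrite /square_ind valuations_pfactor //.
case: r r0 => // -[|r] _ /=; first by [].
by rewrite subSS subn0 valuations_pfactor //=; case: odd.
Qed.

Definition odd_id (n : nat) : nat := if odd n then n else 0%N.

Lemma odd_id_mult : arith_multiplicative odd_id.
Proof.
split=> // m n _ _ _; rewrite /odd_id oddM.
by case: (odd m); case: (odd n); rewrite ?muln0.
Qed.

(** Only the divisors [1] and [p] of [p ^ r] are squarefree, so that the
    convolution has two terms, [p ^ r + p ^ (r - 1)] for odd [p]. *)
Lemma squarefree_odd_dconv_pfactor (p r : nat) : prime p -> (0 < r)%N ->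
  dconv (fun m => squarefree m : nat) odd_id (p ^ r) =
    if (p ^ r == 2)%N then 1%N
    else if (p == 2)%N && (1 < r)%N then 0%N
    else ((p + 1) * p ^ (r - 1))%N.
Proof.
move=> pp r0; rewrite dconv_pfactor // big_ltn // expn0 subn0 big_ltn //.
rewrite big_nat_cond big1 ?addn0; last first.
  move=> j; rewrite andbT => /andP[j2 _].
  by rewrite /squarefree valuations_pfactor ?(ltn_trans _ j2) // leqNgt j2.
rewrite /squarefree {1}/valuations /= mul1n valuations_pfactor //= mul1n.
rewrite /odd_id !oddX.
case: (eqVneq p 2%N) => [->|p2] /=.
  case: r r0 => // -[|r] _ //=.
  by rewrite gtn_eqF // -[X in (X < _)%N](expn1 2) ltn_exp2l.
have op : odd p by case: (even_prime pp) => // E; rewrite E in p2.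
have -> : (p ^ r == 2)%N = false.
  by apply/negP => /eqP E; have := oddX p r; rewrite E op orbT.
by rewrite op !orbT mulnDl mul1n -expnS subn1 prednK.
Qed.

(** * The values of the zeta function at 2 and 4 *)

Section Basel.
Variable R : realType.

(** The mean value theorem for [sin] on [0, t] gives both bounds, because
    [cos] decreases from 1 to [cos t] there. *)
Lemma sin_bounds (t : R) : 0 < t < pi / 2 ->
  [/\ 0 < sin t, sin t <= t & t * cos t <= sin t].
Proof.
move=> /andP[t0 tpi].
have pi0 := @pi_gt0 R.
have [|c] := @MVT R sin cos 0 t t0.
  by apply: continuous_subspaceT => x; exact: continuous_sin.
rewrite in_itv /= => /andP[c0 ct]; rewrite sin0 !subr0 => E.
have cc : cos t < cos c.
  by rewrite ltr_cos ?in_itv /= ?ct //; lra.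
split.
- by apply: sin_gt0_pihalf; rewrite t0.
- by rewrite E -[leRHS]mul1r ler_wpM2r ?cos_le1 // ltW.
- by rewrite E mulrC ler_wpM2r ?(ltW cc) // ltW.
Qed.

Lemma invsqr_sin_bounds (t : R) : 0 < t < pi / 2 ->
  0 <= (sin t) ^- 2 - 1 /\ (sin t) ^- 2 - 1 <= t ^- 2 <= (sin t) ^- 2.
Proof.
move=> tb; have [s0 st ct] := sin_bounds tb.
have t0 : 0 < t by case/andP: tb.
have c0 : 0 <= cos t by apply: cos_ge0_pihalf; move: tb; have := @pi_gt0 R; lra.
have -> : (sin t) ^- 2 - 1 = (cos t / sin t) ^+ 2.
  rewrite expr_div_n cos2sin2 mulrBl mul1r divff ?expf_neq0 ?gt_eqF //.
split; first exact: sqr_ge0.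
rewrite -!exprVn !lerXn2r ?nnegrE ?divr_ge0 ?invr_ge0 ?(ltW s0) ?(ltW t0) //=.
  by rewrite lef_pV2.
by rewrite ler_pdivrMr // mulrC ler_pdivlMr // mulrC.
Qed.

(** Both come from [cos^2 + sin^2 = 1] at [y / 2] and
    [sin y = 2 sin (y / 2) cos (y / 2)]. *)
Lemma invsqr_sin_double (y : R) : sin y != 0 ->
  let a := sin (y / 2) ^- 2 in let b := sin (y / 2 + pi / 2) ^- 2 in
  a + b = 4 * sin y ^- 2 /\ a ^+ 2 + b ^+ 2 = 16 * sin y ^- 4 - 8 * sin y ^- 2.
Proof.
rewrite sinDpihalf.
have -> : sin y = 2 * (cos (y / 2) * sin (y / 2)).
  by rewrite {1}(splitr y) -mulr2n sin_mulr2n mulr_natl.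
have := cos2Dsin2 (y / 2); set c := cos _; set s := sin _ => E.
rewrite !mulf_eq0 !negb_or => /and3P[_ c0 s0] /=; split.
  have -> : s ^- 2 + c ^- 2 = (c ^+ 2 + s ^+ 2) * (c ^- 2 * s ^- 2).
    by field; rewrite c0 s0.
  by rewrite E; field; rewrite c0 s0.
have -> : 16 * (2 * (c * s)) ^- 4 = (c ^+ 2 + s ^+ 2) ^+ 2 * (c ^- 4 * s ^- 4).
  by rewrite E; field; rewrite c0 s0.
have -> : 8 * (2 * (c * s)) ^- 2 = 2 * c ^- 2 * s ^- 2.
  by field; rewrite c0 s0.
field; by rewrite c0 s0.
Qed.

(** The zeros of [cos (2 ^ n y)] in [0, pi]: going from level [n] to [n.+1]
    replaces each angle [y] by [y / 2] and [y / 2 + pi / 2]. *)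
Definition oddangle (n k : nat) : R := pi * (2 * k%:R + 1) / (2 * 2 ^+ n).

Lemma oddangle_gt0 n k : 0 < oddangle n k.
Proof.
by rewrite divr_gt0 ?mulr_gt0 ?exprn_gt0 ?pi_gt0 // ltr_wpDl // mulr_ge0.
Qed.

Lemma oddangle_ltpi n k : (k < 2 ^ n)%N -> oddangle n k < pi.
Proof.
move=> kn; rewrite ltr_pdivrMr ?mulr_gt0 ?exprn_gt0 // ltr_pM2l ?pi_gt0 //.
rewrite -natrX -!natrM natr1 ltr_nat; lia.
Qed.

Lemma oddangle_ltpihalf n k : (k < 2 ^ n)%N -> oddangle n.+1 k < pi / 2.
Proof.
move=> kn; rewrite ltr_pdivrMr ?mulr_gt0 ?exprn_gt0 //.
have -> : pi / 2 * (2 * 2 ^+ n.+1) = pi * (2 * 2 ^+ n) :> R by rewrite exprS; field.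
rewrite ltr_pM2l ?pi_gt0 // -natrX -!natrM natr1 ltr_nat; lia.
Qed.

Lemma sum_shift m (f : nat -> R) :
  \sum_(m <= k < m + m) f k = \sum_(0 <= k < m) f (k + m)%N.
Proof. by rewrite -{1}[m]add0n big_addn addnK. Qed.

(** By [invsqr_sin_double], each doubling of the number of angles multiplies the
    sum [S2] of the inverse squares by 4, and turns the sum [S4] of the inverse
    fourth powers into [16 S4 - 8 S2]. *)
Lemma sum_invsqr_sin n :
  \sum_(0 <= k < 2 ^ n) sin (oddangle n k) ^- 2 = 4 ^+ n /\
  \sum_(0 <= k < 2 ^ n) sin (oddangle n k) ^- 4 = (16 ^+ n + 2 * 4 ^+ n) / 3.
Proof.
elim: n => [|n [IH2 IH4]].
  rewrite !expn0 !big_nat1 /oddangle mulr0 add0r !mulr1 sin_pihalf !expr1n invr1.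
  by split=> //; rewrite expr0; lra.
have half k : oddangle n.+1 k = oddangle n k / 2.
  by rewrite /oddangle exprS; field; rewrite expf_neq0 ?pnatr_eq0.
have halfD k : oddangle n.+1 (k + 2 ^ n) = oddangle n k / 2 + pi / 2.
  rewrite /oddangle exprS natrD natrX.
  by field; rewrite expf_neq0 ?pnatr_eq0.
have split_sum (f : nat -> R) : \sum_(0 <= k < 2 ^ n.+1) f k =
    \sum_(0 <= k < 2 ^ n) (f k + f (k + 2 ^ n)%N).
  rewrite expnS mul2n -addnn (@big_cat_nat _ _ _ (2 ^ n)) ?leq_addr //=.
  by rewrite (sum_shift (2 ^ n)%N) big_split.
have nz k : (0 <= k < 2 ^ n)%N -> sin (oddangle n k) != 0.
  by move=> kn; rewrite gt_eqF // sin_gt0_pi // oddangle_gt0 oddangle_ltpi.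
rewrite !split_sum; split.
  rewrite exprS -IH2 mulr_sumr; apply: eq_big_nat => k kn.
  by rewrite half halfD; have [-> _] := invsqr_sin_double (nz k kn).
rewrite [RHS](_ : _ = 16 * ((16 ^+ n + 2 * 4 ^+ n) / 3) - 8 * 4 ^+ n); last first.
  by rewrite !exprS; field.
rewrite -IH4 -IH2 !mulr_sumr -sumrB; apply: eq_big_nat => k kn.
rewrite half halfD; have [_ <-] := invsqr_sin_double (nz k kn).
by rewrite -!exprVn -!exprM.
Qed.

(** The angles are symmetric about [pi / 2]; those below it satisfy the bounds
    of [invsqr_sin_bounds]. *)
Lemma half_sum_invsqr_sin n (f : R -> R) :
  \sum_(0 <= k < 2 ^ n.+1) f (sin (oddangle n.+1 k)) =
  2 * \sum_(0 <= k < 2 ^ n) f (sin (oddangle n.+1 k)).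
Proof.
rewrite expnS mul2n -addnn (@big_cat_nat _ _ _ (2 ^ n)) ?leq_addr //=.
rewrite mulr_natl mulr2n; congr (_ + _).
rewrite (sum_shift (2 ^ n)%N) big_nat_rev /=.
apply: eq_big_nat => k /andP[_ kn]; congr (f _).
have -> : oddangle n.+1 (0 + 2 ^ n - k.+1 + 2 ^ n) = pi - oddangle n.+1 k.
  rewrite /oddangle add0n natrD natrB // -natr1 natrX exprS.
  by field; rewrite expf_neq0 ?pnatr_eq0.
by rewrite -[in LHS](opprB _ pi) sinN -[in LHS](opprK (sin _)) -sinDpi subrK opprK.
Qed.

Definition oddsum (a N : nat) : R := \sum_(0 <= k < N) ((2 * k%:R + 1) ^- a).

Definition zetasum (a N : nat) : R := \sum_(1 <= k < N.+1) (k%:R ^- a).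

Lemma oddsum_angle a n : \sum_(0 <= k < 2 ^ n) oddangle n.+1 k ^- a =
  ((4 * 2 ^+ n) / pi) ^+ a * oddsum a (2 ^ n).
Proof.
rewrite mulr_sumr; apply: eq_big_nat => k _.
rewrite -!exprVn -exprMn /oddangle exprS; congr (_ ^+ _).
have D : 2 * k%:R + 1 != 0 :> R by rewrite gt_eqF // ltr_wpDl // mulr_ge0.
have P2 : (2 : R) ^+ n != 0 by rewrite expf_neq0.
have : pi != 0 :> R by rewrite gt_eqF ?pi_gt0.
by move: pi => p P; field; rewrite D P P2.
Qed.

Lemma angle_in n k : (0 <= k < 2 ^ n)%N -> 0 < oddangle n.+1 k < pi / 2.
Proof. by move=> /andP[_ kn]; rewrite oddangle_gt0 oddangle_ltpihalf. Qed.

(** Compare the inverse squares of the angles with those of their sines: the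
    latter sum to [2 * 4 ^ n], and the error is at most [1] per angle. *)
Lemma oddsum2_bound n :
  pi ^+ 2 / 8 - pi ^+ 2 / 16 * 2 ^- n <= oddsum 2 (2 ^ n) <= pi ^+ 2 / 8.
Proof.
have [H2 _] := sum_invsqr_sin n.+1.
have := half_sum_invsqr_sin n (fun x => x ^- 2); rewrite H2 => {}H2.
have A := oddsum_angle 2 n.
have up : \sum_(0 <= k < 2 ^ n) oddangle n.+1 k ^- 2 <=
    \sum_(0 <= k < 2 ^ n) sin (oddangle n.+1 k) ^- 2.
  by apply: ler_sum_nat => k /angle_in/invsqr_sin_bounds[_ /andP[]].
have lo : \sum_(0 <= k < 2 ^ n) (sin (oddangle n.+1 k) ^- 2 - 1) <=
    \sum_(0 <= k < 2 ^ n) oddangle n.+1 k ^- 2.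
  by apply: ler_sum_nat => k /angle_in/invsqr_sin_bounds[_ /andP[]].
move: up lo; rewrite A sumrB sumr_const_nat subn0 natrX.
move: H2; rewrite (_ : 4 ^+ n.+1 = 4 * (2 ^+ n) ^+ 2 :> R); last first.
  by rewrite exprS -exprM mulnC exprM; congr (_ * _ ^+ _); lra.
move: (\sum_(_ <= _ < _) _) => S; set P := 2 ^+ n : R => H2.
have -> : S = 2 * P ^+ 2 by lra.
have P0 : 0 < P by rewrite exprn_gt0.
have := @pi_gt0 R; move: pi => p pi0.
rewrite (_ : (4 * P / p) ^+ 2 = 16 * P ^+ 2 / p ^+ 2); last first.
  by field; rewrite gt_eqF.
have D0 : 0 < 16 * P ^+ 2 / p ^+ 2 by rewrite divr_gt0 ?mulr_gt0 ?exprn_gt0.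
rewrite -(ler_pdivlMl _ _ D0) -(ler_pdivrMl _ _ D0) => up lo; apply/andP; split.
  apply: le_trans lo; rewrite le_eqVlt; apply/orP; left; apply/eqP.
  by field; rewrite !gt_eqF.
apply: le_trans up _; rewrite le_eqVlt; apply/orP; left; apply/eqP.
by field; rewrite !gt_eqF.
Qed.

Lemma oddsum4_bound n :
  pi ^+ 4 / 96 - pi ^+ 4 / 96 * 2 ^- n <= oddsum 4 (2 ^ n)
    <= pi ^+ 4 / 96 + pi ^+ 4 / 96 * 2 ^- n.
Proof.
have [H2 H4] := sum_invsqr_sin n.+1.
have := half_sum_invsqr_sin n (fun x => x ^- 2); rewrite H2 => {}H2.
have := half_sum_invsqr_sin n (fun x => x ^- 4); rewrite H4 => {}H4.
have A := oddsum_angle 4 n.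
have E4 (x : R) : x ^- 4 = (x ^- 2) ^+ 2 by rewrite -!exprVn -exprM.
have up : \sum_(0 <= k < 2 ^ n) oddangle n.+1 k ^- 4 <=
    \sum_(0 <= k < 2 ^ n) sin (oddangle n.+1 k) ^- 4.
  apply: ler_sum_nat => k /angle_in/invsqr_sin_bounds[a0 /andP[b c]].
  rewrite !E4 lerXn2r ?nnegrE //; lra.
have lo : \sum_(0 <= k < 2 ^ n)
     (sin (oddangle n.+1 k) ^- 4 - 2 * sin (oddangle n.+1 k) ^- 2) <=
    \sum_(0 <= k < 2 ^ n) oddangle n.+1 k ^- 4.
  apply: ler_sum_nat => k /angle_in/invsqr_sin_bounds[a0 /andP[b c]].
  rewrite !E4; nra.
move: up lo; rewrite A sumrB -mulr_sumr.
move: H2 H4; rewrite (_ : 4 ^+ n.+1 = 4 * (2 ^+ n) ^+ 2 :> R); last first.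
  by rewrite exprS -exprM mulnC exprM; congr (_ * _ ^+ _); lra.
rewrite (_ : 16 ^+ n.+1 = 16 * (2 ^+ n) ^+ 4 :> R); last first.
  by rewrite exprS -exprM mulnC exprM; congr (_ * _ ^+ _); lra.
move: (\sum_(_ <= _ < _) sin _ ^- 2) (\sum_(_ <= _ < _) sin _ ^- 4) => S S4.
set P := 2 ^+ n : R => H2 H4.
have -> : S4 = (16 * P ^+ 4 + 8 * P ^+ 2) / 6 by lra.
have -> : S = 2 * P ^+ 2 by lra.
have P1 : 1 <= P by rewrite exprn_ege1 // ler1n.
have P0 : 0 < P by lra.
have := @pi_gt0 R; move: pi => p pi0.
rewrite (_ : (4 * P / p) ^+ 4 = 256 * P ^+ 4 / p ^+ 4); last first.
  by field; rewrite gt_eqF.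
have D0 : 0 < 256 * P ^+ 4 / p ^+ 4 by rewrite divr_gt0 ?mulr_gt0 ?exprn_gt0.
rewrite -(ler_pdivlMl _ _ D0) -(ler_pdivrMl _ _ D0) => up lo; apply/andP; split.
  apply: le_trans lo.
  have -> : (256 * P ^+ 4 / p ^+ 4)^-1 *
     ((16 * P ^+ 4 + 8 * P ^+ 2) / 6 - 2 * (2 * P ^+ 2)) =
     p ^+ 4 / 96 - p ^+ 4 / 96 * (P^-1 * P^-1).
    by field; rewrite !gt_eqF.
  rewrite lerD2l lerN2 ler_wpM2l ?divr_ge0 ?exprn_ge0 ?(ltW pi0) //.
  by rewrite -[leRHS]mulr1 ler_wpM2l ?invr_ge0 ?(ltW P0) // invf_le1.
apply: le_trans up _.
have -> : (256 * P ^+ 4 / p ^+ 4)^-1 * ((16 * P ^+ 4 + 8 * P ^+ 2) / 6) =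
     p ^+ 4 / 96 + p ^+ 4 / 96 * (P^-1 * P^-1 / 2).
  by field; rewrite !gt_eqF.
rewrite lerD2l ler_wpM2l ?divr_ge0 ?exprn_ge0 ?(ltW pi0) //.
have Pi : 0 < P^-1 by rewrite invr_gt0.
have : P^-1 <= 1 by rewrite invf_le1.
nra.
Qed.

Lemma oddsum_nondecreasing a : nondecreasing_seq (oddsum a).
Proof.
apply/nondecreasing_seqP => n; rewrite /oddsum big_nat_recr //= lerDl.
by rewrite invr_ge0 exprn_ge0 // addr_ge0 // mulr_ge0.
Qed.

Lemma cvg_expn2 : (2 ^ n)%N @[n --> \oo] --> \oo.
Proof.
apply/cvgnyPge => A; near=> n; apply: leq_trans (ltnW (ltn_expl n (leqnn 2))).
by near: n; exists A.
Unshelve. all: by end_near. Qed.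

(** The partial sums increase, so it suffices to control them along the powers
    of 2. *)
Lemma oddsum_cvg a (l c : R) :
  (forall n, l - c * 2 ^- n <= oddsum a (2 ^ n) <= l + c * 2 ^- n) ->
  oddsum a @ \oo --> l.
Proof.
move=> B.
have g0 : (fun n => c * 2 ^- n) @ \oo --> (0 : R).
  rewrite -[X in _ --> X](mulr0 c); apply: cvgM; first exact: cvg_cst.
  have := @cvg_geometric R 1 2^-1; rewrite ger0_norm ?invr_ge0 // => H.
  have {}H := H ltac:(lra).
  by under eq_fun do rewrite -exprVn -[_ ^+ _]mul1r.
have sub : (fun n => oddsum a (2 ^ n)) @ \oo --> l.
  apply: (@squeeze_cvgr _ _ _ _ (fun n => l - c * 2 ^- n) (fun n => l + c * 2 ^- n)).
  - by near=> n; exact: B.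
  - by rewrite -[X in _ --> X](subr0 l); apply: cvgB => //; exact: cvg_cst.
  - by rewrite -[X in _ --> X](addr0 l); apply: cvgD => //; exact: cvg_cst.
have c0 : cvgn (oddsum a).
  apply: nondecreasing_is_cvgn; first exact: oddsum_nondecreasing.
  exists (l + `|c|) => _ [n _ <-].
  have H : oddsum a n <= oddsum a (2 ^ n).
    by apply: oddsum_nondecreasing; exact: ltnW (ltn_expl n (leqnn 2)).
  apply: le_trans H _.
  case/andP: (B n) => _ /le_trans; apply; rewrite lerD2l.
  apply: le_trans (ler_norm _) _; rewrite normrM -[leRHS]mulr1 ler_wpM2l //.
  rewrite ger0_norm ?invr_ge0 ?exprn_ge0 // invf_le1 ?exprn_gt0 //.
  by rewrite exprn_ege1 // ler1n.
have : (oddsum a \o (fun n => 2 ^ n)%N) @ \oo --> limn (oddsum a).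
  exact: cvg_comp cvg_expn2 c0.
by move=> /(cvg_unique (@Rhausdorff R) sub) ->.
Unshelve. all: by end_near. Qed.

Lemma zetasum_double a N :
  zetasum a N.*2 = oddsum a N + 2 ^- a * zetasum a N.
Proof.
rewrite /zetasum /oddsum !big_add1 /=.
elim: N => [|N IH]; first by rewrite !big_geq ?mulr0 ?addr0.
rewrite doubleS 2?big_nat_recr //= IH !big_nat_recr //= mulrDr.
have -> : (N.*2.+2)%:R ^- a = 2 ^- a * N.+1%:R ^- a :> R.
  by rewrite -doubleS -mul2n natrM exprMn invfM.
have -> : N.*2.+1%:R = 2 * N%:R + 1 :> R by rewrite -natr1 -mul2n natrM.
ring.
Qed.

(** The even terms add up to [2 ^- a] times the whole sum. *)
Lemma zetasum_cvg a (l : R) : (0 < a)%N -> oddsum a @ \oo --> l ->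
  zetasum a @ \oo --> l / (1 - 2 ^- a).
Proof.
move=> a0 ol.
have z_nd : nondecreasing_seq (zetasum a).
  apply/nondecreasing_seqP => n; rewrite /zetasum [leRHS]big_nat_recr //= lerDl.
  by rewrite invr_ge0 exprn_ge0.
have q1 : (2 : R) ^- a < 1 by rewrite invf_lt1 ?exprn_gt0 // exprn_egt1 ?ltr1n ?lt0n_neq0.
have cz : cvgn (zetasum a).
  apply: nondecreasing_is_cvgn => //; exists (l / (1 - 2 ^- a)) => _ [n _ <-].
  rewrite ler_pdivlMr ?subr_gt0 // mulrBr mulr1 lerBlDr.
  have : zetasum a n <= zetasum a n.*2 by apply: z_nd; rewrite -addnn leq_addr.
  move/le_trans; apply; rewrite zetasum_double [_ * 2 ^- a]mulrC lerD2r.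
  rewrite -(cvg_lim _ ol) //; apply: nondecreasing_cvgn_le; last by apply/cvg_ex; exists l.
  exact: oddsum_nondecreasing.
have E : (fun N => zetasum a N.*2) @ \oo --> limn (zetasum a).
  apply: (@cvg_comp _ _ _ double (zetasum a) _ \oo) => //.
  apply/cvgnyPge => A; near=> k.
  by rewrite -addnn; apply: leq_trans (leq_addr _ _); near: k; exists A.
have E2 : (fun N => zetasum a N.*2) @ \oo --> l + 2 ^- a * limn (zetasum a).
  under eq_fun do rewrite zetasum_double.
  by apply: cvgD => //; apply: cvgM => //; exact: cvg_cst.
have := cvg_unique (@Rhausdorff R) E E2; set z := limn _ => Ez.
suff <- : z = l / (1 - 2 ^- a) by [].
apply: (canRL (mulfK _)); first by rewrite subr_eq0 gt_eqF.
by rewrite mulrBr mulr1 {1}Ez; ring.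
Unshelve. all: by end_near. Qed.

Lemma zeta2_cvg : zetasum 2 @ \oo --> pi ^+ 2 / 6.
Proof.
rewrite (_ : pi ^+ 2 / 6 = pi ^+ 2 / 8 / (1 - 2 ^- 2)); last by field.
apply: zetasum_cvg => //; apply: (@oddsum_cvg _ _ (pi ^+ 2 / 16)) => n.
have /andP[-> /le_trans ->] // := oddsum2_bound n.
by rewrite lerDl mulr_ge0 ?divr_ge0 ?invr_ge0 ?exprn_ge0 ?pi_ge0.
Qed.

Lemma zeta4_cvg : zetasum 4 @ \oo --> pi ^+ 4 / 90.
Proof.
rewrite (_ : pi ^+ 4 / 90 = pi ^+ 4 / 96 / (1 - 2 ^- 4)); last by field.
by apply: zetasum_cvg => //; apply: (@oddsum_cvg _ _ (pi ^+ 4 / 96)); exact: oddsum4_bound.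
Qed.

End Basel.

(** * Dirichlet series *)

Section ConvolutionSums.
Variable K : numFieldType.
Implicit Types a b : nat -> K.

Definition psum a (N : nat) : K := \sum_(1 <= m < N.+1) a m.

Lemma psum0 a : psum a 0 = 0.
Proof. exact: big_geq. Qed.

Lemma psumS a N : psum a N.+1 = psum a N + a N.+1.
Proof. exact: big_nat_recr. Qed.

(** Group the products [a m * b n] with [m * n <= N] by [m]. *)
Lemma psum_dconv a b (N : nat) :
  psum (fun k => \sum_(d <- divisors k) a d * b (k %/ d)%N) N =
  \sum_(1 <= m < N.+1) a m * psum b (N %/ m).
Proof.
have div_sum k : (0 < k < N.+1)%N ->
    \sum_(d <- divisors k) a d * b (k %/ d)%N =
    \sum_(1 <= d < N.+1 | (d %| k)%N) a d * b (k %/ d)%N.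
  move=> /andP[k0 kN]; rewrite -[RHS]big_filter; apply: perm_big; apply: uniq_perm.
  - exact: divisors_uniq.
  - by rewrite filter_uniq ?iota_uniq.
  move=> d; rewrite -dvdn_divisors // mem_filter mem_index_iota.
  case dk : (d %| k)%N => //=.
  by rewrite (dvdn_gt0 k0 dk) (leq_trans _ kN) // ltnS dvdn_leq.
rewrite /psum (eq_big_nat _ _ div_sum).
rewrite (exchange_big_dep_nat predT) //=; apply: eq_big_nat => m /andP[m0 mN].
rewrite mulr_sumr.
transitivity (\sum_(k <- [seq (m * n)%N | n <- index_iota 1 (N %/ m).+1])
   a m * b (k %/ m)%N); last first.
  by rewrite big_map; apply: eq_bigr => n _; rewrite mulKn.
rewrite -[LHS]big_filter; apply: perm_big; apply: uniq_perm.
- by rewrite filter_uniq ?iota_uniq.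
- rewrite map_inj_uniq ?iota_uniq // => x y /eqP.
  by rewrite eqn_pmul2l // => /eqP.
move=> k; rewrite mem_filter mem_index_iota; apply/idP/mapP.
  case/andP=> /dvdnP[n ->]; rewrite muln_gt0 ltnS => /andP[/andP[n0 _] nN].
  by exists n; rewrite 1?mulnC // mem_index_iota n0 ltnS leq_divRL.
move=> [n]; rewrite mem_index_iota ltnS leq_divRL // => /andP[n0 nN] ->.
by rewrite dvdn_mulr //= muln_gt0 m0 n0 ltnS mulnC.
Qed.

Lemma psum_nonneg_le a (M N : nat) : (forall m, 0 <= a m) -> (M <= N)%N ->
  psum a M <= psum a N.
Proof.
move=> a0 MN; rewrite /psum (@big_cat_nat _ _ _ M.+1 1 N.+1) //=.
by rewrite lerDl sumr_ge0.
Qed.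

Lemma psum_dconv_diff a b (N : nat) :
  psum a N * psum b N -
    psum (fun k => \sum_(d <- divisors k) a d * b (k %/ d)%N) N =
  \sum_(1 <= m < N.+1) \sum_((N %/ m).+1 <= n < N.+1) a m * b n.
Proof.
rewrite psum_dconv {1}/psum mulr_suml -sumrB; apply: eq_big_nat => m /andP[m0 mN].
rewrite -mulrBr -mulr_sumr; congr (_ * _).
rewrite /psum (@big_cat_nat _ _ _ (N %/ m).+1 1 N.+1) //=; last first.
  by rewrite ltnS leq_div.
by rewrite addrAC subrr add0r.
Qed.

(** The pairs [m, n <= N] with [m * n > N] are not both at most [M], so what
    they contribute is at most the growth of the product of the absolute sums
    between [M] and [N]. *)
Lemma norm_psum_dconv_diff a b (M N : nat) : (M * M <= N)%N ->
  `|psum a N * psum b N -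
    psum (fun k => \sum_(d <- divisors k) a d * b (k %/ d)%N) N| <=
  psum (fun m => `|a m|) N * psum (fun m => `|b m|) N -
  psum (fun m => `|a m|) M * psum (fun m => `|b m|) M.
Proof.
move=> MN.
have leMN : (M <= N)%N by case: M MN => // M'; apply: leq_trans; rewrite leq_pmulr.
have C_ge : psum (fun m => `|a m|) M * psum (fun m => `|b m|) M <=
    psum (fun k => \sum_(d <- divisors k) `|a d| * `|b (k %/ d)%N|) N.
  rewrite (psum_dconv (fun m => `|a m|) (fun m => `|b m|)) {1}/psum mulr_suml.
  apply: (@le_trans _ _ (\sum_(1 <= m < M.+1) `|a m| * psum (fun m => `|b m|) (N %/ m))).
    apply: ler_sum_nat => m /andP[m0 mM]; apply: ler_wpM2l => //.
    apply: psum_nonneg_le => //; rewrite leq_divRL //.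
    by apply: leq_trans MN; rewrite leq_mul2l -ltnS mM orbT.
  rewrite [leRHS](@big_cat_nat _ _ _ M.+1 1 N.+1) //= lerDl sumr_ge0 // => m _.
  by rewrite mulr_ge0 // /psum sumr_ge0.
apply: le_trans (_ : _ <= psum (fun m => `|a m|) N * psum (fun m => `|b m|) N -
    psum (fun k => \sum_(d <- divisors k) `|a d| * `|b (k %/ d)%N|) N) _; last first.
  by rewrite lerD2l lerN2.
rewrite (psum_dconv_diff (fun m => `|a m|) (fun m => `|b m|)) psum_dconv_diff.
apply: le_trans (ler_norm_sum _ _ _) _; apply: ler_sum => m _.
apply: le_trans (ler_norm_sum _ _ _) _; apply: ler_sum => i _.
by rewrite normrM.
Qed.

(** By [norm_psum_dconv_diff], the partial sums of the convolution differ from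
    the product of the partial sums by a Cauchy difference of absolute sums. *)
Lemma cvg_psum_dconv a b (x y : K^o) :
  cvgn (psum (fun m => `|a m|) : nat -> K^o) ->
  cvgn (psum (fun m => `|b m|) : nat -> K^o) ->
  (psum a : nat -> K^o) @ \oo --> x -> (psum b : nat -> K^o) @ \oo --> y ->
  (psum (fun k => \sum_(d <- divisors k) a d * b (k %/ d)%N) : nat -> K^o)
    @ \oo --> (x * y : K^o).
Proof.
move=> /cvg_ex[u ua] /cvg_ex[v vb] ax bY.
pose A' := psum (fun m => `|a m|); pose B' := psum (fun m => `|b m|).
have uv : (fun N => A' N * B' N : K^o) @ \oo --> (u * v : K^o) by exact: cvgM.
have xy : (fun N => psum a N * psum b N : K^o) @ \oo --> (x * y : K^o) by exact: cvgM.
pose D N : K^o := psum a N * psum b N -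
  psum (fun k => \sum_(d <- divisors k) a d * b (k %/ d)%N) N.
suff D0 : D @ \oo --> (0 : K^o).
  rewrite -[x * y]subr0.
  rewrite [F in F @ _ --> _](_ : _ = (fun N => psum a N * psum b N) - D).
    exact: cvgB.
  by apply/funext => N; rewrite !fctE /D opprB addrC subrK.
apply/cvgr0Pnorm_lt => e e0.
have /cvgrPdist_lt/(_ _ (divr_gt0 e0 (ltr0n _ 2))) [M _ HM] := uv.
near=> N.
have MN : (M * M <= N)%N by near: N; exists (M * M)%N.
have MN1 : (M <= N)%N.
  by case: (posnP M) => [->//|M0]; apply: leq_trans MN; rewrite leq_pmulr.
apply: le_lt_trans (norm_psum_dconv_diff a b MN) _; rewrite -/A' -/B'.
have D_ge : 0 <= A' N * B' N - A' M * B' M.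
  by rewrite subr_ge0 ler_pM ?psum_nonneg_le // /A' /B' /psum sumr_ge0.
rewrite -(ger0_norm D_ge) (splitr e) -[X in `|X|](subrK (u * v)) -addrA.
rewrite [X in `|X|](_ : _ = (u * v - A' M * B' M) - (u * v - A' N * B' N)); last by ring.
by apply: le_lt_trans (ler_normB _ _) _; rewrite ltrD ?HM /=.
Unshelve. all: by end_near. Qed.

End ConvolutionSums.

Section ComplexSeries.
Variable R : realType.
Implicit Types (s z w : R[i]) (f g h : nat -> nat) (x : R).

Lemma normc_real x : `|x%:C%C| = (`|x|)%:C%C :> R[i].
Proof. by rewrite normc_def /= expr0n addr0 sqrtr_sqr. Qed.

Lemma cexpD z w : cexp (z + w) = cexp z * cexp w.
Proof.
case: z w => [a b] [c d]; rewrite /cexp /= expRD sinD cosD.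
by apply/eqP; rewrite eq_complex /=; apply/andP; split; apply/eqP; ring.
Qed.

Lemma norm_cexp z : `|cexp z| = (expR (complex.Re z))%:C%C.
Proof.
rewrite /cexp normrM normc_real (ger0_norm (expR_ge0 _)) normc_def /=.
by rewrite cos2Dsin2 sqrtr1 mulr1.
Qed.

Lemma cexp0 : cexp (0 : R[i]) = 1.
Proof. by rewrite /cexp /= expR0 cos0 sin0 mulr1. Qed.

Lemma ReMr z x : complex.Re (z * x%:C%C) = complex.Re z * x.
Proof. by case: z => a b /=; rewrite mulr0 subr0. Qed.

Lemma Re_double s : complex.Re (2 * s) = 2 * complex.Re s.
Proof. by rewrite mulr_natl mulr2n; case: s => a b /=; ring. Qed.

Lemma natcpow1 s : natcpow 1 s = 1.
Proof. by rewrite /natcpow ln1 mulr0 cexp0. Qed.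

Lemma natcpowM (m n : nat) s : (0 < m)%N -> (0 < n)%N ->
  natcpow (m * n) s = natcpow m s * natcpow n s.
Proof.
by move=> m0 n0; rewrite /natcpow natrM lnM ?posrE ?ltr0n // rmorphD mulrDr cexpD.
Qed.

Lemma natcpowD (n : nat) s z : natcpow n (s + z) = natcpow n s * natcpow n z.
Proof. by rewrite /natcpow mulrDl cexpD. Qed.

Lemma natcpow_1 (n : nat) : (0 < n)%N -> natcpow n (1 : R[i]) = n%:R.
Proof.
move=> n0; rewrite /natcpow mul1r /cexp /= lnK ?posrE ?ltr0n // cos0 sin0.
by rewrite mulr1 rmorph_nat.
Qed.

Definition cterm f s (m : nat) : R[i] := (f m)%:R * natcpow m (- s).
Definition rterm f (x : R) (m : nat) : R := (f m)%:R * expR (- x * ln m%:R).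

Lemma dirichlet_partialE f s : dirichlet_partial f s = psum (cterm f s).
Proof. by []. Qed.

Lemma rterm_ge0 f x m : 0 <= rterm f x m.
Proof. by rewrite mulr_ge0 ?expR_ge0. Qed.

Lemma norm_cterm f s m : `|cterm f s m| = (rterm f (complex.Re s) m)%:C%C.
Proof.
rewrite /cterm normrM norm_cexp ReMr normr_nat rmorphM rmorph_nat.
by case: s => a b.
Qed.

Lemma psum_norm_cterm f s N : psum (fun m => `|cterm f s m|) N =
  (psum (rterm f (complex.Re s)) N)%:C%C.
Proof. by rewrite /psum rmorph_sum; apply: eq_bigr => m _; rewrite norm_cterm. Qed.

Lemma cvg_real_complex (u : nat -> R) (l : R) : u @ \oo --> l ->
  (fun n => (u n)%:C%C : R[i]^o) @ \oo --> (l%:C%C : R[i]^o).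
Proof.
move=> ul; apply/cvgrPdist_lt => -[e e'].
rewrite ltcE /= => /andP[/eqP -> e0].
have /cvgrPdist_lt/(_ _ e0) := ul; apply: filterS => n.
by rewrite -rmorphB normc_real ltcR.
Qed.

Lemma psum_series (K : numFieldType) (a : nat -> K) :
  psum a = series (fun k => a k.+1).
Proof. by apply/funext => N; rewrite /psum /series /= big_add1. Qed.

Lemma cvg_psum_dominated (a b : nat -> R) : (forall m, (0 < m)%N -> `|a m| <= b m) ->
  cvgn (psum b) -> cvgn (psum a).
Proof.
move=> ab; rewrite !psum_series => cb; apply: normed_cvg.
apply: (series_le_cvg _ _ _ cb) => n //=; last exact: ab.
by apply: le_trans (ab n.+1 _).
Qed.

Lemma dirichlet_partial_Re_Im f s N : dirichlet_partial f s N =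
  (psum (fun m => complex.Re (cterm f s m)) N)%:C%C +
  'i%C * (psum (fun m => complex.Im (cterm f s m)) N)%:C%C.
Proof.
rewrite /psum !rmorph_sum mulr_sumr -big_split /=.
by apply: eq_bigr => m _; rewrite -complexE.
Qed.

(** The real and the imaginary parts of the terms are dominated by their
    absolute values. *)
Lemma dirichlet_cvg f s : cvgn (psum (rterm f (complex.Re s))) ->
  cvg (dirichlet_partial f s @ \oo).
Proof.
move=> cf.
have H (z : R[i]) (p : R) : `|z| = p%:C%C -> `|complex.Re z| <= p /\ `|complex.Im z| <= p.
  move=> E; split; rewrite -lecR -E; first exact: normc_ge_Re.
  have := normc_ge_Re (z * 'i%C); rewrite ReiNIm normrN normrM.
  suff -> : `|'i%C| = 1 :> R[i] by rewrite mulr1.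
  by rewrite normc_def /= expr0n expr1n add0r sqrtr1.
have /cvg_ex[x Hx] : cvgn (psum (fun m => complex.Re (cterm f s m))).
  by apply: cvg_psum_dominated cf => m _; case: (H _ _ (norm_cterm f s m)).
have /cvg_ex[y Hy] : cvgn (psum (fun m => complex.Im (cterm f s m))).
  by apply: cvg_psum_dominated cf => m _; case: (H _ _ (norm_cterm f s m)).
apply/cvg_ex; exists (x%:C%C + 'i%C * y%:C%C : R[i]^o).
rewrite (_ : dirichlet_partial f s = fun N => dirichlet_partial f s N) //.
under eq_fun do rewrite dirichlet_partial_Re_Im.
apply: (@cvgD R[i] R[i]^o); first exact: cvg_real_complex.
apply: (@cvgM R[i]); [exact: cvg_cst|exact: cvg_real_complex].
Qed.

Lemma dirichlet_limP f s : cvgn (psum (rterm f (complex.Re s))) ->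
  dirichlet_partial f s @ \oo --> (dirichlet f s : R[i]^o).
Proof. exact: dirichlet_cvg. Qed.

Lemma dirichlet_unique f s z : dirichlet_partial f s @ \oo --> (z : R[i]^o) ->
  dirichlet f s = z.
Proof. by move=> H; apply: (cvg_lim _ H). Qed.

Lemma dconv_weight (K : comNzRingType) (w : nat -> K) f g m : (0 < m)%N ->
  (forall a b, (0 < a)%N -> (0 < b)%N -> w (a * b)%N = w a * w b) ->
  (dconv f g m)%:R * w m =
    \sum_(d <- divisors m) (f d)%:R * w d * ((g (m %/ d)%N)%:R * w (m %/ d)%N).
Proof.
move=> m0 wM; rewrite /dconv natr_sum mulr_suml !big_seq.
apply: eq_bigr => d; rewrite -dvdn_divisors // => dm.
have d0 := dvdn_gt0 m0 dm.
have md0 : (0 < m %/ d)%N by rewrite divn_gt0 // dvdn_leq.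
have -> : w m = w d * w (m %/ d)%N by rewrite -wM // mulnC divnK.
by rewrite natrM mulrACA.
Qed.

Lemma cterm_dconv f g s m : (0 < m)%N ->
  cterm (dconv f g) s m = \sum_(d <- divisors m) cterm f s d * cterm g s (m %/ d)%N.
Proof.
move=> m0; apply: (@dconv_weight R[i] (fun k => natcpow k (- s))) => // a b a0 b0.
exact: natcpowM.
Qed.

Lemma rterm_dconv f g x m : (0 < m)%N ->
  rterm (dconv f g) x m = \sum_(d <- divisors m) rterm f x d * rterm g x (m %/ d)%N.
Proof.
move=> m0; apply: (@dconv_weight R (fun k => expR (- x * ln k%:R))) => // a b a0 b0.
by rewrite natrM lnM ?posrE ?ltr0n // mulrDr expRD.
Qed.

Lemma rterm_dconv_cvg f g x (u v : R) :
  psum (rterm f x) @ \oo --> u -> psum (rterm g x) @ \oo --> v ->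
  psum (rterm (dconv f g) x) @ \oo --> u * v.
Proof.
move=> fu gv.
have nr h : (fun m => `|rterm h x m|) = rterm h x.
  by apply/funext => m; rewrite ger0_norm ?rterm_ge0.
rewrite (_ : psum (rterm (dconv f g) x) = psum (fun m =>
   \sum_(d <- divisors m) rterm f x d * rterm g x (m %/ d)%N)).
  by apply: (@cvg_psum_dconv R) => //; rewrite nr; apply/cvg_ex; [exists u|exists v].
apply/funext => N; apply: eq_big_nat => m /andP[m0 _]; exact: rterm_dconv.
Qed.

Lemma dirichlet_dconv f g s :
  cvgn (psum (rterm f (complex.Re s))) -> cvgn (psum (rterm g (complex.Re s))) ->
  dirichlet (dconv f g) s = dirichlet f s * dirichlet g s.
Proof.
move=> cf cg; apply: dirichlet_unique.
rewrite (_ : dirichlet_partial (dconv f g) s = psum (fun m =>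
   \sum_(d <- divisors m) cterm f s d * cterm g s (m %/ d)%N)); last first.
  by apply/funext => N; apply: eq_big_nat => m /andP[m0 _]; exact: cterm_dconv.
have nc h : cvgn (psum (rterm h (complex.Re s))) ->
    cvgn (psum (fun m => `|cterm h s m|) : nat -> R[i]^o).
  move=> /cvg_ex[l Hl]; apply/cvg_ex; exists (l%:C%C : R[i]^o).
  rewrite (_ : psum _ = fun N => (psum (rterm h (complex.Re s)) N)%:C%C).
    exact: cvg_real_complex.
  by apply/funext => N; rewrite psum_norm_cterm.
apply: cvg_psum_dconv; [exact: nc|exact: nc|exact: dirichlet_limP|exact: dirichlet_limP].
Qed.

Lemma psum_rterm_le f g x : (forall m, (f m <= g m)%N) ->
  cvgn (psum (rterm g x)) -> cvgn (psum (rterm f x)).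
Proof.
move=> fg; apply: cvg_psum_dominated => m m0.
by rewrite ger0_norm ?rterm_ge0 // ler_wpM2r ?expR_ge0 // ler_nat.
Qed.

(** Cauchy condensation: the terms in the dyadic block from [2^k] to
    [2^k.+1 - 1] are at most [2^-xk]. *)
Lemma zeta_abs_cvg x : 1 < x -> cvgn (psum (rterm (fun=> 1%N) x)).
Proof.
move=> x1; set a := rterm _ x.
pose q := expR ((1 - x) * ln 2) : R.
have q1 : q < 1 by rewrite -expR0 ltr_expR nmulr_rlt0 ?ln_gt0 ?ltr1n //; lra.
have q0 : 0 < q := expR_gt0 _.
have block k : psum a (2 ^ k).-1 <= \sum_(0 <= j < k) q ^+ j.
  elim: k => [|k IH]; first by rewrite /psum !big_geq.
  rewrite big_nat_recr //= /psum prednK ?expn_gt0 //; rewrite /psum prednK ?expn_gt0 // in IH.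
  rewrite (@big_cat_nat _ _ _ (2 ^ k)%N) ?expn_gt0 ?leq_exp2l //=.
  apply: lerD => //.
  have -> : q ^+ k = (2 ^ k)%:R * a (2 ^ k)%N.
    rewrite /a /rterm mul1r natrX lnXn ?ltr0n // -[in RHS](lnK (x := 2)) ?posrE ?ltr0n //.
    rewrite /q -!expRM_natl -expRD; congr expR.
    by rewrite lnK ?posrE ?ltr0n // -mulr_natr; ring.
  have -> : (2 ^ k)%:R * a (2 ^ k)%N = \sum_(2 ^ k <= i < 2 ^ k.+1) a (2 ^ k)%N.
    by rewrite sumr_const_nat expnS mul2n -addnn addnK mulr_natl.
  apply: ler_sum_nat => i /andP[ki _].
  rewrite /a /rterm !mul1r ler_expR !mulNr lerN2 ler_wpM2l //; first by lra.
  have k0 : (0 < 2 ^ k)%N by rewrite expn_gt0.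
  by rewrite ler_ln ?posrE ?ltr0n ?(leq_trans k0 ki) // ler_nat.
apply: nondecreasing_is_cvgn.
  by move=> m n mn; apply: psum_nonneg_le => // i; exact: rterm_ge0.
exists (1 - q)^-1 => _ [n _ <-].
apply: (@le_trans _ _ (psum a (2 ^ n).-1)).
  apply: psum_nonneg_le => [i|]; first exact: rterm_ge0.
  by rewrite -ltnS prednK ?expn_gt0 // ltn_expl.
apply: le_trans (block n) _.
have := congr1 (fun u => u n) (geometric_seriesE 1 (negbT (lt_eqF q1))).
rewrite /series /= mul1r => E.
rewrite (eq_bigr (fun j => 1 * q ^+ j)) => [|j _]; last by rewrite mul1r.
rewrite E ler_piMl ?invr_ge0 ?subr_ge0 ?(ltW q1) //.
by rewrite gerBl exprn_ge0 // ltW.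
Qed.

Lemma id_abs_cvg x : 2 < x -> cvgn (psum (rterm id x)).
Proof.
move=> x2; have := @zeta_abs_cvg (x - 1) ltac:(lra).
rewrite (_ : psum (rterm (fun=> 1%N) (x - 1)) = psum (rterm id x)) //.
apply/funext => N; apply: eq_big_nat => m /andP[m0 _].
rewrite /rterm mul1r opprB mulrBl mul1r -mulNr expRD lnK //.
by rewrite posrE ltr0n.
Qed.

Lemma dirichlet_id s : dirichlet id s = zeta (s - 1).
Proof.
rewrite /zeta /dirichlet (_ : dirichlet_partial id s = dirichlet_partial (fun=> 1%N) (s - 1)) //.
apply/funext => N; apply: eq_big_nat => m /andP[m0 _].
by rewrite mul1r opprB natcpowD natcpow_1.
Qed.

(** The even terms of the series of [h] scaled by [2 ^ (- s)] account for the
    difference of [f] and [g]; compare partial sums of even length. *)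
Lemma dirichlet_even_split f g h (c : nat) s :
  (forall m, f m.*2.+1 = g m.*2.+1) ->
  (forall m, (0 < m)%N -> f m.*2 = (g m.*2 + c * h m)%N) ->
  cvgn (psum (rterm f (complex.Re s))) -> cvgn (psum (rterm g (complex.Re s))) ->
  cvgn (psum (rterm h (complex.Re s))) ->
  dirichlet f s = dirichlet g s + c%:R * natcpow 2 (- s) * dirichlet h s.
Proof.
move=> fodd feven cf cg ch.
have dbl : double n @[n --> \oo] --> \oo.
  apply/cvgnyPge => A; near=> k.
  by rewrite -addnn; apply: leq_trans (leq_addr _ _); near: k; exists A.
have lim2 k : cvgn (psum (rterm k (complex.Re s))) ->
    (fun N => dirichlet_partial k s N.*2) @ \oo --> (dirichlet k s : R[i]^o).
  move=> /dirichlet_limP H; exact: (@cvg_comp _ _ _ double (dirichlet_partial k s) _ \oo).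
have H : (fun N => dirichlet_partial f s N.*2) @ \oo -->
    (dirichlet g s + c%:R * natcpow 2 (- s) * dirichlet h s : R[i]^o).
  rewrite (_ : (fun N => dirichlet_partial f s N.*2) = (fun N =>
     dirichlet_partial g s N.*2 + c%:R * natcpow 2 (- s) * dirichlet_partial h s N)).
    apply: (@cvgD R[i] R[i]^o); first exact: lim2.
    by apply: (@cvgM R[i]); [exact: cvg_cst|exact: dirichlet_limP].
  apply/funext => N; rewrite !dirichlet_partialE.
  elim: N => [|N IH]; first by rewrite !psum0 mulr0 addr0.
  rewrite doubleS !psumS IH /cterm.
  rewrite -[N.*2.+2]doubleS feven // fodd natrD natrM.
  rewrite (_ : natcpow N.+1.*2 _ = natcpow 2 (- s) * natcpow N.+1 (- s)).
    by ring.
  by rewrite -natcpowM // mul2n.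
exact: (cvg_unique (@norm_hausdorff R[i] R[i]^o) (lim2 _ cf) H).
Unshelve. all: by end_near. Qed.

(** The partial sums over the squares up to [N * N] are those of [zeta (2 s)]
    up to [N]. *)
Lemma dirichlet_square s : 1 < complex.Re s ->
  dirichlet square_ind s = zeta (2 * s).
Proof.
move=> s1.
have cs : cvgn (psum (rterm square_ind (complex.Re s))).
  apply: psum_rterm_le (zeta_abs_cvg s1) => m; exact: leq_b1.
have cz : cvgn (psum (rterm (fun=> 1%N) (complex.Re (2 * s)))).
  by apply: zeta_abs_cvg; rewrite Re_double; lra.
have sq : (n * n)%N @[n --> \oo] --> \oo.
  apply/cvgnyPge => A; near=> k.
  have kA : (A <= k)%N by near: k; exists A.
  by apply: leq_trans kA _; case: (k) => // n; rewrite leq_pmulr.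
have H : (fun N => dirichlet_partial square_ind s (N * N)%N) @ \oo --> (zeta (2 * s) : R[i]^o).
  rewrite (_ : (fun N => _) = dirichlet_partial (fun=> 1%N) (2 * s)).
    exact: dirichlet_limP.
  apply/funext => N; rewrite !dirichlet_partialE.
  elim: N => [|N IH]; first by rewrite !psum0.
  rewrite [RHS]psumS -IH [(N.+1 * N.+1)%N]mulSn addSn psumS /psum.
  rewrite (@big_cat_nat _ _ _ (N * N).+1) //=; last by lia.
  rewrite [X in _ + X + _ = _](_ : _ = 0); last first.
    rewrite big_nat_cond; apply: big1 => m; rewrite andbT => /andP[m1 m2].
    rewrite /cterm square_indE; last by lia.
    rewrite (_ : [exists d : 'I__, _] = false) ?mul0r //.
    apply/negbTE/existsPn => d; apply/eqP => E.
    have [dN|Nd] := leqP d N; first by have := leq_mul dN dN; lia.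
    by have := leq_mul Nd Nd; lia.
  rewrite addr0 -addSn -mulSn /cterm square_indE // natcpowM //.
  rewrite (_ : [exists d : 'I__, _] = true).
    rewrite -natcpowD !mul1r; congr (_ + natcpow _ _).
    by rewrite mulr_natl mulr2n opprD.
  have NN : (N.+1 < (N.+1 * N.+1).+1)%N by lia.
  by apply/existsP; exists (Ordinal NN) => /=.
have L : (fun N => dirichlet_partial square_ind s (N * N)%N) @ \oo -->
    (dirichlet square_ind s : R[i]^o).
  have K := dirichlet_limP cs.
  by apply: (@cvg_comp _ _ _ (fun n => n * n)%N (dirichlet_partial square_ind s) _ \oo).
exact: (cvg_unique (@norm_hausdorff R[i] R[i]^o) L H).
Unshelve. all: by end_near. Qed.

(** The terms after the first are dominated by those of the telescoping series
    1/4 (1/(1.2) + 1/(2.3) + ...), so that they add up to at most 1/4. *)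
Lemma zeta_neq0 s : 4 < complex.Re s -> zeta s != 0.
Proof.
move=> s4; apply/eqP => z0.
have cz : cvgn (psum (rterm (fun=> 1%N) (complex.Re s))) by apply: zeta_abs_cvg; lra.
have := dirichlet_limP cz; rewrite -/(zeta s) z0 => /cvgr0Pnorm_lt.
have e0 : (0 : R[i]) < (4^-1)%:C%C by rewrite ltcE /= eqxx invr_gt0 ltr0n.
move=> /(_ _ e0) [N0 _ /(_ N0.+1 (leqnSn _))].
set P := dirichlet_partial _ _ _ => HP.
have P1 : `|P - 1| <= (4^-1)%:C%C.
  rewrite /P dirichlet_partialE /psum big_ltn // {1}/cterm natcpow1 mulr1 addrAC subrr add0r.
  apply: le_trans (ler_norm_sum _ _ _) _.
  under eq_bigr do rewrite norm_cterm.
  rewrite -rmorph_sum lecR.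
  apply: (@le_trans _ _ (\sum_(2 <= m < N0.+2) 4^-1 * (m.-1%:R^-1 - m%:R^-1))).
    apply: ler_sum_nat => m /andP[m2 _].
    have m0 : (0 : R) < m%:R by rewrite ltr0n; lia.
    have l0 : 0 <= ln m%:R :> R by rewrite ln_ge0 // ler1n; lia.
    apply: (@le_trans _ _ (expR (- 4 * ln m%:R))).
      by rewrite /rterm mul1r ler_expR ler_wpM2r //; lra.
    rewrite mulNr -[4]/(4%:R) expRN expRM_natl lnK //.
    have -> : (m.-1%:R : R) = m%:R - 1 by rewrite -subn1 natrB //; lia.
    have : (2 : R) <= m%:R by rewrite ler_nat.
    move: (m%:R : R) m0 => t t0 t2.
    have -> : 4^-1 * ((t - 1)^-1 - t^-1) = (4 * ((t - 1) * t))^-1.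
      by field; rewrite !gt_eqF //; lra.
    have A : 4 * (t - 1) <= t ^+ 2 by have := sqr_ge0 (t - 2); rewrite !expr2; lra.
    have B : t <= t ^+ 2 by rewrite expr2 -{1}[t]mul1r ler_wpM2r; lra.
    have t1 : 0 < t - 1 by lra.
    rewrite lef_pV2 ?posrE ?mulr_gt0 ?exprn_gt0 //.
    have -> : t ^+ 4 = t ^+ 2 * t ^+ 2 by ring.
    by rewrite mulrA ler_pM //; lra.
  rewrite -mulr_sumr -[leRHS]mulr1 ler_wpM2l //.
  rewrite big_add1 /= (@telescope_sumr_eq _ 1 N0.+1 (fun k => - k%:R^-1)) //.
    by rewrite opprK addrC invr1 gerBl invr_ge0.
  by move=> k _; rewrite opprK addrC.
have : (1 : R[i]) < (2^-1)%:C%C.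
  have E : (2^-1)%:C%C = (4^-1)%:C%C + (4^-1)%:C%C :> R[i].
    by rewrite -rmorphD; congr (_%:C%C); lra.
  have -> : (1 : R[i]) = `|P - (P - 1)| by rewrite opprB addrC subrK normr1.
  by rewrite E; apply: le_lt_trans (ler_normB _ _) _; exact: ltr_leD.
by rewrite -[1](rmorph1 (real_complex R)) ltcR; lra.
Qed.

End ComplexSeries.

Definition squarefree_ind (n : nat) : nat := squarefree n.

(** The coefficients of [(1 - 2^(1-s)) zeta(s-1) zeta(s) / zeta(2s)], since
    [zeta(s) / zeta(2s)] is the series of the squarefree numbers and
    [(1 - 2^(1-s)) zeta(s-1)] the one of [odd_id]. *)
Definition csp_coef : nat -> nat := dconv squarefree_ind odd_id.

Section Asymptotics.
Variable R : realType.
Implicit Types (s : R[i]) (f g : nat -> nat) (x : R).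

Lemma dirichlet_partial_ext f g s : (forall n, (0 < n)%N -> f n = g n) ->
  dirichlet_partial f s = dirichlet_partial g s.
Proof.
by move=> fg; apply/funext => N; apply: eq_big_nat => m /andP[m0 _]; rewrite fg.
Qed.

Lemma psum_rterm_ext f g x : (forall n, (0 < n)%N -> f n = g n) ->
  psum (rterm f x) = psum (rterm g x).
Proof.
move=> fg; apply/funext => N; apply: eq_big_nat => m /andP[m0 _].
by rewrite /rterm fg.
Qed.

Lemma squarefree_abs_cvg x : 1 < x -> cvgn (psum (rterm squarefree_ind x)).
Proof. by move/zeta_abs_cvg; apply: psum_rterm_le => m; exact: leq_b1. Qed.

Lemma odd_id_abs_cvg x : 2 < x -> cvgn (psum (rterm odd_id x)).
Proof. by move/id_abs_cvg; apply: psum_rterm_le => m; rewrite /odd_id; case: odd. Qed.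

Lemma csp_coef_abs_cvg x : 2 < x -> cvgn (psum (rterm csp_coef x)).
Proof.
move=> x2; have /cvg_ex[u Hu] := @squarefree_abs_cvg x ltac:(lra).
have /cvg_ex[v Hv] := odd_id_abs_cvg x2.
by apply/cvg_ex; exists (u * v); exact: rterm_dconv_cvg.
Qed.

Lemma dirichlet_squarefree s : 1 < complex.Re s ->
  dirichlet squarefree_ind s * zeta (2 * s) = zeta s.
Proof.
move=> s1; rewrite -dirichlet_square // -dirichlet_dconv.
- by rewrite /zeta /dirichlet (dirichlet_partial_ext _ squarefree_square_dconv).
- exact: squarefree_abs_cvg.
by apply: psum_rterm_le (zeta_abs_cvg s1) => m; exact: leq_b1.
Qed.

(** Removing the even terms [2 m] from the series of the identity subtracts
    [2 * 2 ^ (- s)] times that series. *)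
Lemma dirichlet_odd_id s : 2 < complex.Re s ->
  dirichlet odd_id s = (1 - natcpow 2 (1 - s)) * zeta (s - 1).
Proof.
move=> s2.
have := @dirichlet_even_split R id odd_id id 2 s _ _
  (id_abs_cvg s2) (odd_id_abs_cvg s2) (id_abs_cvg s2).
rewrite dirichlet_id natcpowD natcpow_1 // => E.
rewrite mulrBl mul1r {1}E ?addrK //.
  by move=> m; rewrite /odd_id /= odd_double.
by move=> m _; rewrite /odd_id odd_double mul2n.
Qed.

Lemma dirichlet_csp_coef s : 2 < complex.Re s ->
  dirichlet csp_coef s = zetaJ (s / 2) / zeta (2 * s).
Proof.
move=> s2; have s1 : 1 < complex.Re s by lra.
rewrite /csp_coef dirichlet_dconv; [|exact: squarefree_abs_cvg|exact: odd_id_abs_cvg].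
have z0 : zeta (2 * s) != 0.
  by apply: zeta_neq0; rewrite Re_double; lra.
rewrite /zetaJ mulrCA divff ?pnatr_eq0 // mulr1 -[X in _ = _ * X * _ / _]dirichlet_squarefree //.
by rewrite dirichlet_odd_id // -[s - 1 in RHS]/(s - 1); field.
Qed.

Lemma cterm_real f x m : cterm f x%:C%C m = (rterm f x m)%:C%C.
Proof.
rewrite /cterm /rterm /natcpow -rmorphN -rmorphM /cexp /= cos0 sin0.
by rewrite mulr1 rmorphM rmorph_nat.
Qed.

Lemma dirichlet_real f x (l : R) : psum (rterm f x) @ \oo --> l ->
  dirichlet f x%:C%C = l%:C%C.
Proof.
move=> fl; apply: dirichlet_unique.
rewrite (_ : dirichlet_partial _ _ = fun N => (psum (rterm f x) N)%:C%C).
  exact: cvg_real_complex.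
apply/funext => N; rewrite dirichlet_partialE /psum rmorph_sum.
by apply: eq_bigr => m _; exact: cterm_real.
Qed.

Lemma rterm_nat f (a m : nat) : (0 < m)%N ->
  rterm f (a%:R : R) m = (f m)%:R * m%:R ^- a.
Proof.
by move=> m0; rewrite /rterm mulNr expRN expRM_natl lnK // posrE ltr0n.
Qed.

Lemma psum_rterm_zetasum (a : nat) : psum (rterm (fun=> 1%N) (a%:R : R)) = zetasum R a.
Proof.
by apply/funext => N; apply: eq_big_nat => m /andP[m0 _]; rewrite rterm_nat // mul1r.
Qed.

(** Multiplied by the sum over the squares, which is [zeta 4], this gives
    [zeta 2], by [squarefree_square_dconv]; and
    [(pi ^ 2 / 6) / (pi ^ 4 / 90) = 15 / pi ^ 2]. *)
Lemma squarefree_sum :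
  psum (rterm squarefree_ind (2 : R)) @ \oo --> 15 / pi ^+ 2.
Proof.
have c1 : 1 < (2 : R) by rewrite ltr1n.
have /cvg_ex[u Hu] := squarefree_abs_cvg c1.
have csq : cvgn (psum (rterm square_ind (2 : R))).
  by apply: psum_rterm_le (zeta_abs_cvg c1) => m; exact: leq_b1.
have /cvg_ex[v Hv] := csq.
have vE : v = pi ^+ 4 / 90.
  apply: (@complexI R); rewrite -(dirichlet_real Hv) dirichlet_square ?rmorph_nat //.
  rewrite -natrM -(rmorph_nat (real_complex R)); apply: dirichlet_real.
  by rewrite psum_rterm_zetasum; exact: zeta4_cvg.
have := rterm_dconv_cvg Hu Hv.
rewrite (psum_rterm_ext 2 squarefree_square_dconv) psum_rterm_zetasum.
move=> /(cvg_unique (@Rhausdorff R) (@zeta2_cvg R)); rewrite vE => E.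
suff -> : 15 / pi ^+ 2 = u :> R by [].
have : 0 < pi :> R := pi_gt0 R; move: pi E => p E p0.
have -> : u = (u * (p ^+ 4 / 90)) * (90 / p ^+ 4) by field; rewrite gt_eqF.
by rewrite -E; field; rewrite gt_eqF.
Qed.

(** The first [k] odd numbers add up to [k ^ 2]. *)
Lemma psum_odd_id (n : nat) : psum (fun m => (odd_id m)%:R : R) n = (uphalf n)%:R ^+ 2.
Proof.
elim: n => [|n IH]; first by rewrite psum0 expr0n.
rewrite psumS IH /odd_id /= uphalf_half; have := odd_double_half n.
case: (odd n) => /= nE; first by rewrite addr0.
by rewrite -{2}nE !add0n -!natr1 -mul2n natrM; ring.
Qed.

Lemma uphalf_divn_approx (N k : nat) : (0 < k <= N)%N ->
  `|(uphalf (N %/ k))%:R ^+ 2 - 4^-1 * N%:R ^+ 2 * k%:R ^- 2| <= N%:R * k%:R^-1 :> R.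
Proof.
move=> /andP[k0 kN].
have kR : 0 < k%:R :> R by rewrite ltr0n.
set x : R := N%:R * k%:R^-1.
have -> : 4^-1 * N%:R ^+ 2 * k%:R ^- 2 = x ^+ 2 / 4.
  by rewrite /x; field; rewrite gt_eqF.
have x1 : 1 <= x by rewrite /x ler_pdivlMr // mul1r ler_nat.
set n := (N %/ k)%N.
have n1 : n%:R <= x.
  by rewrite /x ler_pdivlMr // -natrM ler_nat leq_trunc_div.
have n2 : x <= n%:R + 1.
  by rewrite /x ler_pdivrMr // natr1 -natrM ler_nat ltnW // ltn_ceil.
have u1 : n%:R <= 2 * (uphalf n)%:R :> R by rewrite -natrM ler_nat; lia.
have u2 : 2 * (uphalf n)%:R <= n%:R + 1 :> R by rewrite natr1 -natrM ler_nat; lia.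
have u0 : 0 <= (uphalf n)%:R :> R by [].
move: ((uphalf n)%:R : R) u1 u2 u0 => u u1 u2 u0.
have A : 0 <= (x + 1 - 2 * u) * (x + 1 + 2 * u) by apply: mulr_ge0; lra.
have B : 0 <= (2 * u - (x - 1)) * (2 * u + (x - 1)) by apply: mulr_ge0; lra.
by rewrite ler_norml; apply/andP; split; lra.
Qed.

(** Sum [odd_id] over the cofactor first: the odd numbers up to [N / k] add up
    to [N^2 / (4 k^2)] with an error of at most [N / k], by [psum_odd_id] and
    [uphalf_divn_approx]. The errors total [N] times a harmonic sum, which is
    [N^2] times a Cesaro mean that tends to 0. *)
Lemma csp_coef_asymptotic :
  (\sum_(1 <= m < N.+1) csp_coef m)%N%:R / (15 * N%:R ^+ 2 / (4 * pi ^+ 2))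
    @[N --> \oo] --> (1 : R).
Proof.
pose F N : R := (\sum_(1 <= m < N.+1) csp_coef m)%N%:R.
pose S N : R := psum (rterm squarefree_ind 2) N.
have FE N : F N = \sum_(1 <= k < N.+1) (squarefree_ind k)%:R * (uphalf (N %/ k))%:R ^+ 2.
  transitivity (psum (fun k => \sum_(d <- divisors k)
      (squarefree_ind d)%:R * (odd_id (k %/ d)%N)%:R) N : R).
    rewrite /F natr_sum; apply: eq_bigr => k _; rewrite /csp_coef /dconv natr_sum.
    by apply: eq_bigr => d _; rewrite natrM.
  rewrite (psum_dconv (fun d => (squarefree_ind d)%:R) (fun d => (odd_id d)%:R)).
  by apply: eq_bigr => k _; rewrite psum_odd_id.
have bound N : `|F N.+1 / N.+1%:R ^+ 2 - 4^-1 * S N.+1| <= arithmetic_mean harmonic N.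
  have N0 : 0 < N.+1%:R :> R by rewrite ltr0n.
  rewrite -(ler_pM2r (exprn_gt0 2 N0)).
  rewrite -[X in _ * X <= _](gtr0_norm (exprn_gt0 2 N0)) -normrM mulrBl mulfVK ?gt_eqF ?exprn_gt0 //.
  rewrite FE /S /psum mulr_sumr mulr_suml -sumrB.
  apply: le_trans (ler_norm_sum _ _ _) _.
  rewrite /arithmetic_mean /series /= [leRHS](_ : _ =
     \sum_(1 <= k < N.+2) N.+1%:R * k%:R^-1); last first.
    rewrite big_add1 /= -mulr_sumr; field.
    by rewrite addrC natr1 gt_eqF.
  apply: ler_sum_nat => k kN; rewrite rterm_nat; last by case/andP: kN.
  have := @uphalf_divn_approx N.+1 k; rewrite -ltnS => /(_ kN).
  rewrite (_ : 4^-1 * ((squarefree_ind k)%:R * _) * _ = (squarefree_ind k)%:R *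
     (4^-1 * N.+1%:R ^+ 2 * k%:R ^- 2)); last by ring.
  rewrite -mulrBr normrM normr_nat; apply: le_trans.
  rewrite ler_piMl // -[1]/(1%:R) ler_nat; exact: leq_b1.
have L : F N / N%:R ^+ 2 @[N --> \oo] --> 4^-1 * (15 / pi ^+ 2).
  rewrite -(cvg_shiftS (fun N => F N / N%:R ^+ 2)).
  have S1 : (fun N => 4^-1 * S N.+1) @ \oo --> 4^-1 * (15 / pi ^+ 2).
    apply: cvgM; first exact: cvg_cst.
    by rewrite (cvg_shiftS S); exact: squarefree_sum.
  have D : (fun N => F N.+1 / N.+1%:R ^+ 2 - 4^-1 * S N.+1) @ \oo --> (0 : R).
    apply/norm_cvg0P; apply: (@squeeze_cvgr _ _ _ _ (fun=> 0) (arithmetic_mean harmonic)).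
    - by near=> N; rewrite normr_ge0 bound.
    - exact: cvg_cst.
    - by apply: cesaro; exact: cvg_harmonic.
  rewrite -[4^-1 * (15 / pi ^+ 2)]add0r.
  rewrite [G in G @ _ --> _](_ : _ =
    (fun N => F N.+1 / N.+1%:R ^+ 2 - 4^-1 * S N.+1) \+ (fun N => 4^-1 * S N.+1)).
    exact: cvgD.
  by apply/funext => N /=; rewrite subrK.
have p0 : 0 < pi :> R := pi_gt0 R.
have E : (4^-1 * (15 / pi ^+ 2)) * ((4 * pi ^+ 2) / 15) = 1 :> R.
  by move: pi p0 => p p0; field; rewrite gt_eqF.
have : F N / N%:R ^+ 2 * ((4 * pi ^+ 2) / 15) @[N --> \oo] -->
    (4^-1 * (15 / pi ^+ 2)) * ((4 * pi ^+ 2) / 15).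
  by apply: cvgM => //; exact: cvg_cst.
rewrite E; apply: cvg_trans; apply: near_eq_cvg; near=> N.
by rewrite -/(F N) -[LHS]mulrA; congr (_ * _); rewrite invf_div [(15 * _)^-1]invfM [RHS]mulrA mulrC.
Unshelve. all: by end_near. Qed.

End Asymptotics.

(** * Quaternions and Euler's rotation matrices *)

Definition i0 : 'I_3 := ord0.
Definition i1 : 'I_3 := lift ord0 ord0.
Definition i2 : 'I_3 := lift ord0 (lift ord0 ord0).

Lemma ord3P (P : 'I_3 -> Prop) : P i0 -> P i1 -> P i2 -> forall i, P i.
Proof.
move=> P0 P1 P2 [[|[|[|//]]] lt_i].
- by rewrite (_ : Ordinal lt_i = i0) //; apply/val_inj.
- by rewrite (_ : Ordinal lt_i = i1) //; apply/val_inj.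
- by rewrite (_ : Ordinal lt_i = i2) //; apply/val_inj.
Qed.

Lemma sum3E (V : nmodType) (F : 'I_3 -> V) : \sum_i F i = F i0 + (F i1 + F i2).
Proof. by rewrite !big_ord_recl big_ord0 addr0. Qed.

Section Vectors.
Variable K : comNzRingType.
Implicit Types (p q : quat K) (y z : 'cV[K]_3).

Definition cv3 (a b c : K) : 'cV[K]_3 := \col_i [:: a; b; c]`_i.

Lemma cv3P y z : y i0 0 = z i0 0 -> y i1 0 = z i1 0 -> y i2 0 = z i2 0 -> y = z.
Proof. by move=> *; apply/colP; apply: ord3P. Qed.

Lemma cv3E y : y = cv3 (y i0 0) (y i1 0) (y i2 0).
Proof. by apply: cv3P; rewrite mxE. Qed.

Definition dot y z : K := y i0 0 * z i0 0 + y i1 0 * z i1 0 + y i2 0 * z i2 0.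

Definition cross y z : 'cV[K]_3 :=
  cv3 (y i1 0 * z i2 0 - y i2 0 * z i1 0)
      (y i2 0 * z i0 0 - y i0 0 * z i2 0)
      (y i0 0 * z i1 0 - y i1 0 * z i0 0).

Lemma mulmx3E (A : 'M[K]_3) y i :
  (A *m y) i 0 = A i i0 * y i0 0 + A i i1 * y i1 0 + A i i2 * y i2 0.
Proof. by rewrite mxE sum3E addrA. Qed.

Lemma dotE y z : dot y z = (y^T *m z) 0 0.
Proof. by rewrite mxE sum3E addrA !mxE. Qed.

Lemma dot_mulmx (A : 'M[K]_3) y z : dot (A *m y) z = dot y (A^T *m z).
Proof. by rewrite !dotE trmx_mul mulmxA. Qed.

Lemma dotC y z : dot y z = dot z y.
Proof. by rewrite /dot; ring. Qed.

Lemma dotDr y z1 z2 : dot y (z1 + z2) = dot y z1 + dot y z2.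
Proof. by rewrite /dot !mxE; ring. Qed.

Lemma dotNr y z : dot y (- z) = - dot y z.
Proof. by rewrite /dot !mxE; ring. Qed.

Lemma dotZr k y z : dot y (k *: z) = k * dot y z.
Proof. by rewrite /dot !mxE; ring. Qed.

Lemma dotZl k y z : dot (k *: y) z = k * dot y z.
Proof. by rewrite dotC dotZr dotC. Qed.

Lemma crossK u y z :
  dot u z *: y - dot u y *: z = cross (cross z y) u.
Proof. by apply: cv3P; rewrite /dot /cross !mxE /=; ring. Qed.

Definition qconj q : quat K := Quat (qc0 q) (- qc1 q) (- qc2 q) (- qc3 q).

Definition qscale (k : K) q : quat K :=
  Quat (k * qc0 q) (k * qc1 q) (k * qc2 q) (k * qc3 q).

Definition qpure y : quat K := Quat 0 (y i0 0) (y i1 0) (y i2 0).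

Lemma qmulA p q r : qmul p (qmul q r) = qmul (qmul p q) r.
Proof. by case: p q r => ? ? ? ? [? ? ? ?] [? ? ? ?] /=; congr Quat; ring. Qed.

Lemma qnorm2M p q : qnorm2 (qmul p q) = qnorm2 p * qnorm2 q.
Proof. by case: p q => ? ? ? ? [? ? ? ?]; rewrite /qnorm2 /=; ring. Qed.

Lemma qnorm2_conj q : qnorm2 (qconj q) = qnorm2 q.
Proof. by rewrite /qnorm2 /= !sqrrN. Qed.

Lemma qnorm2_scale k q : qnorm2 (qscale k q) = k ^+ 2 * qnorm2 q.
Proof. by rewrite /qnorm2 /=; ring. Qed.

Lemma qmul_conj q : qmul q (qconj q) = Quat (qnorm2 q) 0 0 0.
Proof. by case: q => ? ? ? ?; rewrite /qnorm2 /=; congr Quat; ring. Qed.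

Lemma qconjM p q : qconj (qmul p q) = qmul (qconj q) (qconj p).
Proof. by case: p q => ? ? ? ? [? ? ? ?]; rewrite /qconj /=; congr Quat; ring. Qed.

Lemma qconjK : involutive qconj.
Proof. by case=> a b c d; rewrite /qconj /= !opprK. Qed.

Lemma qnorm2_pure y : qnorm2 (qpure y) = dot y y.
Proof. by rewrite /qnorm2 /dot /=; ring. Qed.

(** The matrix of [y |-> q y conj(q)], which is the rotation by [q] scaled by
    the norm of [q]. *)
Definition euler q : 'M[K]_3 :=
  let: Quat a b c d := q in
  \matrix_(i, j) (nth [::] [:: [:: a ^+ 2 + b ^+ 2 - c ^+ 2 - d ^+ 2;
                        (b * c - a * d) *+ 2; (b * d + a * c) *+ 2];
                     [:: (b * c + a * d) *+ 2;
                        a ^+ 2 - b ^+ 2 + c ^+ 2 - d ^+ 2; (c * d - a * b) *+ 2];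
                     [:: (b * d - a * c) *+ 2; (c * d + a * b) *+ 2;
                        a ^+ 2 - b ^+ 2 - c ^+ 2 + d ^+ 2]] i)`_j.

Lemma qpure_euler q y : qpure (euler q *m y) = qmul (qmul q (qpure y)) (qconj q).
Proof.
case: q => a b c d; rewrite /qpure !mulmx3E !mxE /=.
by congr Quat; ring.
Qed.

Lemma qpure_inj : injective qpure.
Proof. by move=> y z [] *; apply: cv3P. Qed.

Lemma mulmx_ext3 (A B : 'M[K]_3) : (forall y, A *m y = B *m y) -> A = B.
Proof.
move=> AB; apply/matrixP => i j; have := AB (delta_mx j 0).
by rewrite -!colE => /colP/(_ i); rewrite !mxE.
Qed.

Lemma eulerM p q : euler (qmul p q) = euler p *m euler q.
Proof.
apply: mulmx_ext3 => y; apply: qpure_inj.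
by rewrite -mulmxA !qpure_euler qconjM !qmulA.
Qed.

Lemma euler_conj q : euler (qconj q) = (euler q)^T.
Proof.
case: q => a b c d; apply/matrixP.
by apply: ord3P; apply: ord3P; rewrite !mxE /=; ring.
Qed.

Lemma euler_scale k q : euler (qscale k q) = k ^+ 2 *: euler q.
Proof.
case: q => a b c d; apply/matrixP.
by apply: ord3P; apply: ord3P; rewrite !mxE /=; ring.
Qed.

Lemma euler_orth q : euler q *m (euler q)^T = (qnorm2 q ^+ 2)%:M.
Proof.
rewrite -euler_conj -eulerM qmul_conj; apply/matrixP.
by apply: ord3P; apply: ord3P; rewrite !mxE /=; ring.
Qed.

Lemma euler_orthT q : (euler q)^T *m euler q = (qnorm2 q ^+ 2)%:M.
Proof.
by rewrite -euler_conj -{2}(qconjK q) [in euler (qconj (qconj q))]euler_conj euler_orth qnorm2_conj.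
Qed.

Lemma det_euler q : \det (euler q) = qnorm2 q ^+ 3.
Proof.
case: q => a b c d; rewrite (expand_det_row _ i0) sum3E /cofactor.
rewrite !(expand_det_row _ ord0) !big_ord_recl !big_ord0 /cofactor !det_mx11.
by rewrite !mxE /= /qnorm2 /=; ring.
Qed.

(** Rotations preserve the cross product; the Euler matrix is [|q|^2] times a
    rotation. *)
Lemma cross_euler q y z :
  cross (euler q *m y) (euler q *m z) = qnorm2 q *: (euler q *m cross y z).
Proof.
rewrite (cv3E y) (cv3E z); move: (y i0 0) (y i1 0) (y i2 0) => y0 y1 y2.
move: (z i0 0) (z i1 0) (z i2 0) => z0 z1 z2.
case: q => a b c d; rewrite /qnorm2.
by apply: cv3P; rewrite /cross !(mulmx3E, mxE) /=; ring.
Qed.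

End Vectors.

(** * Integer quaternions *)

Definition qdvd (d : int) (q : quat int) : bool :=
  [&& (d %| qc0 q)%Z, (d %| qc1 q)%Z, (d %| qc2 q)%Z & (d %| qc3 q)%Z].

Lemma qdvdE d q : qdvd d q = (d %| gcdz (gcdz (qc0 q) (qc1 q)) (gcdz (qc2 q) (qc3 q)))%Z.
Proof. by rewrite !dvdz_gcd -andbA. Qed.

Lemma primitiveP (q : quat int) :
  primitive q <-> forall d, qdvd d q -> (d %| 1)%Z.
Proof.
rewrite /primitive; split=> [E d|H]; first by rewrite qdvdE E.
have /H : qdvd (gcdz (gcdz (qc0 q) (qc1 q)) (gcdz (qc2 q) (qc3 q))) q by rewrite qdvdE dvdzz.
by rewrite dvdz1 => /eqP E; rewrite -[LHS]gez0_abs ?E.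
Qed.

Lemma qdvd_mulr d p q : qdvd d p -> qdvd d (qmul p q).
Proof.
case: p q => a b c e [a' b' c' e']; rewrite /qdvd /= => /and4P[da db dc de].
by rewrite !(rpredB, rpredD) // dvdz_mulr.
Qed.

Lemma qdvd_conj d q : qdvd d (qconj q) = qdvd d q.
Proof. by rewrite /qdvd /= !rpredN. Qed.

Lemma qdvd_norm d q : qdvd d q -> (d %| qnorm2 q)%Z.
Proof. by case/and4P=> *; rewrite /qnorm2 !rpredD // dvdz_exp. Qed.

Lemma qdvdP d q : reflect (exists p, q = qscale d p) (qdvd d q).
Proof.
apply: (iffP and4P) => [[]|[p ->]].
  case: q => a b c e /= /dvdzP[a' ->] /dvdzP[b' ->] /dvdzP[c' ->] /dvdzP[e' ->].
  by exists (Quat a' b' c' e'); rewrite /qscale /=; congr Quat; rewrite mulrC.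
by split; rewrite dvdz_mulr.
Qed.

Lemma qnorm2_ge0 (q : quat int) : 0 <= qnorm2 q.
Proof. by rewrite /qnorm2 !addr_ge0 ?sqr_ge0. Qed.

Lemma qnorm2_eq0 (q : quat int) : qnorm2 q = 0 -> q = Quat 0 0 0 0.
Proof.
case: q => a b c d; rewrite /qnorm2 /= => E.
have := sqr_ge0 a; have := sqr_ge0 b; have := sqr_ge0 c; have := sqr_ge0 d.
move=> d0 c0 b0 a0.
have z (x : int) : x ^+ 2 = 0 -> x = 0 by move/eqP; rewrite sqrf_eq0 => /eqP.
by congr Quat; apply: z; lia.
Qed.

Definition one_plus_unit (u : quat int) : Prop :=
  [\/ u = Quat 1 1 0 0, u = Quat 1 0 1 0 | u = Quat 1 0 0 1].

Lemma sqr_parity (x : int) : exists t, x ^+ 2 = x + 2 * t.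
Proof.
have [k [->|->]] : exists k, x = 2 * k \/ x = 2 * k + 1 by exists (x %/ 2)%Z; lia.
  by exists (2 * k ^+ 2 - k); ring.
by exists (2 * k ^+ 2 + k); ring.
Qed.

(** The number of odd components is even, so the components form two pairs of
    equal parity. If the first one is paired with that of [i], the product with
    [(1 - i) / 2] is integral; similarly for [j] and [k]. *)
Lemma qmul_one_plus_unit (v : quat int) : (2 %| qnorm2 v)%Z ->
  exists r u, v = qmul r u /\ one_plus_unit u.
Proof.
case: v => a b c d; rewrite /qnorm2 /= => E.
have {}E : (2 %| a + b + c + d)%Z.
  by move: (sqr_parity a) (sqr_parity b) (sqr_parity c) (sqr_parity d) E => [? ->] [? ->] [? ->] [? ->]; lia.
have [ab|ab] := boolP (2 %| a + b)%Z.
  exists (Quat ((a + b) %/ 2)%Z ((b - a) %/ 2)%Z ((c - d) %/ 2)%Z ((c + d) %/ 2)%Z).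
  exists (Quat 1 1 0 0); split; last exact: Or31.
  by congr Quat; lia.
have [ac|ac] := boolP (2 %| a + c)%Z.
  exists (Quat ((a + c) %/ 2)%Z ((b + d) %/ 2)%Z ((c - a) %/ 2)%Z ((d - b) %/ 2)%Z).
  exists (Quat 1 0 1 0); split; last exact: Or32.
  by congr Quat; lia.
exists (Quat ((a + d) %/ 2)%Z ((b - c) %/ 2)%Z ((b + c) %/ 2)%Z ((d - a) %/ 2)%Z).
exists (Quat 1 0 0 1); split; last exact: Or33.
by congr Quat; lia.
Qed.

Lemma centered_mod (x k : int) : 0 < k ->
  exists y t, [/\ x = y + k * t, 2 * y <= k & - k <= 2 * y].
Proof.
move=> k0; have E := divz_eq x k.
exists (if 2 * (x %% k)%Z <= k then (x %% k)%Z else (x %% k)%Z - k).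
exists (if 2 * (x %% k)%Z <= k then (x %/ k)%Z else (x %/ k)%Z + 1).
have := modz_ge0 x (lt0r_neq0 k0); have := ltz_pmod x k0.
by move: (x %% k)%Z (x %/ k)%Z E => a b E; case: ifP; split; nia.
Qed.

(** The quaternion form of Lagrange's descent. If [k] is even, a factor of norm
    2 splits off on the right; a common factor of [v] and [k] is divided out;
    otherwise the conjugate of [v] reduced modulo [k] has norm [k k'] with
    [k' < k], so that by induction [conj v] is left divisible by a quaternion of
    norm [k], whose cofactor has norm [m]. *)
Lemma norm_left_factor (m k : int) (v : quat int) :
  (m %% 2)%Z = 1 -> 0 < m -> 0 < k -> qnorm2 v = m * k ->
  (forall d, qdvd d v -> (d %| m)%Z -> (d %| 1)%Z) ->
  exists q a, v = qmul q a /\ qnorm2 q = m.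
Proof.
have [n] := ubnP `|k|%N; elim: n m k v => // n IH m k v kn m1 m0 k0 vmk vm.
have [k1|k1] := eqVneq k 1.
  exists v, (Quat 1 0 0 0); split; last by rewrite vmk k1 mulr1.
  by case: (v) => *; rewrite /=; congr Quat; ring.
have [k2|k2] := boolP (2 %| k)%Z.
  have /qmul_one_plus_unit[r [u [vE uE]]] : (2 %| qnorm2 v)%Z.
    by rewrite vmk dvdz_mull.
  have uN : qnorm2 u = 2 by case: uE => ->.
  case/dvdzP: k2 => k' kE.
  have rN : qnorm2 r = m * k'.
    by move: vmk; rewrite vE qnorm2M uN kE mulrA => /mulIf; apply.
  have [|||q [a [ra qN]]] := IH m k' r _ m1 m0 _ rN; first by lia.
  - by lia.
  - by move=> d dr; apply: vm; rewrite vE qdvd_mulr.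
  by exists q, (qmul a u); rewrite qmulA -ra.
have [[d [dv dk d1]]|H] := pselect (exists d, [/\ qdvd d v, (d %| k)%Z & ~ (d %| 1)%Z]).
  have cdm : coprimez (d ^+ 2) m.
    rewrite coprimezXl // /coprimez.
    have G : qdvd (gcdz d m) v.
      case/and4P: dv => d0 d1' d2 d3; have dl := dvdz_gcdl d m.
      by rewrite /qdvd !(dvdz_trans dl).
    have := vm _ G (dvdz_gcdr _ _); rewrite dvdz1 => /eqP E.
    by apply/eqP; rewrite -[LHS]gez0_abs ?E.
  case/qdvdP: dv => v' vE.
  have : (d ^+ 2 %| m * k)%Z by rewrite -vmk vE qnorm2_scale dvdz_mulr.
  rewrite Gauss_dvdzr // => /dvdzP[k' kE].
  have d0 : d != 0 by apply: contraPneq dk => ->; rewrite dvd0z; lia.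
  have dd : 1 < d ^+ 2.
    suff : 1 < `|d| by rewrite -[d ^+ 2]real_normK ?num_real //; nia.
    by move/negP: d1; rewrite dvdz1; lia.
  have v'N : qnorm2 v' = m * k'.
    apply: (mulfI (lt0r_neq0 (lt_trans ltr01 dd))).
    by rewrite -qnorm2_scale -vE vmk kE; ring.
  have k'0 : 0 < k' by move: k0 dd; rewrite kE; nia.
  have k'k : k' < k by move: k0 dd k'0; rewrite kE; nia.
  have [||q [a [v'E qN]]] := IH m k' v' _ m1 m0 k'0 v'N; first by lia.
    move=> e ev; apply: vm; rewrite vE; case/and4P: ev => *.
    by rewrite /qdvd /= !dvdz_mull.
  exists q, (qscale d a); split=> //; rewrite vE v'E.
  by case: (q) (a) => ? ? ? ? [? ? ? ?]; rewrite /qscale /=; congr Quat; ring.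
have kodd : (k %% 2)%Z = 1 by lia.
have [w [c [vE wk]]] : exists w c, qconj v = Quat (qc0 w + k * qc0 c)
    (qc1 w + k * qc1 c) (qc2 w + k * qc2 c) (qc3 w + k * qc3 c) /\ qnorm2 w < k ^+ 2.
  case: (qconj v) => x0 x1 x2 x3.
  have [y0 [t0 [-> a0 b0]]] := centered_mod x0 k0.
  have [y1 [t1 [-> a1 b1]]] := centered_mod x1 k0.
  have [y2 [t2 [-> a2 b2]]] := centered_mod x2 k0.
  have [y3 [t3 [-> a3 b3]]] := centered_mod x3 k0.
  exists (Quat y0 y1 y2 y3), (Quat t0 t1 t2 t3); split=> //; rewrite /qnorm2 /=.
  have lt (y : int) : 2 * y <= k -> - k <= 2 * y -> 4 * y ^+ 2 < k ^+ 2.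
    move=> a b; have [c1 c2] : 2 * y < k /\ - k < 2 * y by lia.
    have : 0 < (k - 2 * y) * (k + 2 * y) by apply: mulr_gt0; lia.
    by lia.
  by have := lt _ a0 b0; have := lt _ a1 b1; have := lt _ a2 b2; have := lt _ a3 b3; lia.
have [k' wN] : exists k', qnorm2 w = k * k'.
  have := qnorm2_conj v; rewrite vmk vE /qnorm2 /= => E.
  exists (m - (2 * (qc0 w * qc0 c + qc1 w * qc1 c + qc2 w * qc2 c + qc3 w * qc3 c)
    + k * (qc0 c ^+ 2 + qc1 c ^+ 2 + qc2 c ^+ 2 + qc3 c ^+ 2))).
  by rewrite mulrBr [k * m]mulrC -E; ring.
have wv d : qdvd d w -> (d %| k)%Z -> (d %| 1)%Z.
  move=> /and4P[w0 w1 w2 w3] dk; have [//|d1] := boolP (d %| 1)%Z.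
  case: H; exists d; split=> //; last exact/negP.
  by rewrite -qdvd_conj vE /qdvd /= !rpredD // dvdz_mulr.
have k'k : k' < k by move: wk; rewrite wN expr2 ltr_pM2l.
have k'0 : 0 < k'.
  have := qnorm2_ge0 w; rewrite wN pmulr_rge0 // le_eqVlt => /orP[/eqP E|//].
  move: wN; rewrite -E mulr0 => /qnorm2_eq0 w0.
  by have := wv k; rewrite w0 /qdvd /= !dvdz0 dvdzz dvdz1 => /(_ isT isT); lia.
have [|q [a [wE qN]]] := IH k k' w _ kodd k0 k'0 wN wv; first by lia.
have cE : qconj v = qmul q (Quat (qc0 a + qc0 (qmul (qconj q) c))
    (qc1 a + qc1 (qmul (qconj q) c)) (qc2 a + qc2 (qmul (qconj q) c))
    (qc3 a + qc3 (qmul (qconj q) c))).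
  rewrite vE wE -qN; case: (q) (a) (c) => ? ? ? ? [? ? ? ?] [? ? ? ?].
  by rewrite /qnorm2 /=; congr Quat; ring.
move: cE; set b := Quat _ _ _ _ => cE.
exists (qconj b), (qconj q); split; first by rewrite -qconjM -cE qconjK.
have : qnorm2 q * qnorm2 b = m * k by rewrite -qnorm2M -cE qnorm2_conj.
by rewrite qnorm2_conj qN mulrC => /mulIf; apply; lia.
Qed.

(** * Coincidence site lattices as kernels of isotropic functionals *)

Notation "d %|| m" := (m \in dvdz d) (at level 70) : ring_scope.

(** By the first condition [v] is unimodular modulo [m]; it then represents a
    point of the conic [v.v = 0] in the projective plane over [Z/m]. *)
Definition isotropic (m : nat) (v : 'cV[int]_3) : Prop :=
  (exists w, (m%:Z %|| dot v w - 1)) /\ (m%:Z %|| dot v v).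

(** The lattice of all [z] such that [m] divides [conj(q) z q]; when [m] is
    the norm of [q], these are the [z] with integral preimage. *)
Definition euler_kernel (m : nat) (q : quat int) (z : 'cV[int]_3) : Prop :=
  forall i, (m%:Z %|| ((euler q)^T *m z) i 0).

Lemma dvdz_dot (d : int) (u z : 'cV[int]_3) :
  (forall i, (d %|| z i 0)) -> (d %|| dot u z).
Proof. by move=> dz; rewrite /dot !rpredD // dvdz_mull. Qed.

Lemma dvdz_cancel_unit (d x u : int) : d %|| u - 1 -> d %|| x * u -> d %|| x.
Proof.
move=> du dxu; have E : x * u - x * (u - 1) = x by ring.
by rewrite -E rpredB // dvdz_mull.
Qed.

Lemma odd_coprimez2 (m : nat) : odd m -> coprimez m%:Z 2.
Proof. by move=> om; rewrite coprimezE /= coprimen2. Qed.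

(** Up to signs, four times the square of each component of [q] is the sum of [m]
    and the diagonal entries, so an odd prime dividing all of these divides [q]. *)
Lemma euler_content (q : quat int) (m : nat) (d : int) :
  odd m -> primitive q -> qnorm2 q = m%:Z ->
  (forall i j, (d %|| euler q i j)) -> coprimez d m%:Z.
Proof.
move=> om /primitiveP pq qm dq.
have m0 : (0 < m)%N by case: (m) om.
rewrite coprimezE; apply/negPn/negP => ncop.
have g0 : (0 < gcdn `|d| m)%N by rewrite gcdn_gt0 m0 orbT.
have pp : prime (pdiv (gcdn `|d| m)).
  by apply: pdiv_prime; rewrite ltn_neqAle eq_sym ncop.
have := pdiv_dvd (gcdn `|d| m); move: (pdiv _) pp => p pp.
rewrite dvdn_gcd => /andP[pd pm].
have p4 : coprimez p%:Z 4.
  rewrite coprimezE /= (@coprimeXr 2 p 2) // coprimen2.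
  by apply: dvdn_odd pm om.
have pe i j : (p%:Z %|| euler q i j).
  by apply: dvdz_trans (dq i j); rewrite dvdzE.
have pN : (p%:Z %|| qnorm2 q) by rewrite qm dvdzE.
have red (x : int) : (p%:Z %|| 4 * x ^+ 2) -> (p%:Z %|| x).
  by rewrite Gauss_dvdzr // !dvdzE abszX /= Euclid_dvdX // andbT.
have eqd (x y : int) : x = y -> p%:Z %|| x -> p%:Z %|| y by move=> ->.
have : qdvd p%:Z q.
  move: pN (pe i0 i0) (pe i1 i1) (pe i2 i2).
  case: (q) => a b c e; rewrite /qnorm2 !mxE /=.
  move=> h0 h1 h2 h3; apply/and4P; split; apply: red => /=.
  - by apply: eqd (rpredD (rpredD (rpredD h0 h1) h2) h3); ring.
  - by apply: eqd (rpredB (rpredB (rpredD h0 h1) h2) h3); ring.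
  - by apply: eqd (rpredB (rpredD (rpredB h0 h1) h2) h3); ring.
  - by apply: eqd (rpredD (rpredB (rpredB h0 h1) h2) h3); ring.
by move/pq; rewrite dvdz1 /=; move=> /eqP p1; rewrite p1 in pp.
Qed.

(** Modulo [m], the transpose of the Euler matrix has rank one, because it maps
    cross products to multiples of [m] ([cross_euler]); so its kernel is the
    kernel of a single functional. A unimodular one is obtained from the first
    elementary divisor, which is prime to [m]. *)
Lemma euler_kernel_isotropic (q : quat int) (m : nat) :
  odd m -> primitive q -> qnorm2 q = m%:Z ->
  exists2 v, isotropic m v &
    forall z, euler_kernel m q z <-> (m%:Z %|| dot v z).
Proof.
move=> om pq qm.
pose M := (euler q)^T.
have [L Lu [R Ru [d ds ME]]] := int_Smith_normal_form M.
set D := \matrix_(i, j) _ in ME.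
pose u : 'cV[int]_3 := (row i0 (invmx L))^T.
pose w : 'cV[int]_3 := col i0 (invmx R).
have uMw : dot u (M *m w) = d`_0.
  rewrite dotE trmxK /w ME !mulmxA -!row_mul mulVmx // mul1mx.
  rewrite -[RHS](_ : D i0 i0 = _); last by rewrite mxE eqxx.
  transitivity ((D *m R *m invmx R) i0 i0); last by rewrite mulmxK.
  rewrite [LHS]mxE [LHS]mxE [RHS]mxE; apply: eq_bigr => j _.
  by rewrite [col _ _ _ _]mxE.
have /coprimezP[[s t] /= st] : coprimez d`_0 m%:Z.
  apply: (euler_content om pq qm) => i j.
  have -> : euler q i j = M j i by rewrite mxE.
  rewrite ME mxE; apply: rpred_sum => k _; apply: dvdz_mulr.
  rewrite mxE; apply: rpred_sum => l _; apply: dvdz_mull.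
  rewrite mxE; case: (_ == _); rewrite ?mulr0n ?dvdz0 // mulr1n.
  have dle n : (n < size d)%N -> d`_0 %|| d`_n.
    move=> nd; have d0 : (0 < size d)%N := leq_ltn_trans (leq0n n) nd.
    exact: (sorted_leq_nth dvdz_trans dvdzz 0 ds _ _ d0 nd (leq0n n)).
  have [kd|kd] := ltnP l (size d); first exact: dle.
  by rewrite [d`_l]nth_default // dvdz0.
pose u' := s *: u; pose phi := euler q *m u'.
have phiE z : dot phi z = dot u' (M *m z) by rewrite /phi dot_mulmx.
have phiw : dot phi w = 1 - t * m%:Z.
  by rewrite phiE dotZl uMw -st addrK.
exists phi; first split.
- by exists w; rewrite phiw addrAC subrr add0r rpredN dvdz_mull.
- rewrite phiE /phi mulmxA /M euler_orthT mul_scalar_mx dotZr qm expr2.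
  by rewrite -mulrA dvdz_mulr.
move=> z; rewrite phiE; split=> [zk|]; first exact: dvdz_dot.
move=> uz i.
have cr : cross (M *m w) (M *m z) = m%:Z *: (M *m cross w z).
  by rewrite /M -euler_conj cross_euler qnorm2_conj qm.
have entry (a b c : 'cV[int]_3) (k l : int) : k *: a - l *: b = m%:Z *: c ->
    k * a i 0 - l * b i 0 = m%:Z * c i 0.
  by move/colP/(_ i); rewrite !mxE.
have crZ c : cross (m%:Z *: c) u' = m%:Z *: cross c u'.
  by apply: cv3P; rewrite /cross !mxE /=; ring.
have := crossK u' (M *m z) (M *m w); rewrite cr crZ -phiE phiw => /entry.
rewrite mulrBl mul1r => E; rewrite -/M.
move: E; move: ((M *m z) i 0) ((M *m w) i 0) (cross _ _ _ _) => a b c E.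
have -> : a = m%:Z * c + dot u' (M *m z) * b + m%:Z * (t * a) by rewrite -E; ring.
by rewrite !rpredD ?dvdz_mulr.
Qed.

(** By [norm_left_factor] the pure quaternion [v] is [q a] with [q] of norm
    [m]. If [m] divides [conj(q) z q], it divides
    [v z v = (v.v) z - 2 (v.z) v], hence [v.z] because [v] is unimodular and [m]
    odd. So the kernel of [q] is contained in that of [v]. *)
Lemma isotropic_quaternion (m : nat) (v : 'cV[int]_3) :
  odd m -> isotropic m v ->
  exists q, [/\ primitive q, qnorm2 q = m%:Z &
    forall z, euler_kernel m q z <-> (m%:Z %|| dot v z)].
Proof.
move=> om [[w0 vw0] vv]; have m0 : (0 < m)%N by case: (m) om.
have [m1|m1] := eqVneq m 1%N.
  exists (Quat 1 0 0 0); rewrite m1; split=> // z.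
  by split=> _ => [|i]; rewrite dvd1z.
have vdvd d : qdvd d (qpure v) -> (d %|| m%:Z) -> (d %|| 1).
  case/and4P=> _ /= d0 d1 d2 dm.
  have dv : d %|| dot v w0 by rewrite dotC; apply: dvdz_dot; apply: ord3P.
  by rewrite -(subrK (dot v w0) 1) rpredD // -opprB rpredN (dvdz_trans dm).
case/dvdzP: (vv) => k; rewrite mulrC -qnorm2_pure => vk.
have k0 : 0 < k.
  have := qnorm2_ge0 (qpure v); rewrite vk pmulr_rge0 ?ltz_nat // le_eqVlt.
  case/orP=> // /eqP k0; move: vk; rewrite -k0 mulr0 => /qnorm2_eq0 v0.
  by have := vdvd m%:Z; rewrite v0 /qdvd /= !dvdz0 dvdzz dvdz1 => /(_ isT isT)/eqP /= E; rewrite E in m1.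
have modd : (m%:Z %% 2)%Z = 1 by lia.
have [q [a [va qm]]] := norm_left_factor modd (m0 : 0 < m%:Z) k0 vk vdvd.
have pq : primitive q.
  apply/primitiveP => d dq; apply: vdvd; first by rewrite va qdvd_mulr.
  by rewrite -qm qdvd_norm.
exists q; split=> //.
have [phi [[w phiw] _] kphi] := euler_kernel_isotropic om pq qm.
have c2 := odd_coprimez2 om.
have fwd z : euler_kernel m q z -> m%:Z %|| dot v z.
  move=> zk.
  have : qdvd m%:Z (qmul (qmul (qpure v) (qpure z)) (qpure v)).
    have -> : qpure v = qscale (-1) (qmul (qconj a) (qconj q)).
      by rewrite -qconjM -va /qscale /qconj /qpure /=; congr Quat; ring.
    rewrite {2}(_ : qscale (-1) (qmul (qconj a) (qconj q)) = qmul q a); last first.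
      by rewrite -va -qconjM -va /qscale /qconj /qpure /=; congr Quat; ring.
    have zq : qdvd m%:Z (qmul (qmul (qconj q) (qpure z)) q).
      rewrite -{2}(qconjK q) -qpure_euler euler_conj.
      by apply/and4P; split; rewrite ?dvdz0 //; apply: zk.
    case/qdvdP: zq => p pE.
    have -> : qmul (qmul (qscale (-1) (qmul (qconj a) (qconj q))) (qpure z)) (qmul q a) =
        qmul (qscale (-1) (qmul (qconj a) (qmul (qmul (qconj q) (qpure z)) q))) a.
      case: (qconj a) (qconj q) (qpure z) (q) (a) => ? ? ? ? [? ? ? ?] [? ? ? ?] [? ? ? ?] [? ? ? ?].
      by rewrite /qscale /=; congr Quat; ring.
    rewrite pE; apply: qdvd_mulr; apply/qdvdP.
    exists (qscale (-1) (qmul (qconj a) p)).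
    by case: (qconj a) (p) => ? ? ? ? [? ? ? ?]; rewrite /qscale /=; congr Quat; ring.
  have -> : qmul (qmul (qpure v) (qpure z)) (qpure v) =
      qpure (dot v v *: z - (2 * dot v z) *: v).
    by rewrite /qpure /dot !mxE /=; congr Quat; ring.
  case/and4P=> _ /= h0 h1 h2.
  have vv' (x : int) : m%:Z %|| dot v v * x by rewrite dvdz_mulr.
  have h i : m%:Z %|| 2 * dot v z * v i 0.
    have {h0 h1 h2} : m%:Z %|| (dot v v *: z - (2 * dot v z) *: v) i 0.
      by move: i; apply: ord3P.
    by rewrite !mxE => h; rewrite -(subKr (dot v v * z i 0) (_ * _)) rpredB.
  have : m%:Z %|| 2 * dot v z * dot v w0.
    rewrite -dotZl dotC; apply: dvdz_dot => i; rewrite mxE; exact: h.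
  by move/(dvdz_cancel_unit vw0); rewrite Gauss_dvdzr.
move=> z; split; first exact: fwd.
move=> vz; apply/kphi.
(* Both kernels have index [m], so the inclusion is an equality; explicitly,
   the two functionals are proportional modulo [m], with a unit as factor. *)
have red y : m%:Z %|| dot v y - dot phi y * dot v w.
  rewrite -dotZr -dotNr -dotDr; apply: fwd; apply/kphi.
  rewrite dotDr dotNr dotZr -{1}[dot phi y]mulr1 -mulrBr -opprB mulrN rpredN.
  by rewrite dvdz_mull.
have zw : m%:Z %|| dot phi z * dot v w.
  by rewrite -(subKr (dot v z) (_ * _)) rpredB.
apply: (@dvdz_cancel_unit _ _ (dot v w * dot phi w0)).
  rewrite (_ : _ - 1 = (dot v w0 - 1) - (dot v w0 - dot phi w0 * dot v w)).
    exact: rpredB.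
  by ring.
by rewrite mulrA dvdz_mulr.
Qed.

(** * Parity classes and the even part of a quaternion *)

Definition tot (z : 'cV[int]_3) : int := z i0 0 + z i1 0 + z i2 0.

Lemma totB z z' : tot (z - z') = tot z - tot z'.
Proof. by rewrite /tot !mxE; ring. Qed.

Lemma totZ k z : tot (k *: z) = k * tot z.
Proof. by rewrite /tot !mxE; ring. Qed.

Definition oddv (z : 'cV[int]_3) : Prop := forall i, modz (z i 0) 2 = 1.

(** For odd vectors, [y = z / 2] lies in [x + fcc] when [tot z = 3] modulo 4
    and in [- x + fcc] when [tot z = 1]. The Euler matrix of [q] multiplies this
    class by [|q|^2]: its column sums differ from [|q|^2] by even numbers that
    add up to a multiple of 4. *)
Lemma euler_parity (q : quat int) (z : 'cV[int]_3) : oddv z ->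
  (4 %|| tot (euler q *m z) - qnorm2 q * tot z) /\
  (odd `|qnorm2 q| -> oddv (euler q *m z)).
Proof.
move=> oz; have := (oz i0, oz i1, oz i2).
case: q => a b c d; rewrite (cv3E z) /tot !mulmx3E !mxE /=.
move: (z i0 0) (z i1 0) (z i2 0) => z0 z1 z2 [[h0 h1] h2].
have {h0} [k0 ->] : exists k, z0 = 2 * k + 1 by exists (z0 %/ 2)%Z; lia.
have {h1} [k1 ->] : exists k, z1 = 2 * k + 1 by exists (z1 %/ 2)%Z; lia.
have {h2} [k2 ->] : exists k, z2 = 2 * k + 1 by exists (z2 %/ 2)%Z; lia.
rewrite /qnorm2 /=; split.
  apply/dvdzP; exists (- (b ^+ 2 + c ^+ 2 + d ^+ 2) + b * c + b * d + c * d
    + (- c ^+ 2 - d ^+ 2 + b * c + a * d + b * d - a * c) * k0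
    + (- b ^+ 2 - d ^+ 2 + b * c - a * d + c * d + a * b) * k1
    + (- b ^+ 2 - c ^+ 2 + b * d + a * c + c * d - a * b) * k2).
  by ring.
move=> oN i; set N : int := _ + _ in oN.
have {}oN : (N %% 2)%Z = 1 by lia.
have step (x y t : int) : (x %% 2)%Z = 1 -> y = x + 2 * t -> (y %% 2)%Z = 1 by lia.
have NoddM k : ((N * (2 * k + 1)) %% 2)%Z = 1.
  by rewrite (_ : N * (2 * k + 1) = N + 2 * (N * k)); [lia | ring].
move: i; apply: ord3P; rewrite mulmx3E !mxE /=.
- apply: (step _ _ (- (c ^+ 2 + d ^+ 2) * (2 * k0 + 1) + (b * c - a * d) * (2 * k1 + 1)
     + (b * d + a * c) * (2 * k2 + 1)) (NoddM k0)); by rewrite /N; ring.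
- apply: (step _ _ (- (b ^+ 2 + d ^+ 2) * (2 * k1 + 1) + (b * c + a * d) * (2 * k0 + 1)
     + (c * d - a * b) * (2 * k2 + 1)) (NoddM k1)); by rewrite /N; ring.
apply: (step _ _ (- (b ^+ 2 + c ^+ 2) * (2 * k2 + 1) + (b * d - a * c) * (2 * k0 + 1)
     + (c * d + a * b) * (2 * k1 + 1)) (NoddM k2)); by rewrite /N; ring.
Qed.

(** Symmetries of the cube, with the sign by which they multiply the class
    modulo 4 of the coordinate sum of an odd vector. *)
Definition sgnperm (s : int) (B : 'M[int]_3) : Prop :=
  [/\ B *m B^T = 1%:M, B^T *m B = 1%:M &
    forall z, oddv z -> [/\ oddv (B *m z), oddv (B^T *m z),
      4 %|| tot (B *m z) - s * tot z & 4 %|| tot (B^T *m z) - s * tot z]].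

Definition mx3 (r0 r1 r2 : seq int) : 'M[int]_3 :=
  \matrix_(i, j) (nth [::] [:: r0; r1; r2] i)`_j.

Lemma sgnperm_mx3 s r0 r1 r2 : let B := mx3 r0 r1 r2 in
  (forall i j, B i i0 * B j i0 + B i i1 * B j i1 + B i i2 * B j i2 = (i == j)%:R) ->
  (forall i j, B i0 i * B i0 j + B i1 i * B i1 j + B i2 i * B i2 j = (i == j)%:R) ->
  (forall z, oddv z -> [/\ oddv (B *m z), oddv (B^T *m z),
      4 %|| tot (B *m z) - s * tot z & 4 %|| tot (B^T *m z) - s * tot z]) ->
  sgnperm s B.
Proof.
move=> B H1 H2 H3; split=> //; apply/matrixP => i j.
  by rewrite mxE sum3E ![_^T _ _]mxE addrA H1 mxE.
by rewrite mxE sum3E ![_^T _ _]mxE addrA H2 mxE.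
Qed.

Ltac mx3_tac := by apply/matrixP; apply: ord3P; apply: ord3P; rewrite !mxE.

Ltac sgnperm_tac :=
  apply: sgnperm_mx3;
  [ by apply: ord3P; apply: ord3P; rewrite !mxE
  | by apply: ord3P; apply: ord3P; rewrite !mxE
  | let z := fresh "z" in let oz := fresh "oz" in
    move=> z oz; move: (oz i0) (oz i1) (oz i2);
    split; [apply: ord3P | apply: ord3P | | ];
    rewrite /tot !mulmx3E !mxE /=; lia ].

(** Cubic symmetries: quarter turns for [1 + i], [1 + j], [1 + k], and
    rotations of order 3 for [1 + i + j + k] and its conjugate. *)
Lemma euler_one_plus_unit u : one_plus_unit u ->
  exists2 B, sgnperm (-1) B & euler u = 2 *: B.
Proof.
case=> ->.
- exists (mx3 [:: 1; 0; 0] [:: 0; 0; -1] [:: 0; 1; 0]); [sgnperm_tac | mx3_tac].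
- exists (mx3 [:: 0; 0; 1] [:: 0; 1; 0] [:: -1; 0; 0]); [sgnperm_tac | mx3_tac].
- exists (mx3 [:: 0; -1; 0] [:: 1; 0; 0] [:: 0; 0; 1]); [sgnperm_tac | mx3_tac].
Qed.

Lemma euler_hurwitz_unit u : u = Quat 1 1 1 1 \/ u = Quat 1 (-1) (-1) (-1) ->
  exists2 B, sgnperm 1 B & euler u = 4 *: B.
Proof.
case=> ->.
- exists (mx3 [:: 0; 0; 1] [:: 1; 0; 0] [:: 0; 1; 0]); [sgnperm_tac | mx3_tac].
- exists (mx3 [:: 0; 1; 0] [:: 0; 0; 1] [:: 1; 0; 0]); [sgnperm_tac | mx3_tac].
Qed.

Lemma sgnperm1 : sgnperm 1 1%:M.
Proof.
split; rewrite ?trmx1 ?mulmx1 // => z oz.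
by rewrite !mul1mx; split=> //; rewrite mul1r subrr dvdz0.
Qed.

Lemma qnorm2_mod4 (q : quat int) : primitive q -> (2 %|| qnorm2 q) ->
  (qnorm2 q %% 4)%Z = 2 \/
  [/\ (qc0 q %% 2)%Z = 1, (qc1 q %% 2)%Z = 1, (qc2 q %% 2)%Z = 1,
      (qc3 q %% 2)%Z = 1 & (qnorm2 q %% 8)%Z = 4].
Proof.
move=> /primitiveP pq; case: q pq => a b c d pq; rewrite /qnorm2 /=.
have sq (x : int) : (x %% 2)%Z = 1 /\ (x ^+ 2 %% 8)%Z = 1 \/
    (x %% 2)%Z = 0 /\ (x ^+ 2 %% 4)%Z = 0.
  have [y E] : exists y, x = 2 * y \/ x = 2 * y + 1 by exists (x %/ 2)%Z; lia.
  have [t tE] := sqr_parity y.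
  by case: E => ->; [right|left]; split; lia.
have := pq 2; rewrite /qdvd /= => {pq} ev E.
have : ~ [/\ (a %% 2 = 0)%Z, (b %% 2 = 0)%Z, (c %% 2 = 0)%Z & (d %% 2 = 0)%Z].
  case=> *; have : (2 %|| 1) by apply: ev; apply/and4P; split; apply/dvdz_mod0P.
  by rewrite dvdz1.
move: E (sq a) (sq b) (sq c) (sq d) => {ev}.
move: (a ^+ 2) (b ^+ 2) (c ^+ 2) (d ^+ 2) => a2 b2 c2 d2.
move=> E [[]|[]] ? ? [[]|[]] ? ? [[]|[]] ? ? [[]|[]] ? ? H;
  try (exfalso; lia); try (left; lia); try (exfalso; apply: H; split; assumption).
by right; split=> //; lia.
Qed.

(** By [qnorm2_mod4] there are three cases: odd norm; norm 2 modulo 4, where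
    [1 + i], [1 + j] or [1 + k] splits off; and four odd components. In the last
    case its half is a Hurwitz quaternion, and [(1 + i + j + k) / 2] or its
    conjugate makes it integral, since the integral units have index 3 among
    the Hurwitz units. All these right factors act as symmetries of the cube. *)
Lemma primitive_decomposition (q : quat int) : primitive q ->
  exists q' s B c, [/\ primitive q', odd `|qnorm2 q'|, sgnperm s B,
    euler q = c *: (euler q' *m B) &
    qnorm2 q = qnorm2 q' * c /\ [\/ c = 1 /\ s = 1, c = 2 /\ s = -1 | c = 4 /\ s = 1]].
Proof.
move=> pq.
have prim q' u : q = qmul q' u -> primitive q'.
  move=> qE; apply/primitiveP => d dq; move/primitiveP: pq; apply.
  by rewrite qE qdvd_mulr.
have [even|] := boolP (2 %|| qnorm2 q); last first.
  move=> oq; exists q, 1, 1%:M, 1; split=> //; first by lia.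
  - exact: sgnperm1.
  - by rewrite mulmx1 scale1r.
  by rewrite mulr1; split=> //; apply: Or31.
case: (qnorm2_mod4 pq even) => [n2 | [od0 od1 od2 od3 n8]].
  have [r [u [qE uE]]] := qmul_one_plus_unit even.
  have [B sB uB] := euler_one_plus_unit uE.
  have N : qnorm2 q = qnorm2 r * 2 by rewrite qE qnorm2M; case: uE => ->.
  exists r, (-1), B, 2; split=> //; first exact: prim qE.
  - by lia.
  - by rewrite qE eulerM uB scalemxAr.
  by split=> //; apply: Or32.
have [r [u [qE uE]]] : exists r u, q = qmul r u /\
    (u = Quat 1 1 1 1 \/ u = Quat 1 (-1) (-1) (-1)).
  case: q od0 od1 od2 od3 {pq even n8 prim} => a b c d /= od0 od1 od2 od3.
  have [h|h] := boolP (4 %|| a + b + c + d).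
    exists (Quat ((a + b + c + d) %/ 4)%Z ((- a + b - c + d) %/ 4)%Z
      ((- a + b + c - d) %/ 4)%Z ((- a - b + c + d) %/ 4)%Z), (Quat 1 1 1 1).
    by split; [congr Quat; lia | left].
  exists (Quat ((a - b - c - d) %/ 4)%Z ((a + b + c - d) %/ 4)%Z
    ((a - b + c + d) %/ 4)%Z ((a + b - c + d) %/ 4)%Z), (Quat 1 (-1) (-1) (-1)).
  by split; [congr Quat; lia | right].
have [B sB uB] := euler_hurwitz_unit uE.
have N : qnorm2 q = qnorm2 r * 4 by rewrite qE qnorm2M; case: uE => ->.
exists r, 1, B, 4; split=> //; first exact: prim qE.
- by lia.
- by rewrite qE eulerM uB scalemxAr.
by split=> //; apply: Or33.
Qed.

(** * Counting coincidence site lattices *)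

Section Cardinals.
Variables T U : choiceType.
Implicit Types (A : set T) (B : set U).

Lemma card_fset_set_seq A (s : seq T) : uniq s -> (forall x, A x <-> x \in s) ->
  #|` fset_set A|%fset = size s.
Proof.
move=> us As.
have fA : finite_set A.
  by rewrite (_ : A = [set` s]); [exact: finite_seq | apply/seteqP; split=> x /As].
apply: perm_size; apply: uniq_perm; [exact: fset_uniq | exact: us |].
move=> x; rewrite -[LHS]/(x \in fset_set A) in_fset_set //.
by apply/idP/idP => [/set_mem/As|/As/mem_set].
Qed.

Lemma mem_enum_fset_set A x : finite_set A -> (x \in enum_fset (fset_set A)) <-> A x.
Proof.
move=> fA; rewrite -[_ \in _]/(x \in fset_set A) in_fset_set //.
by split=> [/set_mem|/mem_set].
Qed.

Lemma card_fset_set_image A (F : T -> U) : finite_set A ->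
  (forall x y, A x -> A y -> F x = F y -> x = y) ->
  #|` fset_set [set F x | x in A]|%fset = #|` fset_set A|%fset.
Proof.
move=> fA FI; have mA x := mem_enum_fset_set x fA.
transitivity (size [seq F x | x <- enum_fset (fset_set A)]); last exact: size_map.
apply: perm_size; apply: uniq_perm; first exact: fset_uniq.
  by rewrite map_inj_in_uniq ?fset_uniq // => x y /mA Ax /mA Ay; exact: FI.
move=> y; rewrite -[LHS]/(y \in fset_set _) in_fset_set; last exact: finite_image.
apply/idP/mapP => [/set_mem[x Ax <-]|[x /mA Ax ->]]; first by exists x; first exact/mA.
by apply/mem_set; exists x.
Qed.

End Cardinals.

Lemma card_fset_set_image2 (T1 T2 U : choiceType) (A : set T1) (B : set T2)
    (F : T1 -> T2 -> U) : finite_set A -> finite_set B ->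
  (forall a b a' b', A a -> B b -> A a' -> B b' -> F a b = F a' b' -> a = a' /\ b = b') ->
  #|` fset_set [set y | exists a b, [/\ A a, B b & y = F a b]]|%fset =
  (#|` fset_set A|%fset * #|` fset_set B|%fset)%N.
Proof.
move=> fA fB FI; have mA x := mem_enum_fset_set x fA.
have mB x := mem_enum_fset_set x fB.
rewrite -[RHS](size_allpairs F); apply: card_fset_set_seq.
  apply: allpairs_uniq; try exact: fset_uniq.
  move=> [a b] [a' b'] /allpairsP[[a1 b1] [/mA ? /mB ? [-> ->]]].
  move=> /allpairsP[[a2 b2] [/mA ? /mB ? [-> ->]]] /= E.
  by have [|||| -> ->] := FI _ _ _ _ _ _ _ _ E.
move=> y; split=> [[a [b [Aa Bb ->]]]|/allpairsP[[a b] [/mA Aa /mB Bb ->]]].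
  by apply/allpairsP; exists (a, b); split=> //=; [exact/mA|exact/mB].
by exists a, b.
Qed.

Definition dot_ker (m : nat) (v : 'cV[int]_3) : set 'cV[int]_3 :=
  [set z | m%:Z %|| dot v z].

(** For odd [m] these are the coincidence site lattices of [Z^3] of index [m];
    they correspond to the points of the conic [v.v = 0] over [Z/m]. *)
Definition csl (m : nat) : set (set 'cV[int]_3) :=
  [set dot_ker m v | v in isotropic m].

Definition eqmodv (m : nat) (v v' : 'cV[int]_3) : Prop :=
  forall i, m%:Z %|| v i 0 - v' i 0.

Lemma eqmodv_dot (m : nat) v v' z : eqmodv m v v' -> m%:Z %|| dot v z - dot v' z.
Proof.
move=> vv'; rewrite (_ : _ - _ = dot z (v - v')).
  by apply: dvdz_dot => i; rewrite !mxE; exact: vv'.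
by rewrite dotDr dotNr ![dot z _]dotC.
Qed.

Lemma dvdz_subE (d x y : int) : d %|| x - y -> (d %|| x) = (d %|| y).
Proof.
move=> dxy; apply/idP/idP => [dx|dy]; last by rewrite -(subrK y x) rpredD.
by rewrite -(subKr x y) rpredB.
Qed.

Lemma dot_ker_eqmodv (m : nat) v v' : eqmodv m v v' -> dot_ker m v = dot_ker m v'.
Proof.
move=> vv'; apply/seteqP; split=> z; rewrite /dot_ker /= (dvdz_subE (eqmodv_dot z vv')) //.
Qed.

Lemma isotropic_eqmodv (m : nat) v v' : eqmodv m v v' -> isotropic m v -> isotropic m v'.
Proof.
move=> vv' [[w vw] v0]; have E z := eqmodv_dot z vv'.
split.
  exists w; rewrite (_ : _ - 1 = (dot v w - 1) - (dot v w - dot v' w)); last by ring.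
  exact: rpredB.
rewrite (_ : dot v' v' = dot v v - (dot v v - dot v' v) - (dot v v' - dot v' v')).
  by apply: rpredB; first apply: rpredB.
by rewrite [dot v' v]dotC; ring.
Qed.

Lemma dot_ker_scale (m : nat) c c' v : m%:Z %|| c * c' - 1 -> dot_ker m (c *: v) = dot_ker m v.
Proof.
move=> cc'; apply/seteqP; split=> z; rewrite /dot_ker /= dotZl; last exact: dvdz_mull.
by move=> h; apply: (dvdz_cancel_unit cc'); rewrite mulrA [_ * c]mulrC dvdz_mulr.
Qed.

(** If [v.w = 1], then [z - (v.z) w] is in the kernel of [v]; so [v'] agrees
    with [v'.w] times [v]. *)
Lemma dot_ker_sub (m : nat) v v' : isotropic m v -> dot_ker m v `<=` dot_ker m v' ->
  exists c, eqmodv m v' (c *: v).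
Proof.
move=> [[w vw] _] sub; exists (dot v' w).
have key z : m%:Z %|| dot v' z - dot v' w * dot v z.
  have /sub : dot_ker m v (z - dot v z *: w).
    rewrite /dot_ker /= dotDr dotNr dotZr -{1}[dot v z]mulr1 -mulrBr -opprB mulrN rpredN.
    by rewrite dvdz_mull.
  by rewrite /dot_ker /= dotDr dotNr dotZr [_ * dot v' w]mulrC.
move=> i; have := key (delta_mx i 0).
by move: i; apply: ord3P; rewrite /dot !mxE /= ?(mulr1, mulr0, addr0, add0r).
Qed.

Lemma ord_modz (m : nat) (x : int) : (0 < m)%N ->
  exists (u : 'I_m) k, x = u%:Z + m%:Z * k.
Proof.
move=> m0; have mz : m%:Z != 0 by rewrite eqz_nat -lt0n.
have lt : (`|modz x m%:Z| < m)%N.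
  by rewrite -ltz_nat gez0_abs ?modz_ge0 // ltz_pmod // ltz_nat.
exists (Ordinal lt), (divz x m%:Z).
by rewrite /= gez0_abs ?modz_ge0 // mulrC addrC -divz_eq.
Qed.

Lemma box_modz (N : nat) (z : 'cV[int]_3) : (0 < N)%N ->
  exists (x : 'I_N * 'I_N * 'I_N) k,
    z = cv3 x.1.1%:Z x.1.2%:Z x.2%:Z + N%:Z *: k.
Proof.
move=> N0; have [a [k0 E0]] := ord_modz (z i0 0) N0.
have [b [k1 E1]] := ord_modz (z i1 0) N0; have [c [k2 E2]] := ord_modz (z i2 0) N0.
by exists (a, b, c), (cv3 k0 k1 k2); apply: cv3P; rewrite !mxE /=.
Qed.

Lemma finite_csl (m : nat) : (0 < m)%N -> finite_set (csl m).
Proof.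
move=> m0; apply: (@sub_finite_set _ _ (range (fun x : 'I_m * 'I_m * 'I_m =>
    dot_ker m (cv3 x.1.1%:Z x.1.2%:Z x.2%:Z)))).
  move=> _ [v _ <-]; have [x [k vE]] := box_modz v m0; exists x => //.
  apply/esym/dot_ker_eqmodv => i.
  by rewrite {1}vE [_ i 0]mxE addrAC subrr add0r mxE dvdz_mulr.
by apply: finite_image; exact: finite_finset.
Qed.

Definition csl_card (m : nat) : nat := #|` fset_set (csl m)|%fset.

Lemma csl_card1 : csl_card 1 = 1%N.
Proof.
rewrite /csl_card; apply: (@card_fset_set_seq _ _ [:: setT]) => // A; rewrite inE.
have L v : dot_ker 1 v = setT by apply/seteqP; split=> z //= _; exact: dvd1z.
split=> [[v _ <-]|/eqP ->]; first by rewrite L.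
by exists 0; [split; [exists 0; exact: dvd1z | exact: dvd1z] | exact: L].
Qed.

Lemma chinese_int (m n : nat) (x y : int) : coprime m n ->
  exists z, m%:Z %|| x - z /\ n%:Z %|| y - z.
Proof.
move=> cmn; have c : coprimez m%:Z n%:Z by rewrite coprimezE.
exists (zchinese m%:Z n%:Z x y); rewrite -!eqz_mod_dvd.
by rewrite (zchinese_modl c) (zchinese_modr c) !eqxx.
Qed.

Lemma dvdz_coprimeM (m n : nat) (x : int) : coprime m n ->
  ((m * n)%:Z %|| x) = (m%:Z %|| x) && (n%:Z %|| x).
Proof. by move=> cmn; rewrite PoszM Gauss_dvdz // coprimezE. Qed.

Lemma dot_ker_mul (m n : nat) v : coprime m n -> dot_ker (m * n) v = dot_ker m v `&` dot_ker n v.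
Proof.
move=> cmn; apply/seteqP; split=> z; rewrite /dot_ker /= dvdz_coprimeM //; first by case/andP.
by case=> -> ->.
Qed.

(** Chinese remainders; the lattice modulo [m] is recovered from the
    intersection [S] as [{z | n z in S}]. *)
Lemma csl_card_mul (m n : nat) : (0 < m)%N -> (0 < n)%N -> coprime m n ->
  csl_card (m * n) = (csl_card m * csl_card n)%N.
Proof.
move=> m0 n0 cmn; rewrite /csl_card -(@card_fset_set_image2 _ _ _ _ _ setI);
  [|exact: finite_csl|exact: finite_csl|].
  congr #|` fset_set _|%fset; apply/seteqP; split=> [_ [v [[w vw] vv] <-]|].
    move: vw vv; rewrite !dvdz_coprimeM // => /andP[vw vw'] /andP[vv vv'].
    exists (dot_ker m v), (dot_ker n v); rewrite dot_ker_mul //.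
    by split=> //; exists v => //; split=> //; exists w.
  move=> _ [_ [_ [[v vm <-] [v' v'n <-] ->]]].
  have [z0 [a0 b0]] := chinese_int (v i0 0) (v' i0 0) cmn.
  have [z1 [a1 b1]] := chinese_int (v i1 0) (v' i1 0) cmn.
  have [z2 [a2 b2]] := chinese_int (v i2 0) (v' i2 0) cmn.
  have E : eqmodv m v (cv3 z0 z1 z2) by apply: ord3P; rewrite mxE.
  have E' : eqmodv n v' (cv3 z0 z1 z2) by apply: ord3P; rewrite mxE.
  exists (cv3 z0 z1 z2); last by rewrite dot_ker_mul // (dot_ker_eqmodv E) (dot_ker_eqmodv E').
  have [[w vw] vv] := isotropic_eqmodv E vm.
  have [[w' vw'] vv'] := isotropic_eqmodv E' v'n.
  split; last by rewrite dvdz_coprimeM // vv vv'.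
  have /coprimezP[[s t] /= st] : coprimez m%:Z n%:Z by rewrite coprimezE.
  exists (t * n%:Z *: w + s * m%:Z *: w'); rewrite dvdz_coprimeM // dotDr !dotZr.
  set x := dot _ w in vw *; set y := dot _ w' in vw' *; apply/andP; split.
    rewrite (_ : _ - 1 = t * n%:Z * (x - 1) + s * y * m%:Z + (t * n%:Z - 1)); last by ring.
    by rewrite (_ : t * n%:Z - 1 = - s * m%:Z) ?rpredD ?dvdz_mull // -st; ring.
  rewrite (_ : _ - 1 = s * m%:Z * (y - 1) + t * x * n%:Z + (s * m%:Z - 1)); last by ring.
  by rewrite (_ : s * m%:Z - 1 = - t * n%:Z) ?rpredD ?dvdz_mull // -st; ring.
have rec k l (v v' : 'cV[int]_3) : coprime k l ->
    dot_ker k v = [set z | (dot_ker k v `&` dot_ker l v') (l%:Z *: z)].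
  move=> ckl; apply/seteqP; split=> z; rewrite /dot_ker /= !dotZr.
    by move=> h; split; [exact: dvdz_mull | rewrite dvdz_mulr].
  by case; rewrite Gauss_dvdzr ?coprimezE.
move=> _ _ _ _ [v1 _ <-] [v2 _ <-] [v3 _ <-] [v4 _ <-] E; split.
  by rewrite (rec m n v1 v2 cmn) E -rec.
rewrite coprime_sym in cmn.
by rewrite (rec n m v2 v1 cmn) setIC E setIC -rec.
Qed.

(** Modulo [p] there are [(p + 1) / 2] squares and as many values [-1 - y^2], too
    many to be disjoint. *)
Lemma sum2_squares_prime (p : nat) : prime p -> odd p ->
  exists a b : int, p%:Z %|| a ^+ 2 + b ^+ 2 + 1.
Proof.
move=> pp op; have p1 := prime_gt1 pp; have p0 := prime_gt0 pp.
have lt (k : nat) : (k %% p < p)%N by rewrite ltn_mod.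
pose k := (p./2).+1.
pose f (i : 'I_k) : 'I_p := Ordinal (lt (i * i)%N).
pose g (i : 'I_k) : 'I_p := Ordinal (lt ((p * p - 1) - i * i)%N).
have kp (i : 'I_k) : (i * i <= p * p - 1)%N.
  by have := ltn_ord i; rewrite /k => ik; have := leq_mul ik ik; nia.
have sqI (i j : 'I_k) : (p%:Z %|| (i * i)%N%:Z - (j * j)%N%:Z) -> i = j.
  rewrite !PoszM (_ : _ - _ = (i%:Z - j%:Z) * (i%:Z + j%:Z)); last by ring.
  have ip := ltn_ord i; have jp := ltn_ord j.
  have [/val_inj -> //|ij] := eqVneq (i : nat) j.
  have := odd_double_half p; rewrite op => pE.
  move: ip jp ij; rewrite /k; move: (nat_of_ord i) (nat_of_ord j) => x y xp yp xy.
  rewrite dvdzE abszM Euclid_dvdM // => /orP[] /dvdn_leq h; exfalso.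
    have {}h : (p <= `|x%:Z - y%:Z|)%N by apply: h; lia.
    by lia.
  have {}h : (p <= `|(x%:Z + y%:Z)%R|)%N by apply: h; lia.
  by lia.
have modE (x y : nat) : (x %% p = y %% p)%N -> p%:Z %|| x%:Z - y%:Z.
  by move=> E; rewrite -eqz_mod_dvd !modz_nat E.
have fI : injective f by move=> i j [/modE]; exact: sqI.
have subE (i : 'I_k) : (p * p - 1 - i * i)%N%:Z = (p * p)%N%:Z - 1 - (i * i)%N%:Z.
  by rewrite -!subzn ?kp ?muln_gt0 ?p0.
have gI : injective g.
  move=> i j [/modE]; rewrite !subE => E.
  apply/esym/sqI; rewrite (_ : _ - _ = (p * p)%N%:Z - 1 - (i * i)%N%:Z -
    ((p * p)%N%:Z - 1 - (j * j)%N%:Z)) //; ring.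
have : ~~ [disjoint codom f & codom g].
  apply/negP => /pred0P/eq_card0 D; have := max_card [predU mem (codom f) & mem (codom g)].
  have := cardUI (mem (codom f)) (mem (codom g)); rewrite D addn0 => ->.
  by rewrite !card_codom // !card_ord /k; have := odd_double_half p; lia.
rewrite disjoint_has negbK => /hasP[_ /codomP[i ->] /codomP[j [/modE]]].
rewrite subE => h.
exists i%:Z, j%:Z.
rewrite (_ : _ + 1 = ((i * i)%N%:Z - ((p * p)%N%:Z - 1 - (j * j)%N%:Z)) + (p * p)%N%:Z).
  by rewrite rpredD // PoszM dvdz_mull.
by rewrite !PoszM; ring.
Qed.

Lemma coprimez_inverse (a m : int) : coprimez a m -> exists b, m %|| a * b - 1.
Proof.
move=> /coprimezP[[u v] /= uv]; exists u.
by rewrite -uv opprD addrA mulrC subrr add0r rpredN dvdz_mull.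
Qed.

Lemma prime_coprimez (p : nat) (x : int) : prime p -> ~~ (p%:Z %|| x) -> coprimez x p%:Z.
Proof. by move=> pp; rewrite dvdzE coprimezE coprime_sym prime_coprime. Qed.

(** Hensel lifting of the previous solution. *)
Lemma sum2_squares_pfactor (p r : nat) : prime p -> odd p ->
  exists a b : int, (p ^ r)%N%:Z %|| a ^+ 2 + b ^+ 2 + 1.
Proof.
move=> pp op; elim: r => [|r IH]; first by exists 0, 0; exact: dvd1z.
have [r0|r0] := posnP r; first by rewrite r0 expn1; exact: sum2_squares_prime.
have {IH} [a [b [ab pa]]] : exists a b, (p ^ r)%N%:Z %|| a ^+ 2 + b ^+ 2 + 1 /\ ~~ (p%:Z %|| a).
  have [a [b ab]] := IH.
  have [pa|pa] := boolP (p%:Z %|| a); last by exists a, b.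
  exists b, a; rewrite [b ^+ 2 + _]addrC; split=> //; apply/negP => pb.
  have ppr : p%:Z %|| (p ^ r)%N%:Z by rewrite dvdzE /= dvdn_exp.
  have := dvdz_trans ppr ab; rewrite (dvdz_subE (y := 1)) ?dvdz1 /=.
    by move/eqP => E; move: pp; rewrite E.
  by rewrite addrK rpredD // dvdz_exp.
have c2 : coprimez (2 * a) p%:Z.
  rewrite coprimezMl [coprimez 2 _]coprimez_sym odd_coprimez2 //=.
  exact: prime_coprimez.
have [c hc] := coprimez_inverse c2.
case/dvdzP: ab => k kE; exists (a - (p ^ r)%N%:Z * (k * c)), b.
rewrite expnSr PoszM.
set P := (p ^ r)%N%:Z in kE *.
rewrite (_ : _ + 1 = P * (k * (1 - 2 * a * c)) + P * P * (k * c) ^+ 2); last first.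
  transitivity ((a ^+ 2 + b ^+ 2 + 1) - 2 * a * P * (k * c) + P * P * (k * c) ^+ 2).
    by ring.
  by rewrite kE; ring.
apply: rpredD.
  by apply: dvdz_mul; rewrite ?dvdzz // dvdz_mull // -opprB rpredN.
apply: dvdz_mulr; apply: dvdz_mul; rewrite ?dvdzz // dvdzE /= dvdn_exp //.
Qed.

Section PrimePower.
Variables (p r : nat).
Hypotheses (pp : prime p) (op : odd p) (r0 : (0 < r)%N).
Let m := (p ^ r)%N.
Variables (a b h : int).
Hypotheses (ab : m%:Z %|| a ^+ 2 + b ^+ 2 + 1) (h2 : m%:Z %|| 2 * h - 1).

(** The isotropic vectors [(a, b, 1)] and [(a, b, -1)] and the vector
    [(-b, a, 0)] orthogonal to both parametrize the conic: a point is
    [s e + t f + 2 u g] with [u^2 + s t = 0]. *)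
Let e : 'cV[int]_3 := cv3 a b 1.
Let f : 'cV[int]_3 := cv3 a b (-1).
Let g : 'cV[int]_3 := cv3 (- b) a 0.
Let comb (s t u : int) : 'cV[int]_3 := s *: e + t *: f + (2 * u) *: g.
Let S v := - h * dot v f.
Let T v := - h * dot v e.
Let U v := - h * dot v g.
Let A := a ^+ 2 + b ^+ 2 + 1.

Let SE s t u : m%:Z %|| S (comb s t u) - s.
Proof.
rewrite (_ : _ - s = (2 * h - 1) * s + (- h * (s + t)) * A).
  exact: rpredD (dvdz_mulr _ h2) (dvdz_mull _ ab).
by rewrite /S /comb /dot !mxE /= /A; ring.
Qed.

Let TE s t u : m%:Z %|| T (comb s t u) - t.
Proof.
rewrite (_ : _ - t = (2 * h - 1) * t + (- h * (s + t)) * A).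
  exact: rpredD (dvdz_mulr _ h2) (dvdz_mull _ ab).
by rewrite /T /comb /dot !mxE /= /A; ring.
Qed.

Let UE s t u : m%:Z %|| U (comb s t u) - u.
Proof.
rewrite (_ : _ - u = (2 * h - 1) * u + (- h * 2 * u) * A).
  exact: rpredD (dvdz_mulr _ h2) (dvdz_mull _ ab).
by rewrite /U /comb /dot !mxE /= /A; ring.
Qed.

Let combE v : eqmodv m v (comb (S v) (T v) (U v)).
Proof.
rewrite /S /T /U /comb (cv3E v) /dot.
move: (v i0 0) (v i1 0) (v i2 0) => x y z; apply: ord3P; rewrite !mxE /=.
- rewrite (_ : _ - _ = - ((2 * h - 1) * x) + 2 * h * x * A); last by rewrite /A; ring.
  by apply: rpredD; [rewrite rpredN dvdz_mulr | exact: dvdz_mull].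
- rewrite (_ : _ - _ = - ((2 * h - 1) * y) + 2 * h * y * A); last by rewrite /A; ring.
  by apply: rpredD; [rewrite rpredN dvdz_mulr | exact: dvdz_mull].
rewrite (_ : _ - _ = - ((2 * h - 1) * z)); last by ring.
by rewrite rpredN dvdz_mulr.
Qed.

Let isoSTU v : isotropic m v -> m%:Z %|| U v ^+ 2 + S v * T v.
Proof.
move=> [_ vv].
rewrite (_ : _ + _ = h ^+ 2 * (v i0 0 ^+ 2 + v i1 0 ^+ 2) * A - h ^+ 2 * dot v v).
  by apply: rpredB; exact: dvdz_mull.
by rewrite /S /T /U /dot !mxE /= /A; ring.
Qed.

Let comb_eqmod s t u s' t' u' : m%:Z %|| s - s' -> m%:Z %|| t - t' -> m%:Z %|| u - u' ->
  eqmodv m (comb s t u) (comb s' t' u').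
Proof.
move=> ss tt uu i.
rewrite (_ : _ - _ = (s - s') * e i 0 + (t - t') * f i 0 + (u - u') * (2 * g i 0)).
  by rewrite !rpredD // dvdz_mulr.
have entry x y z (k l n : 'cV[int]_3) :
    (x *: k + y *: l + z *: n) i 0 = x * k i 0 + y * l i 0 + z * n i 0.
  by rewrite !mxE.
by rewrite /comb !entry; ring.
Qed.

Let combZ c s t u : c *: comb s t u = comb (c * s) (c * t) (c * u).
Proof. by rewrite /comb !scalerDr !scalerA [c * (2 * u)]mulrCA. Qed.

(** Two charts of the conic: where [s] is a unit, scale it to 1; elsewhere [p]
    divides [s] and [u], and [t] is a unit. *)
Let V (x : 'I_(p ^ r) + 'I_(p ^ (r - 1))) : 'cV[int]_3 :=
  match x with
  | inl u => comb 1 (- u%:Z ^+ 2) u%:Z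
  | inr u => comb (- (p * u)%N%:Z ^+ 2) 1 (p * u)%N%:Z
  end.

Let isoV x : isotropic m (V x).
Proof.
have sq s t u : dot (comb s t u) (comb s t u) = A * (s + t) ^+ 2 + 4 * u ^+ 2 * A - 4 * (s * t + u ^+ 2).
  by rewrite /comb /dot !mxE /= /A; ring.
case: x => u; split.
- exists (- h *: f); rewrite dotZr; exact: (SE _ _ _).
- by rewrite sq mul1r addNr mulr0 subr0; apply: rpredD; [exact: dvdz_mulr | exact: dvdz_mull].
- exists (- h *: e); rewrite dotZr; exact: (TE _ _ _).
- by rewrite sq mulr1 addNr mulr0 subr0; apply: rpredD; [exact: dvdz_mulr | exact: dvdz_mull].
Qed.

Let pm : p%:Z %|| m%:Z.
Proof. by rewrite dvdzE /= dvdn_exp. Qed.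

Let mpE : m = (p * p ^ (r - 1))%N.
Proof. by rewrite /m -expnS subn1 prednK. Qed.

Let coord (F : 'cV[int]_3 -> int) k v v' x x' : (forall u, F u = - h * dot u k) ->
  eqmodv m v' v -> m%:Z %|| F v - x -> m%:Z %|| F v' - x' -> m%:Z %|| x' - x.
Proof.
move=> FE vv' Fx Fx'.
rewrite (_ : _ - _ = - h * (dot v' k - dot v k) + (F v - x) - (F v' - x')).
  by rewrite rpredB // rpredD // dvdz_mull // eqmodv_dot.
by rewrite !FE; ring.
Qed.

Let V_inj x y : dot_ker m (V x) = dot_ker m (V y) -> x = y.
Proof.
have m0 : (0 < m)%N by rewrite expn_gt0 prime_gt0.
have nat_inj (k l : nat) : (k < m)%N -> (l < m)%N -> m%:Z %|| k%:Z - l%:Z -> k = l.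
  move=> km lm; rewrite -eqz_mod_dvd !modz_small ?ltz_nat // => /eqP[] //.
have one c s t u s' t' u' : eqmodv m (comb s' t' u') (c *: comb s t u) ->
    [/\ m%:Z %|| s' - c * s, m%:Z %|| t' - c * t & m%:Z %|| u' - c * u].
  rewrite combZ => E; split.
  - exact: (@coord S f _ _ _ _ (fun=> erefl) E (SE _ _ _) (SE _ _ _)).
  - exact: (@coord T e _ _ _ _ (fun=> erefl) E (TE _ _ _) (TE _ _ _)).
  exact: (@coord U g _ _ _ _ (fun=> erefl) E (UE _ _ _) (UE _ _ _)).
have mixed (u : 'I_(p ^ r)) (w : 'I_(p ^ (r - 1))) c :
    ~ eqmodv m (V (inr w)) (c *: V (inl u)).
  move=> /one[s1 t1 _].
  have : p%:Z %|| 1.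
    rewrite (_ : 1 = (1 - c * (- u%:Z ^+ 2)) + u%:Z ^+ 2 * (- (p * w)%N%:Z ^+ 2 - c * 1)
       + u%:Z ^+ 2 * (p * w)%N%:Z ^+ 2); last by ring.
    apply: rpredD; last first.
      by apply: dvdz_mull; apply: dvdz_exp => //; rewrite PoszM dvdz_mulr.
    apply: rpredD; first exact: dvdz_trans pm t1.
    by apply: dvdz_mull; exact: dvdz_trans pm s1.
  by rewrite dvdz1 /= => /eqP p1; move: pp; rewrite p1.
move=> E.
have [c Hc] : exists c, eqmodv m (V y) (c *: V x).
  by apply: dot_ker_sub (isoV x) _; rewrite E.
have [d Hd] : exists d, eqmodv m (V x) (d *: V y).
  by apply: dot_ker_sub (isoV y) _; rewrite E.
case: x y E Hc Hd => [u|w] [u'|w'] E Hc Hd.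
- have [s1 _ u1] := one _ _ _ _ _ _ _ Hc; congr inl; apply/val_inj/esym/nat_inj => //=.
  rewrite (_ : _ - _ = u'%:Z - c * u%:Z - (1 - c * 1) * u%:Z); last by ring.
  by rewrite rpredB // dvdz_mulr.
- by case: (mixed _ _ _ Hc).
- by case: (mixed _ _ _ Hd).
have [_ t1 u1] := one _ _ _ _ _ _ _ Hc; congr inr; apply/val_inj/esym.
have lt (k : 'I_(p ^ (r - 1))) : (p * k < m)%N.
  by rewrite mpE ltn_pmul2l ?prime_gt0.
have /eqP : (p * w' = p * w)%N.
  apply: nat_inj; rewrite ?lt //.
  rewrite (_ : _ - _ = (p * w')%N%:Z - c * (p * w)%N%:Z - (1 - c * 1) * (p * w)%N%:Z); last by ring.
  by rewrite rpredB // dvdz_mulr.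
by rewrite eqn_pmul2l ?prime_gt0 // => /eqP.
Qed.

Let V_surj v : isotropic m v -> exists x, dot_ker m (V x) = dot_ker m v.
Proof.
move=> iv; have m0 : (0 < m)%N by rewrite expn_gt0 prime_gt0.
have stu := isoSTU iv.
have inv x : ~~ (p%:Z %|| x) -> exists x', m%:Z %|| x * x' - 1.
  move=> px; apply: coprimez_inverse; rewrite /m.
  by have := prime_coprimez pp px; rewrite !coprimezE /= => ?; rewrite coprimeXr.
have rep (x : int) : exists2 u : nat, (u < m)%N & m%:Z %|| x - u%:Z.
  have [u [k ->]] := ord_modz x m0; exists u; first exact: ltn_ord.
  by rewrite addrAC subrr add0r dvdz_mulr.
have sqr_sub (x y : int) : m%:Z %|| x - y -> m%:Z %|| x ^+ 2 - y ^+ 2.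
  by rewrite subr_sqr => ?; rewrite dvdz_mulr.
have [ps|/inv[s' ss']] := boolP (p%:Z %|| S v).
  have pu : p%:Z %|| U v.
    have : p%:Z %|| U v ^+ 2.
      by rewrite -(addrK (S v * T v) (_ ^+ 2)) rpredB ?(dvdz_trans pm stu) // dvdz_mulr.
    by rewrite !dvdzE abszX Euclid_dvdX // andbT.
  have pt : ~~ (p%:Z %|| T v).
    apply/negP => pt; have [[w vw] _] := iv.
    have pv : p%:Z %|| dot v w.
      rewrite dotC; apply: dvdz_dot => i.
      rewrite (dvdz_subE (dvdz_trans pm (combE v i))) /comb !mxE.
      by rewrite !rpredD // dvdz_mulr // dvdz_mull.
    have : p%:Z %|| 1.
      rewrite -[1](subKr (dot v w)) rpredB //; exact: dvdz_trans pm vw.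
    by rewrite dvdz1 /= => /eqP p1; move: pp; rewrite p1.
  have [t' tt'] := inv _ pt.
  have [u um uu] := rep (t' * U v).
  have pu' : (p %| u)%N.
    have : p%:Z %|| u%:Z by rewrite -(dvdz_subE (dvdz_trans pm uu)) dvdz_mull.
    by [].
  case/dvdnP: pu' => w wE.
  have wlt : (w < p ^ (r - 1))%N.
    by move: um; rewrite wE mpE mulnC ltn_pmul2l ?prime_gt0.
  exists (inr (Ordinal wlt)); rewrite (dot_ker_eqmodv (combE v)).
  have tt'' : m%:Z %|| t' * T v - 1 by rewrite mulrC.
  rewrite -(dot_ker_scale (comb _ _ _) tt'') combZ; apply/esym/dot_ker_eqmodv/comb_eqmod => //=.
    rewrite [(p * w)%N]mulnC -wE.
    rewrite (_ : _ - _ = ((t' ^+ 2) * (U v ^+ 2 + S v * T v)) - (t' * T v - 1) * (t' * S v)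
      - ((t' * U v) ^+ 2 - u%:Z ^+ 2)); last by ring.
    by apply: rpredB; [apply: rpredB; [exact: dvdz_mull | exact: dvdz_mulr] | exact: sqr_sub].
  by rewrite [(p * w)%N]mulnC -wE.
have [u um uu] := rep (s' * U v).
exists (inl (Ordinal um)); rewrite (dot_ker_eqmodv (combE v)).
have ss'' : m%:Z %|| s' * S v - 1 by rewrite mulrC.
rewrite -(dot_ker_scale (comb _ _ _) ss'') combZ; apply/esym/dot_ker_eqmodv/comb_eqmod => //=.
rewrite (_ : _ - _ = ((s' ^+ 2) * (U v ^+ 2 + S v * T v)) - (s' * S v - 1) * (s' * T v)
  - ((s' * U v) ^+ 2 - u%:Z ^+ 2)); last by ring.
by apply: rpredB; [apply: rpredB; [exact: dvdz_mull | exact: dvdz_mulr] | exact: sqr_sub].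
Qed.

Lemma csl_card_pfactor_squares : csl_card m = ((p + 1) * p ^ (r - 1))%N.
Proof.
rewrite /csl_card (@card_fset_set_seq _ _ [seq dot_ker m (V x) | x <- enum (('I_(p ^ r) + 'I_(p ^ (r - 1)))%type : finType)]).
- rewrite size_map -cardE card_sum !card_ord mulnDl mul1n.
  by rewrite -/m mpE.
- by rewrite map_inj_uniq ?enum_uniq // => x y; exact: V_inj.
move=> B; split=> [[v iv <-]|/mapP[x _ ->]]; last by exists (V x).
by have [x <-] := V_surj iv; apply: map_f; rewrite mem_enum.
Qed.

End PrimePower.

Lemma csl_card_pfactor (p r : nat) : prime p -> odd p -> (0 < r)%N ->
  csl_card (p ^ r) = ((p + 1) * p ^ (r - 1))%N.
Proof.
move=> pp op r0; have [a [b ab]] := sum2_squares_pfactor r pp op.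
have om : odd (p ^ r) by rewrite oddX op orbT.
have c2 : coprimez 2 (p ^ r)%N%:Z by rewrite coprimez_sym odd_coprimez2.
have [h hh] := coprimez_inverse c2.
exact: csl_card_pfactor_squares ab hh.
Qed.

(** * The lattices and packings in coordinates *)

Lemma subgroupN (V : zmodType) (H : set V) x : subgroup H -> H x -> H (- x).
Proof. by move=> [H0 HB] Hx; rewrite -sub0r; exact: HB. Qed.

Lemma subgroupD (V : zmodType) (H : set V) x y : subgroup H -> H x -> H y -> H (x + y).
Proof. by move=> sH Hx Hy; rewrite -[y]opprK; apply: sH.2 => //; exact: subgroupN. Qed.

Section Real.
Variable R : realType.
Local Notation xfcc := (translate (xD3 R) (@fcc R)).
Implicit Types (A : 'M[R]_3) (y u : 'cV[R]_3) (z : 'cV[int]_3) (q : quat int).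

Definition iz (z : 'cV[int]_3) : 'cV[R]_3 := map_mx intr z.

Lemma izE z i : iz z i 0 = (z i 0)%:~R.
Proof. by rewrite mxE. Qed.

Lemma iz_inj : injective iz.
Proof. by move=> z z' /colP E; apply/colP => i; have := E i; rewrite !mxE => /intr_inj. Qed.

Lemma izD z z' : iz (z + z') = iz z + iz z'.
Proof. by apply/colP => i; rewrite !mxE rmorphD. Qed.

Lemma izN z : iz (- z) = - iz z.
Proof. by apply/colP => i; rewrite !mxE rmorphN. Qed.

Lemma izZ k z : iz (k *: z) = k%:~R *: iz z.
Proof. by apply/colP => i; rewrite !mxE rmorphM. Qed.

Lemma iz_mul (M : 'M[int]_3) z : iz (M *m z) = map_mx intr M *m iz z.
Proof. by rewrite /iz map_mxM. Qed.

Lemma dot_iz z z' : dot (iz z) (iz z') = (dot z z')%:~R :> R.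
Proof. by rewrite /dot !mxE !rmorphD !rmorphM. Qed.

Lemma Z3P y : Z3 y <-> exists z, y = iz z.
Proof.
split=> [Zy|[z ->] i]; last by rewrite mxE; apply/intrP; exists (z i 0).
have /intrP[a a0] := Zy i0; have /intrP[b b1] := Zy i1; have /intrP[c c2] := Zy i2.
by exists (cv3 a b c); apply: cv3P; rewrite !mxE.
Qed.

Lemma Z3_iz z : @Z3 R (iz z).
Proof. by apply/Z3P; exists z. Qed.

Lemma Z3_sub y u : Z3 y -> Z3 u -> Z3 (y - u).
Proof. by move=> /Z3P[z ->] /Z3P[z' ->]; rewrite -izN -izD; exact: Z3_iz. Qed.

Lemma twoZ3P y : twoZ3 y <-> exists z, y = iz (2 *: z).
Proof.
split=> [[u /Z3P[z ->] <-]|[z ->]]; first by exists z; rewrite izZ.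
by exists (iz z); [exact: Z3_iz | rewrite izZ].
Qed.

Lemma fccP y : fcc y <-> exists2 z, y = iz z & 2 %|| tot z.
Proof.
split.
  case=> [[[|]|]|].
  - by move=> /twoZ3P[z ->]; exists (2 *: z); rewrite // /tot !mxE; lia.
  - move=> [_ /twoZ3P[z ->] <-]; exists (cv3 1 1 0 + 2 *: z).
      by rewrite izD; congr (_ + _); apply: cv3P; rewrite !mxE.
    by rewrite /tot !mxE /=; lia.
  - move=> [_ /twoZ3P[z ->] <-]; exists (cv3 0 1 1 + 2 *: z).
      by rewrite izD; congr (_ + _); apply: cv3P; rewrite !mxE.
    by rewrite /tot !mxE /=; lia.
  - move=> [_ /twoZ3P[z ->] <-]; exists (cv3 1 0 1 + 2 *: z).
      by rewrite izD; congr (_ + _); apply: cv3P; rewrite !mxE.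
    by rewrite /tot !mxE /=; lia.
move=> [z -> tz].
pose h := cv3 (divz (z i0 0) 2) (divz (z i1 0) 2) (divz (z i2 0) 2).
have E a b c : z = cv3 a b c + 2 *: h -> iz z = vec3 a%:~R b%:~R c%:~R + iz (2 *: h).
  move=> ->; rewrite izD; congr (_ + _); by apply: cv3P; rewrite !mxE.
have H2 : twoZ3 (iz (2 *: h)) by apply/twoZ3P; exists h.
move: tz; rewrite /tot => tz.
have [a0|a0] := boolP (2 %|| z i0 0); have [b0|b0] := boolP (2 %|| z i1 0).
- left; left; left; apply/twoZ3P; exists h; congr iz.
  by apply: cv3P; rewrite !mxE /=; lia.
- left; right; rewrite (E 0 1 1); first by exists (iz (2 *: h)).
  by apply: cv3P; rewrite !mxE /=; lia.
- right; rewrite (E 1 0 1); first by exists (iz (2 *: h)).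
  by apply: cv3P; rewrite !mxE /=; lia.
- left; left; right; rewrite (E 1 1 0); first by exists (iz (2 *: h)).
  by apply: cv3P; rewrite !mxE /=; lia.
Qed.

Lemma fcc_iz z : fcc (iz z) <-> 2 %|| tot z.
Proof. by rewrite fccP; split=> [[z' /iz_inj ->]|tz] //; exists z. Qed.

Lemma xfccP y : xfcc y <->
  exists z, [/\ y = 2^-1 *: iz z, oddv z & 4 %|| tot z - 3].
Proof.
split=> [[_ /fccP[z -> tz] <-]|[z [-> oz tz]]].
  exists (cv3 1 1 1 + 2 *: z); split.
  - rewrite izD izZ scalerDr scalerA mulVf ?pnatr_eq0 // scale1r; congr (_ + _).
    by apply: cv3P; rewrite !mxE.
  - by apply: ord3P; rewrite !mxE /=; lia.
  - by move: tz; rewrite /tot !mxE /=; lia.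
pose h := cv3 (divz (z i0 0) 2) (divz (z i1 0) 2) (divz (z i2 0) 2).
have zE : z = cv3 1 1 1 + 2 *: h.
  by have := (oz i0, oz i1, oz i2) => -[[? ?] ?]; apply: cv3P; rewrite !mxE /=; lia.
exists (iz h).
  by apply/fcc_iz; move: tz; rewrite zE /tot !mxE /=; lia.
rewrite zE izD izZ scalerDr scalerA mulVf ?pnatr_eq0 // scale1r; congr (_ + _).
by apply: cv3P; rewrite !mxE.
Qed.

Lemma fcc_Z3 y : fcc y -> Z3 y.
Proof. by move=> /fccP[z -> _]; exact: Z3_iz. Qed.

Lemma twoZ3_fcc y : twoZ3 y -> fcc y.
Proof. by move=> H; left; left; left. Qed.

Lemma twoZ3_Z3 y : twoZ3 y -> Z3 y.
Proof. by move/twoZ3_fcc/fcc_Z3. Qed.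

Lemma fcc_sub y u : fcc y -> fcc u -> fcc (y - u).
Proof.
move=> /fccP[z -> tz] /fccP[z' -> tz']; rewrite -izN -izD; apply/fcc_iz.
by rewrite totB rpredB.
Qed.

Lemma subgroup_fcc : subgroup (@fcc R).
Proof.
split; last exact: fcc_sub.
by apply/fccP; exists 0; [apply: cv3P; rewrite !mxE | rewrite /tot !mxE].
Qed.

Lemma subgroup_Z3 : subgroup (@Z3 R).
Proof.
by split; [apply/Z3P; exists 0; apply: cv3P; rewrite !mxE | exact: Z3_sub].
Qed.

(** Squaring preserves parity; unlike the coordinate sum, the squared norm is
    preserved by isometries. *)
Lemma tot_dot z : (2 %|| tot z) = (2 %|| dot z z).
Proof.
have [? E0] := sqr_parity (z i0 0); have [? E1] := sqr_parity (z i1 0).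
have [? E2] := sqr_parity (z i2 0); rewrite !expr2 in E0 E1 E2.
by rewrite /tot /dot E0 E1 E2; apply/idP/idP; lia.
Qed.

Lemma O3_tr A : O3 A -> A^T *m A = 1%:M.
Proof. by move=> /mulmx1C. Qed.

Lemma dot_O3 A y u : O3 A -> dot (A^T *m y) (A^T *m u) = dot y u.
Proof. by move=> OA; rewrite dot_mulmx trmxK mulmxA OA mul1mx. Qed.

Lemma mximage_O3 A S y : O3 A -> mximage A S y <-> S (A^T *m y).
Proof.
move=> OA; split=> [[u Su <-]|Sy]; first by rewrite mulmxA O3_tr // mul1mx.
by exists (A^T *m y); rewrite // mulmxA OA mul1mx.
Qed.

Lemma coinc_O3 A S y : O3 A -> coinc S A y <-> S y /\ S (A^T *m y).
Proof. by move=> OA; rewrite /coinc /setI /= mximage_O3. Qed.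

Lemma fcc_tr A y : O3 A -> fcc y -> Z3 (A^T *m y) -> fcc (A^T *m y).
Proof.
move=> OA /fccP[z -> tz] /Z3P[z' z'E]; rewrite z'E; apply/fcc_iz.
rewrite tot_dot; move: tz; rewrite tot_dot.
by have := dot_O3 (iz z) (iz z) OA; rewrite z'E !dot_iz => /intr_inj ->.
Qed.

(** An integral vector lies in [fcc] when its squared norm is even
    ([tot_dot]), so an integral preimage of a vector of [fcc] is in [fcc]. *)
Lemma coinc_fcc A y : O3 A -> coinc (@fcc R) A y <-> fcc y /\ Z3 (A^T *m y).
Proof.
move=> OA; rewrite coinc_O3 //; split=> -[fy ?]; split=> //; first exact: fcc_Z3.
exact: fcc_tr.
Qed.

(** Vectors of [x + fcc] have squared norm in [3/4 + Z], those of [fcc] have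
    integral squared norm. *)
Lemma fcc_tr_not_xfcc A y : O3 A -> fcc y -> ~ xfcc (A^T *m y).
Proof.
move=> OA /fccP[z -> _] /xfccP[z' [E oz' _]].
have := dot_O3 (iz z) (iz z) OA.
rewrite E dotZr dotZl !dot_iz => H.
have : (dot z' z')%:~R = (4 * dot z z)%:~R :> R.
  by rewrite intrM -H mulrA mulrA; field.
move=> /intr_inj; rewrite /dot; have := (oz' i0, oz' i1, oz' i2).
have sq (x : int) : modz x 2 = 1 -> exists t, x * x = 4 * t + 1.
  move=> od; have [k ->] : exists k, x = 2 * k + 1 by exists (x %/ 2)%Z; lia.
  by exists (k * k + k); ring.
by move=> [[/sq[? ->] /sq[? ->]] /sq[? ->]]; lia.
Qed.

Lemma xfcc_tr_not_fcc A y : O3 A -> xfcc y -> ~ fcc (A^T *m y).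
Proof.
move=> OA xy fy; have OAT : O3 A^T by rewrite /O3 /= trmxK O3_tr.
by apply: (fcc_tr_not_xfcc OAT fy); rewrite trmxK mulmxA OA mul1mx.
Qed.

(** By [fcc_tr_not_xfcc], no point of [fcc] is the image of a point of
    [x + fcc], or conversely. *)
Lemma coinc_D3plus A y : O3 A -> coinc (@D3plus R) A y <->
  coinc (@fcc R) A y \/ (xfcc y /\ xfcc (A^T *m y)).
Proof.
move=> OA; rewrite !coinc_O3 // /D3plus /setU /=; split.
  case=> -[fy|xy] [fy'|xy']; [by left | by case: (fcc_tr_not_xfcc OA fy) |
    by case: (xfcc_tr_not_fcc OA xy) | by right].
by case=> -[? ?]; split; [left|left|right|right].
Qed.

Lemma xfcc_translate y g : xfcc y -> fcc g ->
  xfcc (y + g).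
Proof.
move=> [u fu <-] fg; exists (u + g); last by rewrite addrA.
exact: subgroupD subgroup_fcc fu fg.
Qed.

Lemma xfcc_sub y u : xfcc y -> xfcc u -> fcc (y - u).
Proof.
by move=> [y' fy <-] [u' fu <-]; rewrite opprD addrACA subrr add0r; exact: fcc_sub.
Qed.

(** Two points of [x + fcc] with preimage in [x + fcc] differ by a point of the
    coincidence lattice. *)
Lemma coinc_D3plus_translate A b : O3 A ->
  xfcc b -> xfcc (A^T *m b) ->
  coinc (@D3plus R) A = coinc (@fcc R) A `|` translate b (coinc (@fcc R) A).
Proof.
move=> OA xb xb'; apply/seteqP; split=> y.
  move/(coinc_D3plus _ OA) => [cy|[xy xy']]; first by left.
  right; exists (y - b); last by rewrite addrCA subrr addr0.
  by apply/coinc_O3 => //; rewrite mulmxBr; split; exact: xfcc_sub.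
move=> cy; apply/coinc_D3plus => //; case: cy => [cy|[g cg <-]]; first by left.
right; move/coinc_O3: cg => /(_ OA) [fg fg'].
by rewrite mulmxDr; split; exact: xfcc_translate.
Qed.

Lemma coinc_D3plus_empty A : O3 A ->
  (forall y, xfcc y -> ~ xfcc (A^T *m y)) ->
  coinc (@D3plus R) A = coinc (@fcc R) A.
Proof.
move=> OA H; apply/seteqP; split=> y.
  by move/(coinc_D3plus _ OA) => [//|[xy /(H _ xy)]].
by move=> cy; apply/coinc_D3plus => //; left.
Qed.

Lemma xfcc0 : xfcc (xD3 R).
Proof. by exists 0; [exact: subgroup_fcc.1 | rewrite addr0]. Qed.

Lemma packing_shiftsP A l : O3 A -> packing_shifts A l <->
  fcc l /\ xfcc (A^T *m (xD3 R + l)).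
Proof.
move=> OA; split.
  move=> [[u /(mximage_O3 _ _ OA) fu E] fl]; split=> //.
  have -> : xD3 R + l = A *m xD3 R + u by rewrite -E addrA [xD3 R + _]addrC subrK.
  by rewrite mulmxDr mulmxA O3_tr // mul1mx; exists (A^T *m u).
move=> [fl [g fg E]]; split=> //; exists (A *m g); first by exists g.
have -> : A *m g = A *m (xD3 R + g) - A *m xD3 R by rewrite mulmxDr addrC addKr.
by rewrite E mulmxA OA mul1mx addrC addrA subrK addrC addKr.
Qed.

End Real.

(** * Rational isometries *)

Lemma translate_subgroup (V : zmodType) (H : set V) a b : subgroup H -> H (a - b) ->
  translate a H = translate b H.
Proof.
move=> sH ab; apply/seteqP; split=> _ [x Hx <-].
  by exists (a - b + x); [exact: subgroupD | rewrite addrA addrCA subrr addr0].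
exists (b - a + x); last by rewrite addrA addrCA subrr addr0.
by apply: subgroupD => //; rewrite -opprB; exact: subgroupN.
Qed.

Section Rational.
Variable R : realType.
Implicit Types (A B : 'M[R]_3) (y u : 'cV[R]_3) (z w : 'cV[int]_3) (q : quat int).
Local Notation iz := (@iz R).

Lemma rotq_euler q : rotq R q = (qnorm2 q)%:~R^-1 *: map_mx intr (euler q).
Proof.
have i0E : inord 0 = i0 :> 'I_3 by apply/val_inj; rewrite /= inordK.
have i1E : inord 1 = i1 :> 'I_3 by apply/val_inj; rewrite /= inordK.
have i2E : inord 2 = i2 :> 'I_3 by apply/val_inj; rewrite /= inordK.
case: q => a b c d; apply/matrixP.
have N : qnorm2 (qint R (Quat a b c d)) = (qnorm2 (Quat a b c d))%:~R.
  by rewrite /qnorm2 /= !(rmorphD, rmorphXn).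
apply: ord3P; apply: ord3P;
  rewrite !mxE /qsandwich /quat_of_vec i0E i1E i2E !mxE /qinv N /= ;
  move: (_^-1) => n;
  rewrite !(rmorphD, rmorphB, rmorphN, rmorphM, rmorphXn, rmorphMn) /=; ring.
Qed.

Lemma qnorm2_neq0 q : primitive q -> qnorm2 q != 0.
Proof.
move=> /primitiveP pq; apply/eqP => /qnorm2_eq0 q0.
by have := pq 2; rewrite q0 /qdvd /= dvdz1 => /(_ isT).
Qed.

Lemma rotq_O3 q : qnorm2 q != 0 -> O3 (rotq R q).
Proof.
move=> q0; rewrite /O3 /= rotq_euler linearZ /= -scalemxAl -scalemxAr scalerA.
rewrite map_trmx -map_mxM euler_orth map_scalar_mx scale_scalar_mx rmorphXn.
by rewrite expr2 mulrACA mulVf ?mulr1 // intr_eq0.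
Qed.

Lemma det_rotq q : qnorm2 q != 0 -> \det (rotq R q) = 1.
Proof.
move=> q0; rewrite rotq_euler detZ det_map_mx det_euler rmorphXn -exprMn.
by rewrite mulVf ?expr1n // intr_eq0.
Qed.

Lemma O3N A : O3 A -> O3 (- A).
Proof. by rewrite /O3 /= linearN mulNmx mulmxN opprK. Qed.

Lemma rotqM p q : rotq R (qmul p q) = rotq R p *m rotq R q.
Proof.
by rewrite !rotq_euler -scalemxAl -scalemxAr scalerA -map_mxM eulerM qnorm2M rmorphM invfM.
Qed.

Lemma rotq_conj q : rotq R (qconj q) = (rotq R q)^T.
Proof. by rewrite !rotq_euler qnorm2_conj euler_conj -map_trmx linearZ. Qed.

Lemma rotq_scale k q : k != 0 -> rotq R (qscale k q) = rotq R q.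
Proof.
move=> k0; rewrite !rotq_euler qnorm2_scale euler_scale.
have -> : map_mx intr (k ^+ 2 *: euler q) = (k ^+ 2)%:~R *: map_mx intr (euler q) :> 'M[R]_3.
  by apply/matrixP => i j; rewrite !mxE rmorphM.
by rewrite scalerA rmorphM invfM mulrAC mulVf ?mul1r // intr_eq0 expf_neq0.
Qed.

Definition pm_rotq A : Prop := exists2 q, qnorm2 q != 0 & A = rotq R q \/ A = - rotq R q.

Lemma pm_rotqM A B : pm_rotq A -> pm_rotq B -> pm_rotq (A *m B).
Proof.
move=> [p p0 pA] [q q0 qB]; exists (qmul p q); first by rewrite qnorm2M mulf_neq0.
by rewrite rotqM; case: pA => ->; case: qB => ->; rewrite ?(mulNmx, mulmxN, opprK);
  by [left | right].
Qed.

Lemma pm_rotq_tr A : pm_rotq A -> pm_rotq A^T.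
Proof.
move=> [p p0 pA]; exists (qconj p); first by rewrite qnorm2_conj.
by rewrite rotq_conj; case: pA => ->; rewrite ?linearN; by [left | right].
Qed.

Lemma pm_rotq1 : pm_rotq 1%:M.
Proof.
exists (Quat 1 0 0 0) => //; left; rewrite rotq_euler invr1 scale1r; apply/matrixP.
by apply: ord3P; apply: ord3P; rewrite !mxE.
Qed.

Lemma pm_rotq_O3 A : pm_rotq A -> O3 A.
Proof. by move=> [q q0 [->|->]]; [|apply: O3N]; exact: rotq_O3. Qed.

Lemma pm_rotq_primitive A : pm_rotq A ->
  exists2 q, primitive q & A = rotq R q \/ A = - rotq R q.
Proof.
move=> [q q0 qA].
have [d dq dmax] : exists2 d, qdvd d q & forall e, qdvd e q -> (e %| d)%Z.
  exists (gcdz (gcdz (qc0 q) (qc1 q)) (gcdz (qc2 q) (qc3 q))); first by rewrite qdvdE dvdzz.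
  by move=> e; rewrite qdvdE.
case/qdvdP: dq => p pE.
have d0 : d != 0.
  by apply: contraNneq q0 => d0; rewrite pE d0 qnorm2_scale expr0n mul0r.
exists p; last by move: qA; rewrite pE rotq_scale.
apply/primitiveP => e /qdvdP[p' p'E].
have := dmax (d * e); rewrite -{2}[d]mulr1 dvdz_mul2l //; apply.
by rewrite pE p'E; apply/and4P; split; rewrite /= mulrA dvdz_mulr.
Qed.

(** Conjugation by a pure quaternion [w] is minus the reflection in the plane
    orthogonal to [w]. *)
Lemma rotq_pure w y : dot w w != 0 ->
  - rotq R (qpure w) *m y = y - (2 * dot (iz w) y / dot (iz w) (iz w)) *: iz w.
Proof.
move=> w0; have w0' : dot (iz w) (iz w) != 0 by rewrite dot_iz intr_eq0.
rewrite rotq_euler mulNmx -scalemxAl qnorm2_pure -dot_iz.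
have -> : map_mx intr (euler (qpure w)) *m y =
    (2 * dot (iz w) y) *: iz w - dot (iz w) (iz w) *: y.
  rewrite /dot !izE; apply: cv3P; rewrite mulmx3E !mxE /=;
  rewrite !(rmorphD, rmorphB, rmorphN, rmorphM, rmorphXn, rmorphMn) /=; ring.
rewrite scalerBr !scalerA mulVf // scale1r opprB; congr (_ - _ *: _).
by rewrite mulrC.
Qed.

(** The reflection exchanging two vectors [f] and [e] of equal length, chosen
    to be the identity when they coincide. *)
Lemma reflection_exchange (n : int) (z w : 'cV[int]_3) (f e : 'cV[R]_3) : n != 0 ->
  n%:~R *: f = iz z -> n%:~R *: e = iz w -> dot f f = dot e e ->
  exists B, [/\ pm_rotq B, B *m f = e & forall y, dot y f = dot y e -> B *m y = y].
Proof.
move=> n0 fz ew fe; have nR : n%:~R != 0 :> R by rewrite intr_eq0.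
have [E|ne] := eqVneq z w.
  exists 1%:M; split=> [||y _]; rewrite ?mul1mx //; first exact: pm_rotq1.
  by apply: (scalerI nR); rewrite fz ew E.
pose u := z - w.
have uE : iz u = n%:~R *: (f - e) by rewrite izD izN -fz -ew scalerBr.
have uu : dot u u != 0.
  apply: contra_neq ne => uu; have := @qnorm2_eq0 (qpure u).
  rewrite qnorm2_pure => /(_ uu) [u0 u1 u2]; apply/eqP; rewrite -subr_eq0.
  by apply/eqP/cv3P; rewrite [RHS]mxE.
exists (- rotq R (qpure u)); split=> [||y yfe].
- by exists (qpure u); [rewrite qnorm2_pure | right].
- rewrite rotq_pure // uE.
  have -> : 2 * dot (n%:~R *: (f - e)) f = dot (n%:~R *: (f - e)) (n%:~R *: (f - e)) / n%:~R.
    rewrite !dotZr !dotZl mulrAC mulrA divff // mul1r.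
    rewrite dotDr dotNr ![dot (f - e) _]dotC !dotDr !dotNr -fe [dot e f]dotC; ring.
  rewrite mulrAC divff; last by rewrite -uE dot_iz intr_eq0.
  by rewrite mul1r scalerA mulVf // scale1r opprB addrC subrK.
rewrite rotq_pure // uE dotZl dotC dotDr dotNr yfe subrr !mulr0 mul0r scale0r subr0 //.
Qed.

Definition rational_mx A : Prop :=
  exists (n : int) (M : 'M[int]_3), n != 0 /\ n%:~R *: A = map_mx intr M.

Lemma rational_mxM A B : rational_mx A -> rational_mx B -> rational_mx (A *m B).
Proof.
move=> [n [M [n0 nM]]] [n' [M' [n0' nM']]]; exists (n * n'), (M *m M').
split; first by rewrite mulf_neq0.
by rewrite map_mxM -nM -nM' -scalemxAl -scalemxAr scalerA rmorphM.
Qed.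

Lemma rational_rotq q : qnorm2 q != 0 -> rational_mx (rotq R q).
Proof.
move=> q0; exists (qnorm2 q), (euler q); split=> //.
by rewrite rotq_euler scalerA divff ?scale1r // intr_eq0.
Qed.

Lemma rational_pm_rotq A : pm_rotq A -> rational_mx A.
Proof.
move=> [q q0 [->|->]]; first exact: rational_rotq.
have [n [M [n0 nM]]] := rational_rotq q0; exists n, (- M); split=> //.
by rewrite scalerN nM; apply/matrixP => i j; rewrite !mxE rmorphN.
Qed.

Definition basis3 (i : 'I_3) : 'cV[int]_3 := delta_mx i 0.

(** Cartan-Dieudonne: composing with at most three reflections moves the images
    of the basis vectors back one after the other. *)
Lemma O3_rational_pm_rotq A : O3 A -> rational_mx A -> pm_rotq A.
Proof.
move=> OA rA.
have step C i : O3 C -> rational_mx C ->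
    exists B, [/\ pm_rotq B, B *m (C *m iz (basis3 i)) = iz (basis3 i) &
      forall j, C *m iz (basis3 j) = iz (basis3 j) -> j != i ->
        B *m iz (basis3 j) = iz (basis3 j)].
  move=> OC [n [M [n0 nM]]].
  have dotC y u : dot (C *m y) (C *m u) = dot y u.
    by rewrite dot_mulmx mulmxA O3_tr // mul1mx.
  have fz : n%:~R *: (C *m iz (basis3 i)) = iz (M *m basis3 i).
    by rewrite scalemxAl nM -iz_mul.
  have ew : n%:~R *: iz (basis3 i) = iz (n *: basis3 i) by rewrite izZ.
  have [B [pB Bf By]] := reflection_exchange n0 fz ew (dotC _ _).
  exists B; split=> // j Cj ji; apply: By.
  by rewrite -{1}Cj dotC.
have cl C B : pm_rotq B -> O3 C -> rational_mx C -> O3 (B *m C) /\ rational_mx (B *m C).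
  move=> pB OC rC; split; last by apply: rational_mxM => //; exact: rational_pm_rotq.
  by rewrite /O3 /= trmx_mul mulmxA -[B *m C *m _]mulmxA OC mulmx1; exact: pm_rotq_O3.
have [B0 [pB0 f00 _]] := step A i0 OA rA.
have [OB1 r1] := cl _ _ pB0 OA rA.
have [B1 [pB1 f11 k1]] := step _ i1 OB1 r1.
have [OB2 r2] := cl _ _ pB1 OB1 r1.
have [B2 [pB2 f22 k2]] := step _ i2 OB2 r2.
have fix0 : (B1 *m (B0 *m A)) *m iz (basis3 i0) = iz (basis3 i0).
  by rewrite -!mulmxA f00 k1 // -mulmxA f00.
have g0 : B2 *m iz (basis3 i0) = iz (basis3 i0) by apply: k2.
have e1 : (B1 *m (B0 *m A)) *m iz (basis3 i1) = iz (basis3 i1) by rewrite -mulmxA f11.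
have g1 : B2 *m iz (basis3 i1) = iz (basis3 i1) by apply: k2.
have E : B2 *m (B1 *m (B0 *m A)) = 1%:M.
  have izb i : iz (basis3 i) = delta_mx i 0 :> 'cV[R]_3.
    by apply/colP => k; rewrite !mxE; case: (_ && _).
  have H i : B2 *m (B1 *m (B0 *m A)) *m (delta_mx i 0 : 'cV[R]_3) =
      1%:M *m (delta_mx i 0 : 'cV[R]_3).
    rewrite -!izb mul1mx; move: i; apply: ord3P.
    - by rewrite -mulmxA fix0 g0.
    - by rewrite -mulmxA e1 g1.
    - by rewrite -mulmxA f22.
  apply/matrixP => i j; have := H j; rewrite -!colE => /colP/(_ i).
  by rewrite [LHS]mxE [RHS]mxE.
have pB : pm_rotq (B2 *m (B1 *m B0)) by apply: pm_rotqM => //; exact: pm_rotqM.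
have BA : (B2 *m (B1 *m B0)) *m A = 1%:M by rewrite -!mulmxA.
rewrite -[A]mul1mx -(O3_tr (pm_rotq_O3 pB)) -mulmxA BA mulmx1.
exact: pm_rotq_tr.
Qed.

(** ** Rational isometries are the coincidence isometries *)

Section CoincidenceGroup.
Variable G : set 'cV[R]_3.
Hypotheses (sgG : subgroup G) (G2 : @twoZ3 R `<=` G) (GZ : G `<=` @Z3 R).

Lemma subgroup_coinc A : subgroup (coinc G A).
Proof.
case: sgG => G0 GB; split; first by split=> //; exists 0; rewrite // mulmx0.
move=> u v [Gu [u' Gu' uE]] [Gv [v' Gv' vE]]; split; first exact: GB.
by exists (u' - v'); [exact: GB | rewrite mulmxBr uE vE].
Qed.

(** Twice a common denominator times [Z^3] lies in the coincidence lattice, so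
    the cosets have representatives in a box. *)
Lemma rational_OC A : O3 A -> rational_mx A -> OC G A.
Proof.
move=> OA [n [M [n0 nM]]].
pose N := (2 * `|n|)%N; have N0 : (0 < N)%N by rewrite muln_gt0 absz_gt0.
have nM' : `|n|%:Z%:~R *: A = map_mx intr (sgz n *: M).
  rewrite abszEsg intrM -scalerA nM.
  by apply/matrixP => i j; rewrite !mxE rmorphM.
have AN k : A *m iz (N%:Z *: k) = iz (2 *: (sgz n *: M *m k)).
  rewrite PoszM -scalerA !izZ -!scalemxAr; congr (_ *: _).
  by rewrite scalemxAl nM' -iz_mul.
have ATN k : A^T *m iz (N%:Z *: k) = iz (2 *: ((sgz n *: M)^T *m k)).
  rewrite PoszM -scalerA !izZ -!scalemxAr; congr (_ *: _).
  by rewrite scalemxAl -linearZ /= nM' map_trmx -iz_mul.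
have G2' k : G (iz (2 *: k)) by apply: G2; apply/twoZ3P; exists k.
have GN k : G (iz (N%:Z *: k)) by rewrite PoszM -scalerA; exact: G2'.
have HN k : coinc G A (iz (N%:Z *: k)).
  by apply/coinc_O3 => //; split; rewrite ?ATN.
have HAN k : coinc G A (A *m iz (N%:Z *: k)).
  by rewrite AN; split; [exact: G2' | exists (iz (N%:Z *: k)); rewrite ?AN].
have fin (C : 'M[R]_3) : (forall k, coinc G A (C *m iz (N%:Z *: k))) ->
    finite_set [set translate (C *m g) (coinc G A) | g in G].
  move=> HC; apply: (@sub_finite_set _ _ (range (fun x : 'I_N * 'I_N * 'I_N =>
    translate (C *m iz (cv3 x.1.1%:Z x.1.2%:Z x.2%:Z)) (coinc G A)))).
    move=> _ [g Gg <-]; have /Z3P[z ->] := GZ Gg.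
    have [x [k zE]] := box_modz z N0; exists x => //.
    apply/esym/translate_subgroup; first exact: subgroup_coinc.
    by rewrite zE izD mulmxDr addrC addKr.
  by apply: finite_image; exact: finite_finset.
split=> //; split; try exact: subgroup_coinc; try by move=> y [].
  apply: (sub_finite_set _ (fin 1%:M _)) => [_ [g Gg <-]|k]; last by rewrite mul1mx.
  by exists g; rewrite // mul1mx.
by apply: (sub_finite_set _ (fin A HAN)) => _ [_ [g Gg <-] <-]; exists g.
Qed.

(** Pigeonhole principle: two multiples of [g] lie in the same coset. *)
Lemma finite_index_multiple (K H : set 'cV[R]_3) g : finite_index K H ->
  (forall k : nat, K (g *+ k)) -> exists2 n : nat, (0 < n)%N & H (g *+ n).
Proof.
move=> [[H0 HB] _ fin] Kg.
pose F (k : 'I_(#|` fset_set (cosets K H)|%fset).+1) := translate (g *+ k) H.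
have [inj|] := boolP (injectiveb F); last first.
  move=> /injectivePn[i [j ij Fij]].
  wlog lt_ij : i j ij Fij / (i < j)%N => [W|].
    have [|ji|E] := ltngtP i j; first exact: W.
      by apply: (W j i) => //; rewrite eq_sym.
    by move/eqP: ij; case; apply/val_inj.
  exists (j - i)%N; first by rewrite subn_gt0.
  have : translate (g *+ i) H (g *+ j) by rewrite -/(F i) Fij; exists 0; rewrite ?addr0.
  by move=> [h Hh E]; rewrite mulrnBr ?(ltnW lt_ij) // -E addrC addKr.
have uF : uniq [seq F i | i <- enum 'I_(#|` fset_set (cosets K H)|%fset).+1].
  by rewrite map_inj_uniq ?enum_uniq //; exact/injectiveP.
have := @uniq_leq_size _ _ (enum_fset (fset_set (cosets K H))) uF.
rewrite size_map -cardE card_ord ltnn => W; exfalso; suff : false by []; apply: W.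
by move=> S /mapP[i _ ->]; apply/mem_enum_fset_set => //; exists (g *+ i).
Qed.

Lemma finite_index_rational A :
  (forall i, exists2 n : nat, (0 < n)%N & @Z3 R ((A *m iz (basis3 i)) *+ n)) ->
  rational_mx A.
Proof.
move=> H; have [n0 p0 H0] := H i0; have [n1 p1 H1] := H i1; have [n2 p2 H2] := H i2.
pose N := (n0 * n1 * n2)%N.
have Zn u (k l : nat) : @Z3 R (u *+ k) -> @Z3 R (u *+ (k * l)).
  by move=> /Z3P[z E]; rewrite mulrnA E -scaler_nat -[l%:R]/(l%:Z%:~R) -izZ; exact: Z3_iz.
have HN i : @Z3 R ((A *m iz (basis3 i)) *+ N).
  move: i; apply: ord3P; first by rewrite /N -mulnA; apply: Zn.
    by rewrite /N [(n0 * n1)%N]mulnC -mulnA; apply: Zn.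
  by rewrite /N mulnC; apply: Zn.
have /choice[f fE] : forall i, exists z, (A *m iz (basis3 i)) *+ N = iz z.
  by move=> i; apply/Z3P.
exists N%:Z, (\matrix_(i, j) f j i 0); split.
  by rewrite eqz_nat -lt0n !muln_gt0 p0 p1.
apply/matrixP => i j; have /colP/(_ i) := fE j.
rewrite !mxE => <-; rewrite mulmxnE mxE (bigD1 j) //= big1 ?addr0.
  by rewrite !mxE !eqxx mulr1 mulr_natl.
by move=> k kj; rewrite !mxE (negbTE kj) mulr0.
Qed.

Lemma OC_rational A : OC G A -> rational_mx A.
Proof.
move=> [OA _ fin]; apply: finite_index_rational => i.
have Gk (k : nat) : mximage A G ((A *m iz (2 *: basis3 i)) *+ k).
  exists (iz ((2 * k%:Z) *: basis3 i)).
    by apply: G2; apply/twoZ3P; exists (k%:Z *: basis3 i); rewrite scalerA.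
  by rewrite mulrC -scalerA izZ -scalemxAr -scaler_nat.
have [n n0 [/GZ Hn _]] := finite_index_multiple fin Gk.
exists (2 * n)%N; first by rewrite muln_gt0.
by move: Hn; rewrite izZ -scalemxAr mulrnA scaler_nat.
Qed.

Lemma OC_primitive A : OC G A ->
  exists2 q, primitive q & A = rotq R q \/ A = - rotq R q.
Proof.
move=> OCA; apply: pm_rotq_primitive; apply: O3_rational_pm_rotq.
  by case: OCA.
exact: OC_rational.
Qed.

End CoincidenceGroup.

End Rational.

(** * Coincidence lattices and packings of a rational isometry *)

Section Structure.
Variable R : realType.
Implicit Types (A : 'M[R]_3) (y : 'cV[R]_3) (z v : 'cV[int]_3).
Local Notation iz := (@iz R).
Local Notation xfcc := (translate (xD3 R) (@fcc R)).

Definition csl_mx (m : nat) v A : Prop :=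
  O3 A /\ forall z, @Z3 R (A^T *m iz z) <-> m%:Z %|| dot v z.

Definition sgn_mod4 (m : nat) : int := if (m %% 4 == 1)%N then 1 else -1.

(** [x + fcc] contains exactly one of [m x] and [- m x]. This point of
    [x + fcc] has a preimage in [x + fcc] whenever any point has, and it depends
    on [m] only, so that the packing is determined by the lattice. *)
Definition base_point (m : nat) : 'cV[R]_3 := (sgn_mod4 m * m%:Z)%:~R *: xD3 R.

Lemma sgn_mod4P m : odd m -> 4 %|| sgn_mod4 m * m%:Z - 1.
Proof. by rewrite /sgn_mod4; case: eqP; lia. Qed.

Definition ones3 : 'cV[int]_3 := cv3 1 1 1.

Lemma base_pointE m : base_point m = 2^-1 *: iz ((sgn_mod4 m * m%:Z) *: ones3).
Proof.
rewrite /base_point izZ !scalerA mulrC; congr (_ *: _).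
by apply: cv3P; rewrite !mxE.
Qed.

Lemma xfcc_base_point m : odd m -> xfcc (base_point m).
Proof.
move=> om; apply/xfccP; exists ((sgn_mod4 m * m%:Z) *: ones3).
have H := sgn_mod4P om; split; first exact: base_pointE.
  by apply: ord3P; rewrite !mxE /= mulr1; move: (_ * _) H; lia.
by rewrite totZ /tot !mxE /=; move: (_ * _) H; lia.
Qed.

Section EulerForm.
Variables (m : nat) (q : quat int) (B : 'M[int]_3) (s e : int) (v : 'cV[int]_3).
Variable A : 'M[R]_3.
Hypotheses (om : odd m) (qm : qnorm2 q = m%:Z) (sB : sgnperm s B) (e1 : e * e = 1).
Hypothesis AE : A = e%:~R *: ((m%:Z)%:~R^-1 *: map_mx intr (euler q *m B)).

Let m0 : (m%:Z)%:~R != 0 :> R.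
Proof. by rewrite intr_eq0; case: (m) om. Qed.

Let ATE z : A^T *m iz z =
  (m%:Z)%:~R^-1 *: iz (e *: (B^T *m ((euler q)^T *m z))).
Proof.
rewrite AE scalerA linearZ /= map_trmx -scalemxAl -iz_mul trmx_mul -mulmxA izZ.
by rewrite scalerA mulrC.
Qed.

Lemma euler_form_O3 : O3 A.
Proof.
rewrite /O3 /= AE scalerA linearZ /= map_trmx -scalemxAl -scalemxAr scalerA.
rewrite -map_mxM trmx_mul mulmxA -[euler q *m B *m _]mulmxA.
case: sB => BB _ _; rewrite BB mulmx1 euler_orth qm map_scalar_mx scale_scalar_mx.
rewrite rmorphXn /= (_ : _ * _ = 1) // expr2.
have -> : (e%:~R : R) / (m%:Z)%:~R * (e%:~R / (m%:Z)%:~R) * ((m%:Z)%:~R * (m%:Z)%:~R) =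
  (e%:~R * e%:~R) * ((m%:Z)%:~R / (m%:Z)%:~R) * ((m%:Z)%:~R / (m%:Z)%:~R) by ring.
by rewrite divff // !mulr1 -intrM e1.
Qed.

Lemma euler_form_csl_mx :
  (forall z, euler_kernel m q z <-> m%:Z %|| dot v z) -> csl_mx m v A.
Proof.
move=> ker; split=> [|z]; first exact: euler_form_O3.
rewrite -ker ATE; case: sB => BB BTB _.
set w := (euler q)^T *m z.
have dvd_mul (C : 'M[int]_3) (x : 'cV[int]_3) : (forall i, m%:Z %|| x i 0) -> forall i, m%:Z %|| (C *m x) i 0.
  by move=> Hx i; rewrite mulmx3E !rpredD // dvdz_mull.
have -> : euler_kernel m q z <-> (forall i, m%:Z %|| (e *: (B^T *m w)) i 0).
  split=> [H i|H i].
    by rewrite mxE dvdz_mull //; exact: dvd_mul.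
  rewrite -/w (_ : w = B *m (e *: (e *: (B^T *m w)))).
    by apply: dvd_mul => j; rewrite mxE dvdz_mull.
  by rewrite scalerA e1 scale1r mulmxA BB mul1mx.
move: (e *: _) => x; split=> [/Z3P[x' E] i|H].
  have : iz x = iz (m%:Z *: x') by rewrite izZ -E scalerA divff // scale1r.
  by move=> /iz_inj ->; rewrite mxE dvdz_mulr.
have /choice[x' x'E] : forall i, exists k, x i 0 = k * m%:Z.
  by move=> i; apply/dvdzP.
apply/Z3P; exists (\col_i x' i); apply/colP => i.
by rewrite !mxE x'E intrM mulrC mulfK.
Qed.

Lemma euler_form_tot z : oddv z ->
  oddv (e *: (B^T *m ((euler q)^T *m z))) /\
  4 %|| tot (e *: (B^T *m ((euler q)^T *m z))) - e * s * m%:Z * tot z.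
Proof.
move=> oz; rewrite -euler_conj.
have [] := @euler_parity (qconj q) z oz; rewrite qnorm2_conj qm => t1 /(_ om) od1.
case: sB => _ _ /(_ _ od1) [_ od2 _ t2]; split.
  move=> i; rewrite mxE; have := od2 i; move: (_ i 0) => x.
  have [->|->] : e = 1 \/ e = -1 by nia.
    by rewrite mul1r.
  by lia.
rewrite totZ; set a := tot _ in t2 *; set b := tot _ in t1 t2.
rewrite (_ : _ - _ = e * (a - s * b) + e * s * (b - m%:Z * tot z)); last by ring.
by rewrite rpredD // dvdz_mull.
Qed.

Lemma euler_form_base : e * s = 1 -> xfcc (A^T *m base_point m).
Proof.
move=> es; have oo : oddv ones3 by apply: ord3P; rewrite mxE.
have [od1 t1] := euler_form_tot oo; apply/xfccP.
exists (sgn_mod4 m *: (e *: (B^T *m ((euler q)^T *m ones3)))).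
move: od1 t1; set w := e *: _ => od1 t1; split.
- rewrite base_pointE -scalemxAr izZ -scalemxAr ATE -/w izZ !scalerA; congr (_ *: _).
  by rewrite intrM; field.
- move=> i; rewrite mxE; have := od1 i; move: (_ i 0) => x.
  by rewrite /sgn_mod4; case: ifP => _; lia.
rewrite totZ; move: t1; rewrite es mul1r (_ : tot ones3 = 3); last by rewrite /tot !mxE.
move=> t1; rewrite (_ : _ - 3 = sgn_mod4 m * (tot w - m%:Z * 3) +
  3 * (sgn_mod4 m * m%:Z - 1)); last by ring.
by rewrite rpredD // dvdz_mull // sgn_mod4P.
Qed.

(** Twice the preimage of such a point would have coordinate sum [- 3] instead
    of [3] modulo 4, because the odd factor [m] cancels. *)
Lemma euler_form_empty : e * s = -1 -> forall y, xfcc y -> ~ xfcc (A^T *m y).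
Proof.
move=> es y /xfccP[z [-> oz tz]] /xfccP[z' [E oz' tz']].
have [_ ] := euler_form_tot oz; have h20 : (2 : R)^-1 != 0 by rewrite invr_eq0 pnatr_eq0.
move: E; rewrite -scalemxAr => /(scalerI h20); rewrite ATE.
set w := e *: _ => /(congr1 ( *:%R (m%:Z)%:~R)); rewrite scalerA divff // scale1r -izZ.
move/iz_inj => ->; rewrite totZ es => t1.
have [[k kE] [k' k'E]] : (exists k, tot z = 4 * k + 3) /\ (exists k, tot z' = 4 * k + 3).
  by split; [exists (divz (tot z - 3) 4) | exists (divz (tot z' - 3) 4)]; lia.
have : 4 %|| 6 * m%:Z.
  rewrite (_ : 6 * m%:Z = (m%:Z * tot z' - (-1) * m%:Z * tot z) + 4 * (- m%:Z * (k + k'))).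
    by rewrite rpredD // dvdz_mulr.
  by rewrite kE k'E; ring.
by lia.
Qed.

End EulerForm.

(** ** Indices *)

(** The multiples [w *+ k] with [k < m] represent the cosets of the kernel of
    [phi] modulo [m]. The last clause, uniqueness modulo [m], makes the cosets
    disjoint, so that the index can be compared with densities. *)
Lemma group_index_functional (V : zmodType) (G H : set V) (phi : V -> int)
    (m : nat) (w : V) : (0 < m)%N ->
  subgroup G -> (forall g g', G g -> G g' -> phi (g - g') = phi g - phi g') ->
  G w -> m%:Z %|| phi w - 1 -> H = [set g | G g /\ m%:Z %|| phi g] ->
  [/\ subgroup H, group_index G H = m, (forall k : nat, G (w *+ k)) &
      forall g, G g -> exists2 k : 'I_m, translate (w *+ k) H g &
        forall k', translate (w *+ k') H g -> k = k' %[mod m]].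
Proof.
move=> m0 sG phiB Gw phiw HE; have [G0 GB] := sG.
have GN g : G g -> G (- g) := subgroupN sG.
have GD g g' : G g -> G g' -> G (g + g') := subgroupD sG.
have phi0 : phi 0 = 0 by have := phiB _ _ G0 G0; rewrite subr0 subrr.
have phiN g : G g -> phi (- g) = - phi g.
  by move=> Gg; rewrite -sub0r phiB // phi0 sub0r.
have phiD g g' : G g -> G g' -> phi (g + g') = phi g + phi g'.
  by move=> Gg Gg'; rewrite -[g']opprK phiB ?phiN ?opprK //; exact: GN.
have Gk (k : nat) : G (w *+ k) by elim: k => // k IH; rewrite mulrSr; exact: GD.
have phik (k : nat) : phi (w *+ k) = phi w * k%:Z.
  elim: k => [|k IH]; first by rewrite phi0 mulr0.
  by rewrite mulrSr phiD // IH -addn1 PoszD mulrDr mulr1.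
have phik1 k : m%:Z %|| phi (w *+ k) - k%:Z.
  by rewrite phik -{2}[k%:Z]mul1r -mulrBl dvdz_mulr.
have sH : subgroup H.
  rewrite HE; split; first by rewrite /= phi0 dvdz0.
  move=> a b [Ga ma] [Gb mb]; split; first exact: GB.
  by rewrite phiB // rpredB.
have trP k g : G g -> translate (w *+ k) H g <-> m%:Z %|| phi g - k%:Z.
  move=> Gg; split=> [[h]|mg].
    rewrite HE => -[Gh mh] <-; rewrite phiD // addrAC rpredD //.
  exists (g - w *+ k); last by rewrite addrCA subrr addr0.
  rewrite HE; split; first exact: GB.
  rewrite phiB //; have -> : phi g - phi (w *+ k) = (phi g - k%:Z) - (phi (w *+ k) - k%:Z) by ring.
  exact: rpredB.
have cov g : G g -> exists2 k : 'I_m, translate (w *+ k) H g &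
        forall k', translate (w *+ k') H g -> k = k' %[mod m].
  move=> Gg; have [u [k uE]] := ord_modz (phi g) m0.
  have E : m%:Z %|| phi g - u%:Z by rewrite uE addrAC subrr add0r dvdz_mulr.
  exists u; first exact/trP.
  move=> k' /(trP _ _ Gg) E'; apply/eqP; rewrite -eqz_nat -!modz_nat eqz_mod_dvd /=.
  rewrite (_ : _ - _ = (phi g - k'%:Z) - (phi g - u%:Z)); last by ring.
  exact: rpredB.
split=> //; rewrite /group_index.
have eqC k g : G g -> translate (w *+ k) H g -> translate g H = translate (w *+ k) H.
  move=> Gg [h Hh <-]; apply: translate_subgroup => //.
  by rewrite addrC addKr.
rewrite (@card_fset_set_seq _ _ [seq translate (w *+ (k : 'I_m)) H | k <- enum 'I_m]).
- by rewrite size_map -cardE card_ord.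
- rewrite map_inj_uniq ?enum_uniq // => i j E.
  have : translate (w *+ j) H (w *+ i) by rewrite -E; exists 0; [exact: sH.1 | rewrite addr0].
  move=> /(trP _ _ (Gk i)) Hij.
  have : m%:Z %|| i%:Z - j%:Z.
    rewrite (_ : _ - _ = (phi (w *+ i) - j%:Z) - (phi (w *+ i) - i%:Z)); last by ring.
    exact: rpredB.
  rewrite -eqz_mod_dvd !modz_nat eqz_nat !modn_small // => /eqP; exact: val_inj.
move=> S; split=> [[g Gg <-]|/mapP[k _ ->]]; last by exists (w *+ k).
have [k kg _] := cov g Gg; apply/mapP; exists k; first by rewrite mem_enum.
exact: eqC.
Qed.

End Structure.

(** * Densities *)

Section DensityTheory.
Variable R : realType.
Implicit Types (S H : set 'cV[R]_3) (y c : 'cV[R]_3) (r d : R).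
Local Notation iz := (@iz R).

Lemma has_density_unique S d d' : has_density S d -> has_density S d' -> d = d'.
Proof. by move=> [_ Sd] [_ Sd']; exact: (cvg_unique (@Rhausdorff R) Sd Sd'). Qed.

Lemma has_densityU S S' d d' : (forall y, S y -> ~ S' y) ->
  has_density S d -> has_density S' d' -> has_density (S `|` S') (d + d').
Proof.
move=> dis [fS Sd] [fS' Sd']; split=> [r|].
  by rewrite setIUl finite_setU.
rewrite [G in G @ _ --> _](_ : _ =
  (fun r => (#|` fset_set (S `&` cube r)|%fset)%:R / (2 * r) ^+ 3) \+
  (fun r => (#|` fset_set (S' `&` cube r)|%fset)%:R / (2 * r) ^+ 3)).
  exact: cvgD.
apply/funext => r /=; rewrite -mulrDl -natrD; congr (_%:R / _).
have mS y := mem_enum_fset_set y (fS r); have mS' y := mem_enum_fset_set y (fS' r).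
rewrite setIUl (@card_fset_set_seq _ _ (enum_fset (fset_set (S `&` cube r)) ++
   enum_fset (fset_set (S' `&` cube r)))) ?size_cat //.
  rewrite cat_uniq !fset_uniq /= andbT; apply/hasPn => y /mS' [Sy' _].
  by apply/negP => /mS [/dis].
move=> y; rewrite mem_cat; split.
  by case=> [/mS ->|/mS' ->]; rewrite ?orbT.
by case/orP=> [/mS|/mS']; [left|right].
Qed.

Lemma has_density0 : has_density (@set0 'cV[R]_3) 0.
Proof.
split=> [r|]; first by rewrite set0I; exact: finite_set0.
under eq_fun do rewrite set0I fset_set0 cardfs0 mul0r.
exact: cvg_cst.
Qed.

Lemma has_density_bigU (I : eqType) (s : seq I) (F : I -> set 'cV[R]_3) d : uniq s ->
  {in s, forall i, has_density (F i) d} ->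
  {in s &, forall i j y, F i y -> F j y -> i = j} ->
  has_density [set y | exists2 i, i \in s & F i y] ((size s)%:R * d).
Proof.
elim: s => [|i s IH] /=; [move=> _ _ _ | move=> /andP[si us] Fd Fdis].
  rewrite (_ : [set y | _] = set0) ?mul0r; first exact: has_density0.
  by apply/seteqP; split=> y; [case=> i; rewrite in_nil | case].
rewrite (_ : [set y | _] = F i `|` [set y | exists2 i, i \in s & F i y]).
  rewrite -natr1 mulrDl mul1r addrC; apply: has_densityU.
  - move=> y Fy [j js Fj]; have := Fdis i j _ _ y Fy Fj.
    by rewrite !inE eqxx js orbT => /(_ isT isT) ij; rewrite ij js in si.
  - by apply: Fd; rewrite inE eqxx.
  apply: IH => // [j js|j k js ks]; first by apply: Fd; rewrite inE js orbT.
  by apply: Fdis; rewrite inE ?js ?ks orbT.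
apply/seteqP; split=> y.
  by move=> [j]; rewrite inE => /orP[/eqP ->|js] Fj; [left | right; exists j].
by case=> [Fy|[j js Fj]]; [exists i | exists j]; rewrite ?inE ?eqxx ?js ?orbT.
Qed.

Lemma interval_count (N : nat) (c r : R) : (0 < N)%N -> 0 <= r ->
  exists s : seq int, [/\ uniq s, forall k, (`|c + N%:R * k%:~R| <= r) = (k \in s) &
    `|(size s)%:R - 2 * r / N%:R| <= 1].
Proof.
move=> N0 r0; have NR : 0 < N%:R :> R by rewrite ltr0n.
set a := (- r - c) / N%:R; set b := (r - c) / N%:R.
have ab : b = a + 2 * r / N%:R by rewrite /a /b; field; rewrite gt_eqF.
set lo := Num.ceil a; set hi := Num.floor b.
have /andP[lo1 lo2] := ceil_itv a; have /andP[hi1 hi2] := floor_itv b.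
rewrite -/lo -/hi in lo1 lo2 hi1 hi2.
have q0 : 0 <= 2 * r / N%:R by rewrite divr_ge0 ?mulr_ge0 // ltW.
have n0 : 0 <= hi - lo + 1.
  have : -1 < (hi - lo + 1)%:~R :> R.
    by move: lo1 hi2; rewrite !rmorphD !rmorphN /=; lra.
  by rewrite -[-1]/((-1)%:~R) ltr_int; lia.
pose n := absz (hi - lo + 1).
have nE : n%:Z = hi - lo + 1 by rewrite /n gez0_abs.
exists [seq lo + j%:Z | j <- iota 0 n]; split.
- by rewrite map_inj_uniq ?iota_uniq // => j j' /addrI [].
- move=> k; transitivity ((lo <= k) && (k <= hi)).
    rewrite ceil_le_int floor_ge_int /a /b ler_pdivrMr // ler_pdivlMr // ler_norml.
    by apply/andP/andP => -[? ?]; split; lra.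
  apply/andP/mapP => [[k1 k2]|[j]].
    by exists `|k - lo|%N; rewrite ?mem_iota /=; lia.
  by rewrite mem_iota => /andP[_ j2] ->; split; lia.
rewrite size_map size_iota -[n%:R]/((n%:Z)%:~R) nE.
by move: lo1 lo2 hi1 hi2; rewrite !rmorphD !rmorphN /= ler_norml ab => *; apply/andP; split; lra.
Qed.

Lemma prod3_approx (x y z b e : R) : 0 <= b <= 1 -> 0 <= e <= 1 ->
  `|x - b| <= e -> `|y - b| <= e -> `|z - b| <= e ->
  `|x * y * z - b ^+ 3| <= 7 * e.
Proof.
move=> /andP[b0 b1] /andP[e0 e1] xb yb zb.
have x2 : `|x| <= 2 by rewrite -(subrK b x) (le_trans (ler_normD _ _)) // (ger0_norm b0); lra.
have y2 : `|y| <= 2 by rewrite -(subrK b y) (le_trans (ler_normD _ _)) // (ger0_norm b0); lra.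
have -> : x * y * z - b ^+ 3 = x * y * (z - b) + (x * b * (y - b) + b * b * (x - b)) by ring.
apply: le_trans (ler_normD _ _) _.
have H1 : `|x * y * (z - b)| <= 4 * e.
  rewrite normrM ler_pM // normrM (_ : 4 = 2 * 2); last by lra.
  by rewrite ler_pM.
have H2 : `|x * b * (y - b)| <= 2 * e.
  by rewrite normrM ler_pM // normrM (ger0_norm b0) -[leRHS]mulr1 ler_pM.
have H3 : `|b * b * (x - b)| <= e.
  rewrite normrM -[leRHS]mul1r ler_pM // ger0_norm ?mulr_ge0 //.
  by rewrite -[leRHS]mulr1 ler_pM.
by have := ler_normD (x * b * (y - b)) (b * b * (x - b)); lra.
Qed.

Definition shifted_grid (N : nat) c : set 'cV[R]_3 :=
  [set y | exists k, y = c + N%:R *: iz k].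

(** The points of a shifted grid in a cube form a product of three intervals,
    and each interval has the expected number of points up to 1. *)
Lemma shifted_grid_count (N : nat) c r : (0 < N)%N -> 1 <= r ->
  finite_set (shifted_grid N c `&` cube r) /\
  `|(#|` fset_set (shifted_grid N c `&` cube r)|%fset)%:R / (2 * r) ^+ 3 - N%:R^-1 ^+ 3|
     <= 7 * (2 * r)^-1.
Proof.
move=> N0 r1; have r0 : 0 <= r by lra.
have NR : 0 < N%:R :> R by rewrite ltr0n.
have [s0 [u0 m0 c0]] := interval_count (c i0 0) N0 r0.
have [s1 [u1 m1 c1]] := interval_count (c i1 0) N0 r0.
have [s2 [u2 m2 c2]] := interval_count (c i2 0) N0 r0.
pose L := [seq c + N%:R *: iz (cv3 ab.1 ab.2 l) |
  ab <- [seq (a, b) | a <- s0, b <- s1], l <- s2].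
have sL : size L = (size s0 * size s1 * size s2)%N by rewrite !size_allpairs.
have uL : uniq L.
  apply: allpairs_uniq => //; first by apply: allpairs_uniq => // -[? ?] [? ?].
  move=> [[a b] l] [[a' b'] l'] _ _ /= /addrI.
  move/(scalerI (lt0r_neq0 NR))/iz_inj/colP => E.
  by have := (E i0, E i1, E i2); rewrite !mxE /= => -[[-> ->] ->].
have mL y : (shifted_grid N c `&` cube r) y <-> y \in L.
  split=> [[[k ->] yr]|/allpairsP[[ab l] /= [/allpairsP[[a b] /= [sa sb ->]] sl ->]]].
    apply/allpairsP; exists ((k i0 0, k i1 0), k i2 0); split=> /=.
    - apply/allpairsP; exists (k i0 0, k i1 0); split=> //=.
        by rewrite -m0; have := yr i0; rewrite !mxE.
      by rewrite -m1; have := yr i1; rewrite !mxE.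
    - by rewrite -m2; have := yr i2; rewrite !mxE.
    by rewrite -cv3E.
  split; first by exists (cv3 a b l).
  by apply: ord3P; rewrite !mxE /= ?m0 ?m1 ?m2.
split.
  rewrite (_ : _ `&` _ = [set` L]); first exact: finite_seq.
  by apply/seteqP; split=> y /mL.
rewrite (card_fset_set_seq uL mL) sL !natrM.
have r2 : 0 < 2 * r by lra.
have -> : (size s0)%:R * (size s1)%:R * (size s2)%:R / (2 * r) ^+ 3 =
  ((size s0)%:R / (2 * r)) * ((size s1)%:R / (2 * r)) * ((size s2)%:R / (2 * r)) :> R.
  by field; rewrite gt_eqF //; lra.
have dv (n : nat) : `|n%:R - 2 * r / N%:R| <= 1 -> `|n%:R / (2 * r) - N%:R^-1| <= (2 * r)^-1.
  move=> H; have -> : n%:R / (2 * r) - N%:R^-1 = (n%:R - 2 * r / N%:R) / (2 * r).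
    by field; rewrite !gt_eqF //; lra.
  rewrite normrM [X in _ * X]gtr0_norm ?invr_gt0 // -[leRHS]mul1r.
  by rewrite ler_wpM2r // invr_ge0 ltW.
apply: prod3_approx; try exact: dv.
- by rewrite invr_ge0 ltW //= invf_le1 // ler1n.
- by rewrite invr_ge0 ltW //= invf_le1 //; lra.
Qed.

Lemma has_density_shifted_grid (N : nat) c : (0 < N)%N ->
  has_density (shifted_grid N c) (N%:R^-1 ^+ 3).
Proof.
move=> N0; split=> [r|].
  have [fin _] := @shifted_grid_count N c (`|r| + 1) N0 ltac:(have := normr_ge0 r; lra).
  apply: sub_finite_set fin => y [gy yr]; split=> // i.
  by apply: le_trans (yr i) _; have := ler_norm r; lra.
apply/cvgrPdist_le => e e0; near=> r.
have r1 : 1 <= r by near: r; apply: nbhs_pinfty_ge; rewrite num_real.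
have re : 7 / e <= r by near: r; apply: nbhs_pinfty_ge; rewrite num_real.
have [_] := @shifted_grid_count N c r N0 r1.
move=> H; rewrite distrC; apply: le_trans H _.
have : 7 <= r * e by rewrite -ler_pdivrMr.
move=> re'; rewrite ler_pdivrMr; last by lra.
by rewrite mulrC; nra.
Unshelve. all: by end_near. Qed.

(** A group between [N Z^3] and [Z^3] is a disjoint union of translates of
    [N Z^3]; all its translates have the same density. *)
Lemma has_density_lattice H (N : nat) : (0 < N)%N -> subgroup H ->
  (forall k, H (iz (N%:Z *: k))) -> H `<=` @Z3 R ->
  exists2 d, 0 < d & forall c, has_density (translate c H) d.
Proof.
move=> N0 sH HN HZ; have [H0 HB] := sH.
pose box (x : 'I_N * 'I_N * 'I_N) : 'cV[int]_3 := cv3 x.1.1%:Z x.1.2%:Z x.2%:Z.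
pose s := [seq x <- enum {: 'I_N * 'I_N * 'I_N} | `[< H (iz (box x)) >]].
have ms x : x \in s <-> H (iz (box x)).
  by rewrite mem_filter mem_enum andbT; split=> [/asboolP|?]; last exact/asboolP.
exists ((size s)%:R * N%:R^-1 ^+ 3).
  rewrite mulr_gt0 ?exprn_gt0 ?invr_gt0 ?ltr0n //.
  have : (Ordinal N0, Ordinal N0, Ordinal N0) \in s.
    by apply/ms; rewrite (_ : iz _ = 0) //; apply: cv3P; rewrite !mxE.
  by case: (s).
move=> c.
rewrite (_ : translate c H = [set y | exists2 x, x \in s &
    shifted_grid N (c + iz (box x)) y]).
  apply: has_density_bigU.
  - by rewrite filter_uniq ?enum_uniq.
  - by move=> x _; exact: has_density_shifted_grid.
  move=> x x' _ _ y [k ->] [k']; rewrite -!addrA => /addrI.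
  have E z : N%:R *: iz z = iz (N%:Z *: z) by rewrite izZ.
  rewrite !E -!izD => /iz_inj/colP Hx.
  have small (a b : 'I_N) (l l' : int) : a%:Z + N%:Z * l = b%:Z + N%:Z * l' -> a = b.
    move=> H1; apply/val_inj/eqP; rewrite /= -eqz_nat.
    rewrite -[a%:Z](modz_small (d := N%:Z)) ?ltz_nat ?ltn_ord //.
    rewrite -[b%:Z](modz_small (d := N%:Z)) ?ltz_nat ?ltn_ord //.
    rewrite eqz_mod_dvd (_ : _ - _ = N%:Z * (l' - l)) ?dvdz_mulr //.
    by rewrite mulrBr; lia.
  have := (Hx i0, Hx i1, Hx i2); rewrite !mxE /=.
  move: Hx => _; case: x x' => [[x0 x1] x2] [[x0' x1'] x2'] /= -[[h0 h1] h2].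
  by rewrite (small _ _ _ _ h0) (small _ _ _ _ h1) (small _ _ _ _ h2).
have NE z : N%:R *: iz z = iz (N%:Z *: z) by rewrite izZ.
apply/seteqP; split=> y.
  move=> [h Hh <-]; have /Z3P[z zE] := HZ _ Hh.
  have [x [k zx]] := box_modz z N0; exists x; last first.
    by exists k; rewrite zE zx izD NE addrA.
  apply/ms; rewrite (_ : iz _ = h - iz (N%:Z *: k)); first exact: HB.
  by rewrite zE zx izD addrK.
move=> [x /ms Hx [k ->]]; exists (iz (box x) + iz (N%:Z *: k)); first exact: subgroupD.
by rewrite NE addrA.
Qed.

End DensityTheory.

(** * The coincidence site packings *)

Section Packings.
Variable R : realType.
Implicit Types (A : 'M[R]_3) (y : 'cV[R]_3) (z v : 'cV[int]_3) (q : quat int).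
Local Notation iz := (@iz R).
Local Notation xfcc := (translate (xD3 R) (@fcc R)).

Section OneIsometry.
Variables (m : nat) (v : 'cV[int]_3) (A : 'M[R]_3).
Hypotheses (om : odd m) (iv : isotropic m v) (cA : csl_mx m v A).

Let OA : O3 A := cA.1.
Let m0 : (0 < m)%N.
Proof. by case: (m) om. Qed.

(** Restrict the functional [v] to [G]: it still takes the value 1 modulo [m],
    because [G] contains [2 Z^3] and [m] is odd. *)
Lemma coinc_csl_index (G : set 'cV[R]_3) : subgroup G -> @twoZ3 R `<=` G ->
  G `<=` @Z3 R -> (forall y, coinc G A y <-> G y /\ @Z3 R (A^T *m y)) ->
  Sigma G A = m /\ exists w, (forall k : nat, G (w *+ k)) /\
    forall g, G g -> exists2 k : 'I_m, translate (w *+ k) (coinc G A) g &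
      forall k', translate (w *+ k') (coinc G A) g -> k = k' %[mod m].
Proof.
move=> sG G2 GZ GA; have [[w0 vw0] _] := iv.
(* [floor] inverts the embedding of the integer vectors into real ones. *)
pose phi y := dot v (map_mx Num.floor y).
have phi_iz z : phi (iz z) = dot v z.
  by congr dot; apply/colP => i; rewrite !mxE intrKfloor.
(* [m + 1] is even and 1 modulo [m], so [w] lies in [2 Z^3] and [v.w = 1]. *)
pose w := iz ((m%:Z + 1) *: w0).
have Gw : G w.
  apply: G2; apply/twoZ3P; exists (divz (m%:Z + 1) 2 *: w0).
  by rewrite scalerA; congr (iz (_ *: _)); lia.
have phiw : m%:Z %|| phi w - 1.
  rewrite /w phi_iz dotZr (_ : _ - 1 = m%:Z * dot v w0 + (dot v w0 - 1)); last by ring.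
  by rewrite rpredD // dvdz_mulr.
have phiB g g' : G g -> G g' -> phi (g - g') = phi g - phi g'.
  move=> /GZ/Z3P[z ->] /GZ/Z3P[z' ->].
  by rewrite -izN -izD !phi_iz dotDr dotNr.
have HE : coinc G A = [set g | G g /\ m%:Z %|| phi g].
  apply/seteqP; split=> g.
    move/GA => [Gg]; split=> //; have /Z3P[z zE] := GZ _ Gg.
    by move: b; rewrite zE phi_iz => /(cA.2 _).
  move=> [Gg mg]; apply/GA; split=> //; have /Z3P[z zE] := GZ _ Gg.
  by move: mg; rewrite zE phi_iz => /(cA.2 _).
have [_ ind Gk cov] := group_index_functional m0 sG phiB Gw phiw HE.
by split=> //; exists w.
Qed.

Lemma Sigma_Z3 : Sigma (@Z3 R) A = m.
Proof.
have GA y : coinc (@Z3 R) A y <-> @Z3 R y /\ @Z3 R (A^T *m y) by exact: coinc_O3.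
by case: (coinc_csl_index (@subgroup_Z3 R) (@twoZ3_Z3 R) (fun y Zy => Zy) GA).
Qed.

Let fcc_index := coinc_csl_index (@subgroup_fcc R) (@twoZ3_fcc R) (@fcc_Z3 R)
  (fun y => coinc_fcc y OA).

Lemma Sigma_fcc : Sigma (@fcc R) A = m.
Proof. by case: fcc_index. Qed.

Lemma coinc_Z3_csl : coinc (@Z3 R) A = [set iz z | z in dot_ker m v].
Proof.
apply/seteqP; split=> y.
  by move/(coinc_O3 _ _ OA) => [/Z3P[z ->] /(cA.2 _) Lz]; exists z.
by move=> [z Lz <-]; apply/coinc_O3 => //; split; [exact: Z3_iz | exact/cA.2].
Qed.

Lemma coinc_fcc_csl : coinc (@fcc R) A = [set iz z | z in dot_ker m v] `&` @fcc R.
Proof.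
rewrite -coinc_Z3_csl; apply/seteqP; split=> y.
  move/(coinc_fcc _ OA) => [fy Zy]; split=> //; apply/coinc_O3 => //.
  by split=> //; exact: fcc_Z3.
by move=> [/(coinc_O3 _ _ OA) [_ Zy] fy]; apply/coinc_fcc.
Qed.

(** [fcc] is the disjoint union of [m] translates of its coincidence lattice. *)
Lemma csl_densities : exists d : R, [/\ d != 0,
  forall c, has_density (translate c (coinc (@fcc R) A)) d &
  forall c, has_density (translate c (@fcc R)) (m%:R * d)].
Proof.
have sH : subgroup (coinc (@fcc R) A) := subgroup_coinc (@subgroup_fcc R) A.
have HZ : coinc (@fcc R) A `<=` @Z3 R by move=> y [/fcc_Z3].
have N0 : (0 < 2 * m)%N by rewrite muln_gt0.
have HN k : coinc (@fcc R) A (iz ((2 * m)%N%:Z *: k)).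
  apply/coinc_fcc => //; split.
    by apply: twoZ3_fcc; apply/twoZ3P; exists (m%:Z *: k); rewrite scalerA.
  by apply/cA.2; rewrite dotZr PoszM dvdz_mulr // dvdz_mull.
have [d d0 dd] := has_density_lattice N0 sH HN HZ.
exists d; split=> // [|c]; first by rewrite gt_eqF.
have [_ [w [fw cov]]] := fcc_index.
rewrite -[X in X%:R * _](size_enum_ord m).
rewrite (_ : translate c (@fcc R) = [set y | exists2 k, k \in enum 'I_m &
    translate (c + w *+ (k : 'I_m)) (coinc (@fcc R) A) y]).
  apply: has_density_bigU; [exact: enum_uniq | by move=> k _; exact: dd |].
  move=> k k' _ _ y [g Hg <-] [g' Hg']; rewrite -!addrA => /addrI E.
  have fg : @fcc R (w *+ k + g).
    by case: Hg => fg _; apply: subgroupD => //; exact: subgroup_fcc.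
  have [k0 _ kE] := cov _ fg.
  have T1 : translate (w *+ k) (coinc (@fcc R) A) (w *+ k + g) by exists g.
  have T2 : translate (w *+ k') (coinc (@fcc R) A) (w *+ k + g) by exists g'.
  have := kE _ T1; rewrite (kE _ T2) !modn_small // => /val_inj -> //.
apply/seteqP; split=> y.
  move=> [g fg <-]; have [k [h Hh hE] _] := cov _ fg.
  by exists k; [rewrite mem_enum | exists h; rewrite // -addrA hE].
move=> [k _ [h [fh _] <-]]; exists (w *+ k + h); last by rewrite addrA.
by apply: subgroupD => //; exact: subgroup_fcc.
Qed.

Lemma translate0 (S : set 'cV[R]_3) : translate 0 S = S.
Proof.
apply/seteqP; split=> y; first by move=> [x Sx <-]; rewrite add0r.
by move=> Sy; exists y; rewrite // add0r.
Qed.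

Lemma fcc_xfcc_disjoint y : @fcc R y -> ~ xfcc y.
Proof.
have O1' : O3 (1%:M : 'M[R]_3) by rewrite /O3 /= trmx1 mulmx1.
by move=> /(fcc_tr_not_xfcc O1'); rewrite trmx1 mul1mx.
Qed.

Lemma D3plus_density d : (forall c, has_density (translate c (@fcc R)) (m%:R * d)) ->
  has_density (@D3plus R) (2 * (m%:R * d)).
Proof.
move=> H; rewrite mulr_natl mulr2n; apply: has_densityU; last exact: H.
  exact: fcc_xfcc_disjoint.
by have := H 0; rewrite translate0.
Qed.

Lemma packing_index_double (b : 'cV[R]_3) : xfcc b ->
  coinc (@D3plus R) A = coinc (@fcc R) A `|` translate b (coinc (@fcc R) A) ->
  packing_index (@D3plus R) A m%:R.
Proof.
move=> xb E; have [d [d0 Hd Fd]] := csl_densities.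
exists (2 * (m%:R * d)), (d + d); split; first exact: D3plus_density.
- rewrite E; apply: has_densityU; last exact: Hd.
    move=> y [fy _] [g [fg _] yE]; apply: (fcc_xfcc_disjoint fy).
    by rewrite -yE; exact: xfcc_translate.
  by have := Hd 0; rewrite translate0.
- by rewrite -mulr2n mulrn_eq0 (negbTE d0).
by field; rewrite -mulr2n mulrn_eq0 (negbTE d0).
Qed.

Lemma packing_index_single : coinc (@D3plus R) A = coinc (@fcc R) A ->
  packing_index (@D3plus R) A (2 * m%:R).
Proof.
move=> E; have [d [d0 Hd Fd]] := csl_densities.
exists (2 * (m%:R * d)), d; split=> //; first exact: D3plus_density.
  by rewrite E; have := Hd 0; rewrite translate0.
by field.
Qed.

End OneIsometry.

Lemma packing_index_unique S A (c c' : R) : packing_index S A c ->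
  packing_index S A c' -> c = c'.
Proof.
move=> [d [e [dS eS e0 <-]]] [d' [e' [dS' eS' _ <-]]].
by rewrite (has_density_unique dS dS') (has_density_unique eS eS').
Qed.

(** [m] is the odd part of the norm. The sign [e] of the isometry and the sign
    [s] of the even part multiply the class modulo 4 that tells [x + fcc] from
    [- x + fcc], so that [e * s] decides whether [x + fcc] meets its image. *)
Lemma pm_rotq_classification q (e : int) : primitive q -> e * e = 1 ->
  let A : 'M[R]_3 := e%:~R *: rotq R q in
  exists m v c s, [/\ odd m, isotropic m v, csl_mx m v A,
    qnorm2 q = m%:Z * c /\ [\/ c = 1 /\ s = 1, c = 2 /\ s = -1 | c = 4 /\ s = 1] &
    (e * s = 1 -> xfcc (A^T *m base_point R m)) /\
    (e * s = -1 -> forall y, xfcc y -> ~ xfcc (A^T *m y))].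
Proof.
move=> pq e1 A.
have [q' [s [B [c [pq' oq' sB qE [qN cs]]]]]] := primitive_decomposition pq.
pose m := absz (qnorm2 q').
have qm : qnorm2 q' = m%:Z by rewrite /m gez0_abs // qnorm2_ge0.
have [v iv kv] := euler_kernel_isotropic oq' pq' qm.
have c0 : (c%:~R : R) != 0 by rewrite intr_eq0; case: cs => -[-> _].
have AE : A = e%:~R *: ((m%:Z)%:~R^-1 *: map_mx intr (euler q' *m B)).
  rewrite /A rotq_euler qE qN qm; congr (_ *: _).
  rewrite (_ : map_mx intr (c *: _) = c%:~R *: map_mx intr (euler q' *m B) :> 'M[R]_3).
    by rewrite scalerA intrM invfM -mulrA mulVf // mulr1.
  by apply/matrixP => i j; rewrite !mxE rmorphM.
exists m, v, c, s; split=> //.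
- exact: (euler_form_csl_mx oq' qm sB e1 AE kv).
- by rewrite qN qm.
split=> es; first exact: (euler_form_base oq' qm sB e1 AE es).
exact: (euler_form_empty oq' qm sB e1 AE es).
Qed.

Definition packing_double (m : nat) (L : set 'cV[int]_3) : set 'cV[R]_3 :=
  ([set iz z | z in L] `&` @fcc R) `|`
  translate (base_point R m) ([set iz z | z in L] `&` @fcc R).

Definition packing_single (L : set 'cV[int]_3) : set 'cV[R]_3 :=
  [set iz z | z in L] `&` @fcc R.

Lemma coinc_double m v A : odd m -> csl_mx m v A -> xfcc (A^T *m base_point R m) ->
  coinc (@D3plus R) A = packing_double m (dot_ker m v).
Proof.
move=> om cA xb; rewrite (coinc_D3plus_translate cA.1 (xfcc_base_point R om) xb).
by rewrite !(coinc_fcc_csl cA).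
Qed.

Lemma packing_index_base_point m v A : odd m -> isotropic m v -> csl_mx m v A ->
  xfcc (A^T *m base_point R m) -> packing_index (@D3plus R) A m%:R.
Proof.
move=> om iv cA xb; apply: (packing_index_double om iv cA (xfcc_base_point R om)).
exact: coinc_D3plus_translate cA.1 (xfcc_base_point R om) xb.
Qed.

(** A quaternion of norm [m] for [v] gives one kind of packing as a rotation,
    and the other kind as a rotoreflection. *)
Lemma isotropic_realized m v (e : int) : odd m -> isotropic m v -> e * e = 1 ->
  exists2 A, pm_rotq A & [/\ csl_mx m v A,
    e = 1 -> xfcc (A^T *m base_point R m) &
    e = -1 -> forall y, xfcc y -> ~ xfcc (A^T *m y)].
Proof.
move=> om iv e1; have [q [pq qm kq]] := isotropic_quaternion om iv.
pose A : 'M[R]_3 := e%:~R *: rotq R q.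
have AE : A = e%:~R *: ((m%:Z)%:~R^-1 *: map_mx intr (euler q *m 1%:M)).
  by rewrite mulmx1 /A rotq_euler qm.
exists A.
  exists q; first exact: qnorm2_neq0.
  have [eE|eE] : e = 1 \/ e = -1 by nia.
    by left; rewrite /A eE scale1r.
  by right; rewrite /A eE scaleN1r.
have es : e * 1 = e := mulr1 e.
split=> [|eE|eE]; first exact: (euler_form_csl_mx om qm sgnperm1 e1 AE kq).
  exact: (euler_form_base om qm sgnperm1 e1 AE (etrans es eE)).
exact: (euler_form_empty om qm sgnperm1 e1 AE (etrans es eE)).
Qed.

Lemma OC_pm_rotq (G : set 'cV[R]_3) A : subgroup G -> @twoZ3 R `<=` G ->
  G `<=` @Z3 R -> OC G A <-> pm_rotq A.
Proof.
move=> sG G2 GZ; split=> [OCA|pA].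
  have [q pq qA] := OC_primitive G2 GZ OCA.
  by exists q; first exact: qnorm2_neq0.
by apply: rational_OC => //; [exact: pm_rotq_O3 | exact: rational_pm_rotq].
Qed.

Lemma OC_fcc A : OC (@fcc R) A <-> pm_rotq A.
Proof. exact: (OC_pm_rotq _ (@subgroup_fcc R) (@twoZ3_fcc R) (@fcc_Z3 R)). Qed.

Lemma OC_Z3 A : OC (@Z3 R) A <-> pm_rotq A.
Proof. exact: (OC_pm_rotq _ (@subgroup_Z3 R) (@twoZ3_Z3 R) (fun y Zy => Zy)). Qed.

Lemma pm_rotq_cases A : pm_rotq A -> exists m v, [/\ odd m, isotropic m v, csl_mx m v A &
  xfcc (A^T *m base_point R m) \/ forall y, xfcc y -> ~ xfcc (A^T *m y)].
Proof.
move=> /pm_rotq_primitive[q pq qA].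
have [e e1 AE] : exists2 e : int, e * e = 1 & A = e%:~R *: rotq R q.
  by case: qA => ->; [exists 1; rewrite // scale1r | exists (-1); rewrite // scaleN1r].
have [m [v [c [s [om iv cA [_ cs] [H1 H2]]]]]] := pm_rotq_classification pq e1.
exists m, v; rewrite AE; split=> //.
have [es|es] : e * s = 1 \/ e * s = -1.
  have : e = 1 \/ e = -1 by nia.
  by case=> ->; case: cs => -[_ ->]; [left|right|left|right|left|right].
- by left; exact: H1.
- by right; exact: H2.
Qed.

(** The index is [m] or [2 m] for a coincidence lattice of odd index [m], so its
    parity tells the two kinds of packings apart. *)
Lemma D3plus_cspsE (m : nat) (S : set 'cV[R]_3) : D3plus_csps m S <->
  (odd m /\ [set packing_double m L | L in csl m] S) \/
  (~~ odd m /\ odd m./2 /\ [set packing_single L | L in csl m./2] S).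
Proof.
split.
  move=> [A [/OC_fcc/pm_rotq_cases[n [v [on iv cA [xb|em]]]] -> idx]].
    have := packing_index_unique (packing_index_base_point on iv cA xb) idx.
    move/eqP; rewrite eqr_nat => /eqP nm; subst n; left; split=> //.
    by exists (dot_ker m v); [exists v | rewrite (coinc_double on cA xb)].
  have E := coinc_D3plus_empty cA.1 em.
  have := packing_index_unique (packing_index_single on iv cA E) idx.
  rewrite -natrM => /eqP; rewrite eqr_nat => /eqP nm; right.
  have -> : m./2 = n by lia.
  split; first by lia.
  split=> //; exists (dot_ker n v); first by exists v.
  by rewrite E (coinc_fcc_csl cA).
case=> [[om [_ [v iv <-] <-]]|[em [om [_ [v iv <-] <-]]]].
  have [A pA [cA /(_ erefl) xb _]] := isotropic_realized (e := 1) om iv erefl.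
  exists A; split; [exact/OC_fcc | by rewrite (coinc_double om cA xb) |].
  exact: packing_index_base_point om iv cA xb.
have [A pA [cA _ /(_ erefl) xb]] := isotropic_realized (e := -1) om iv erefl.
have E := coinc_D3plus_empty cA.1 xb.
exists A; split; [exact/OC_fcc | by rewrite E (coinc_fcc_csl cA) |].
rewrite (_ : m%:R = 2 * (m./2)%:R); first exact: packing_index_single om iv cA E.
by rewrite -natrM; congr _%:R; lia.
Qed.

(** [z] lies in a lattice of odd index [m] if and only if [2 z] does, and [2 z]
    lies in [fcc]. *)
Lemma packing_single_inj m (L L' : set 'cV[int]_3) : odd m -> csl m L -> csl m L' ->
  packing_single L = packing_single L' -> L = L'.
Proof.
move=> om; have sub v v' : packing_single (dot_ker m v) `<=` packing_single (dot_ker m v') ->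
    dot_ker m v `<=` dot_ker m v'.
  move=> H z Lz; have : packing_single (dot_ker m v) (iz (2 *: z)).
    split; first by exists (2 *: z); rewrite // /dot_ker /= dotZr dvdz_mull.
    by apply/fcc_iz; rewrite totZ dvdz_mulr.
  move/H => [[z' Lz' /iz_inj E] _]; move: Lz'; rewrite E /dot_ker /= dotZr.
  by rewrite Gauss_dvdzr // odd_coprimez2.
by move=> [v _ <-] [v' _ <-] E; apply/seteqP; split; apply: sub; rewrite E.
Qed.

Lemma packing_double_fcc m L : odd m -> packing_double m L `&` @fcc R = packing_single L.
Proof.
move=> om; apply/seteqP; split=> y.
  move=> [[//|[g [_ fg] yE]] fy]; case: (fcc_xfcc_disjoint fy).
  by rewrite -yE; apply: xfcc_translate => //; exact: xfcc_base_point.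
by move=> Hy; split; [left | case: Hy].
Qed.

Lemma finite_D3plus_csps (m : nat) : (0 < m)%N -> finite_set (@D3plus_csps R m).
Proof.
move=> m0; have [om|em] := boolP (odd m).
  apply: (@sub_finite_set _ _ [set packing_double m L | L in csl m]).
    by move=> S /D3plus_cspsE[[]//|[]]; rewrite om.
  by apply: finite_image; exact: finite_csl.
apply: (@sub_finite_set _ _ [set packing_single L | L in csl m./2]).
  by move=> S /D3plus_cspsE[[]|[_ []//]]; rewrite (negbTE em).
by apply: finite_image; apply: finite_csl; lia.
Qed.

Lemma fD3plusE (m : nat) : fD3plus R m =
  if odd m then csl_card m else if odd m./2 then csl_card m./2 else 0%N.
Proof.
rewrite /fD3plus; case: ifP => om.
  have m0 : (0 < m)%N by case: (m) om.
  rewrite (_ : D3plus_csps m = [set packing_double m L | L in csl m]).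
    apply: card_fset_set_image; first exact: finite_csl.
    move=> L L' cL cL' E; apply: (packing_single_inj om cL cL').
    by rewrite -!(packing_double_fcc _ om) E.
  apply/seteqP; split=> S; first by move=> /D3plus_cspsE[[]//|[]]; rewrite om.
  by move=> H; apply/D3plus_cspsE; left.
case: ifP => om2.
  have m0 : (0 < m./2)%N by case: (m./2) om2.
  rewrite (_ : D3plus_csps m = [set packing_single L | L in csl m./2]).
    apply: card_fset_set_image; first exact: finite_csl.
    by move=> L L'; exact: packing_single_inj.
  apply/seteqP; split=> S; first by move=> /D3plus_cspsE[[]|[_ []//]]; rewrite om.
  by move=> H; apply/D3plus_cspsE; right; rewrite om om2.
rewrite (_ : D3plus_csps m = set0) ?fset_set0 ?cardfs0 //.
apply/seteqP; split=> S // /D3plus_cspsE[[]|[_ []]]; first by rewrite om.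
by rewrite om2.
Qed.

Lemma fZ3E (m : nat) : fZ3 R m = if odd m then csl_card m else 0%N.
Proof.
have H S : @Z3_csls R m S -> odd m /\ [set [set iz z | z in L] | L in csl m] S.
  move=> [A [/OC_Z3/pm_rotq_cases[n [v [on iv cA _]]] -> idx]].
  move: idx; rewrite (Sigma_Z3 on iv cA) => nm; subst n; split=> //.
  by exists (dot_ker m v); [exists v | rewrite (coinc_Z3_csl cA)].
rewrite /fZ3; case: ifP => om.
  have m0 : (0 < m)%N by case: (m) om.
  rewrite (_ : Z3_csls m = [set [set iz z | z in L] | L in csl m]).
    apply: card_fset_set_image; first exact: finite_csl.
    move=> L L' _ _ E; apply/seteqP; split=> z Lz.
      have : [set iz z | z in L] (iz z) by exists z.
      by rewrite E => -[z' Lz' /iz_inj <-].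
    have : [set iz z | z in L'] (iz z) by exists z.
    by rewrite -E => -[z' Lz' /iz_inj <-].
  apply/seteqP; split=> S; first by case/H.
  move=> [_ [v iv <-] <-].
  have [A pA [cA _ _]] := isotropic_realized (e := 1) om iv erefl.
  exists A; split; [exact/OC_Z3 | by rewrite (coinc_Z3_csl cA) |].
  exact: Sigma_Z3 om iv cA.
rewrite (_ : Z3_csls m = set0) ?fset_set0 ?cardfs0 //.
by apply/seteqP; split=> S // /H[]; rewrite om.
Qed.

(** At most one of two coprime numbers is even, and its half is odd or its count
    vanishes; the rest is [csl_card_mul]. *)
Lemma fD3plus_mult : arith_multiplicative (fD3plus R).
Proof.
split; first by rewrite fD3plusE /= csl_card1.
have half (m n : nat) : (0 < m)%N -> (0 < n)%N -> coprime m n -> odd m -> ~~ odd n ->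
    fD3plus R (m * n) = (fD3plus R m * fD3plus R n)%N.
  move=> m0 n0 cmn om en; rewrite !fD3plusE oddM om (negbTE en) /=.
  have nE : n = (n./2 * 2)%N by lia.
  have -> : (m * n)./2 = (m * n./2)%N.
    by rewrite {1}nE mulnA muln2 doubleK.
  rewrite oddM om /=; case: ifP => _; last by rewrite muln0.
  apply: csl_card_mul => //; first by lia.
  by move: cmn; rewrite {1}nE coprimeMr => /andP[].
move=> m n m0 n0 cmn.
have [om|em] := boolP (odd m); have [on|en] := boolP (odd n).
- by rewrite !fD3plusE oddM om on /= csl_card_mul.
- exact: half.
- by rewrite mulnC half // 1?coprime_sym // mulnC.
have : (2 %| gcdn m n)%N by rewrite dvdn_gcd !dvdn2 em en.
by move/eqP: cmn => ->.
Qed.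

Lemma fD3plus_pfactor (p r : nat) : prime p -> (0 < r)%N ->
  fD3plus R (p ^ r) =
    if (p ^ r == 2)%N then 1%N
    else if (p == 2)%N && (1 < r)%N then 0%N
    else ((p + 1) * p ^ (r - 1))%N.
Proof.
move=> pp r0; rewrite fD3plusE oddX.
have [p2|p2] := eqVneq p 2%N.
  rewrite p2; case: r r0 => // -[|r] _; first by rewrite /= csl_card1.
  rewrite /= !expnS mulnA -[(2 * 2)%N]/4%N.
  rewrite (_ : (4 * 2 ^ r)./2 = (2 * 2 ^ r)%N); last by lia.
  rewrite oddM /= ifF //; apply/negbTE; have := expn_gt0 2 r; lia.
have op : odd p by case: (even_prime pp) => // E; rewrite E in p2.
rewrite op orbT csl_card_pfactor // ifF //=.
by apply/negP => /eqP E; have := oddX p r; rewrite E op orbT.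
Qed.

(** Both sides are multiplicative and agree at prime powers. *)
Lemma fD3plus_csp_coef (n : nat) : (0 < n)%N -> fD3plus R n = csp_coef n.
Proof.
apply: arith_multiplicative_ext; first exact: fD3plus_mult.
  by apply: dconv_mult; [exact: valuations_mult | exact: odd_id_mult].
move=> p r pp r0; rewrite fD3plus_pfactor //.
by rewrite /csp_coef squarefree_odd_dconv_pfactor.
Qed.

End Packings.

(** * The group of coincidence isometries and the counting function *)

Section Conclusions.
Variable R : realType.
Implicit Types (A : 'M[R]_3) (s : R[i]).
Local Notation iz := (@iz R).

Lemma mxgroup_OC_fcc : mxgroup (OC (@fcc R)).
Proof.
split; first by apply/OC_fcc; exact: pm_rotq1.
  by move=> A B /OC_fcc pA /OC_fcc pB; apply/OC_fcc; exact: pm_rotqM.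
move=> A /OC_fcc pA; have OA := pm_rotq_O3 pA.
have uA : A \in unitmx by case/mulmx1_unit: (OA : A *m A^T = 1%:M).
split=> //; apply/OC_fcc.
rewrite (_ : invmx A = A^T); first exact: pm_rotq_tr.
by rewrite -[RHS]mul1mx -(mulVmx uA) -mulmxA (OA : A *m A^T = 1%:M) mulmx1.
Qed.

Lemma D3plus_half y : @D3plus R y -> @Z3 R (y *+ 2).
Proof.
case=> [/fccP[z -> _]|/xfccP[z [-> _ _]]].
  by rewrite -scaler_nat -[2]/(2%:~R) -izZ; exact: Z3_iz.
rewrite -scaler_nat scalerA divff ?pnatr_eq0 // scale1r; exact: Z3_iz.
Qed.

(** The points of the packing lie in half of [Z^3]. If two points of [L(A)] differ
    by a multiple of a basis vector, twice their preimages differ by an integral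
    vector, so a multiple of each basis vector has integral preimage and [A] is
    rational. *)
Lemma packing_coincidence_OC : @packing_coincidence R = OC (@fcc R).
Proof.
apply/seteqP; split=> A.
  move=> [OA [y [l [G' [_ _ finG sub]]]]]; apply/OC_fcc.
  rewrite -[A]trmxK; apply: pm_rotq_tr.
  have OAT : O3 A^T by rewrite /O3 /= trmxK O3_tr.
  apply: O3_rational_pm_rotq => //; apply: finite_index_rational => i.
  have Gk (k : nat) : @fcc R (iz (2 *: basis3 i) *+ k).
    apply: twoZ3_fcc; apply/twoZ3P; exists (k%:Z *: basis3 i).
    by rewrite -scaler_nat -[k%:R]/(k%:Z%:~R) -izZ !scalerA mulrC.
  have [n n0 Gn] := finite_index_multiple finG Gk.
  have half u : translate (y + l) G' u -> @Z3 R ((A^T *m u) *+ 2).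
    by move/sub => /(coinc_O3 _ _ OA) [_ /D3plus_half].
  have H1 : @Z3 R ((A^T *m (y + l + iz (2 *: basis3 i) *+ n)) *+ 2).
    by apply: half; exists (iz (2 *: basis3 i) *+ n).
  have H0 : @Z3 R ((A^T *m (y + l)) *+ 2).
    by apply: half; exists 0; [case: finG => -[] | rewrite addr0].
  exists (2 * n * 2)%N; first by rewrite !muln_gt0 n0.
  have := Z3_sub H1 H0; rewrite -mulrnBl -mulmxBr addrC addKr.
  have mulmxMn (B : 'M[R]_3) (u : 'cV_3) k : B *m (u *+ k) = (B *m u) *+ k.
    by elim: k => [|k IH]; rewrite ?mulr0n ?mulmx0 // !mulrS mulmxDr IH.
  by rewrite izZ -[2%:~R]/(2%:R) scaler_nat !mulmxMn -!mulrnA mulnA.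
move=> OCA; have [OA fin _] := OCA; split=> //.
exists 0, 0, (coinc (@fcc R) A); split=> //; first by left.
  exact: (@subgroup_fcc R).1.
rewrite addr0 => y [g cg <-]; rewrite add0r; apply/coinc_D3plus => //; by left.
Qed.

(** The vector from [x] to [base_point m] is a shift; any other shift describes
    the same set by [coinc_D3plus_translate]. *)
Lemma D3plus_dichotomy (A : 'M[R]_3) (m : nat) v : odd m -> isotropic m v -> csl_mx m v A ->
  ((forall y, translate (xD3 R) (@fcc R) y -> ~ translate (xD3 R) (@fcc R) (A^T *m y)) ->
   coinc (@D3plus R) A = coinc (@fcc R) A /\ packing_index (@D3plus R) A (2 * m%:R)) /\
  (translate (xD3 R) (@fcc R) (A^T *m base_point R m) ->
   [/\ packing_shifts A !=set0,
      forall l, packing_shifts A l -> coinc (@D3plus R) A =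
        coinc (@fcc R) A `|` translate (xD3 R + l) (coinc (@fcc R) A) &
      packing_index (@D3plus R) A m%:R]).
Proof.
move=> om iv cA; have OA := cA.1; split=> [em|xb].
  have E := coinc_D3plus_empty OA em; split=> //; exact: packing_index_single om iv cA E.
split.
- have fb : @fcc R (base_point R m - xD3 R).
    by apply: xfcc_sub; [exact: xfcc_base_point | exact: xfcc0].
  exists (base_point R m - xD3 R); apply/packing_shiftsP => //; split=> //.
  by rewrite addrCA subrr addr0.
- move=> l /(packing_shiftsP _ OA) [fl xl]; apply: coinc_D3plus_translate => //.
  by exists l.
exact: packing_index_base_point om iv cA xb.
Qed.

Lemma fZ3_le (m : nat) : (fZ3 R m <= fD3plus R m)%N.
Proof. by rewrite fZ3E fD3plusE; case: ifP. Qed.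

Lemma fD3plus_abs_cvg (x : R) : 2 < x -> cvgn (psum (rterm (fD3plus R) x)).
Proof. by move=> x2; rewrite (psum_rterm_ext x (@fD3plus_csp_coef R)); exact: csp_coef_abs_cvg. Qed.

Lemma dirichlet_fD3plus_fZ3 s : 2 < complex.Re s ->
  dirichlet (fD3plus R) s = (1 + natcpow 2 (- s)) * dirichlet (fZ3 R) s.
Proof.
move=> s2; have cf := fD3plus_abs_cvg s2.
have cz := psum_rterm_le fZ3_le cf.
rewrite (@dirichlet_even_split R (fD3plus R) (fZ3 R) (fZ3 R) 1 s) //.
- by rewrite mul1r mulrDl mul1r.
- by move=> m; rewrite fD3plusE fZ3E /= odd_double.
move=> m m0; rewrite fD3plusE !fZ3E odd_double doubleK mul1n.
by case: (odd m).
Qed.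

Lemma fD3plus_values : [seq fD3plus R m | m <- iota 1 17] =
  [:: 1; 1; 4; 0; 6; 4; 8; 0; 12; 6; 12; 0; 14; 8; 24; 0; 18]%N.
Proof.
have [f1 fM] := fD3plus_mult R.
have fp p r : prime p -> odd p -> (0 < r)%N -> fD3plus R (p ^ r) = ((p + 1) * p ^ (r - 1))%N.
  by move=> pp op r0; rewrite fD3plusE oddX op orbT csl_card_pfactor.
have f2 : fD3plus R 2 = 1%N by exact: (fD3plus_pfactor R (p := 2) (r := 1)).
have f3 : fD3plus R 3 = 4%N by exact: (fp 3 1)%N.
have f5 : fD3plus R 5 = 6%N by exact: (fp 5 1)%N.
have f7 : fD3plus R 7 = 8%N by exact: (fp 7 1)%N.
have f9 : fD3plus R 9 = 12%N by exact: (fp 3 2)%N.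
have f11 : fD3plus R 11 = 12%N by exact: (fp 11 1)%N.
have f13 : fD3plus R 13 = 14%N by exact: (fp 13 1)%N.
have f17 : fD3plus R 17 = 18%N by exact: (fp 17 1)%N.
have f6 : fD3plus R 6 = 4%N by rewrite (fM 2 3)%N // f2 f3.
have f10 : fD3plus R 10 = 6%N by rewrite (fM 2 5)%N // f2 f5.
have f14 : fD3plus R 14 = 8%N by rewrite (fM 2 7)%N // f2 f7.
have f15 : fD3plus R 15 = 24%N by rewrite (fM 3 5)%N // f3 f5.
by rewrite /= f1 f2 f3 f5 f6 f7 f9 f10 f11 f13 f14 f15 f17 !fD3plusE.
Qed.

Lemma fD3plus_asymptotic :
  (\sum_(1 <= m < N.+1) fD3plus R m)%N%:R / (15 * N%:R ^+ 2 / (4 * pi ^+ 2))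
    @[N --> \oo] --> (1 : R).
Proof.
under eq_fun => N.
  rewrite (_ : (\sum_(1 <= m < N.+1) fD3plus R m)%N = (\sum_(1 <= m < N.+1) csp_coef m)%N).
    over.
  by apply: eq_big_nat => m /andP[m0 _]; exact: fD3plus_csp_coef.
exact: csp_coef_asymptotic.
Qed.

End Conclusions.

Theorem theorem7p3 (R : realType) :
  (* the group of linear coincidence isometries *)
  [/\ mxgroup (@packing_coincidence R) & @packing_coincidence R = OC (@fcc R)] /\
  (* rotations *)
  (forall q : quat int, primitive q ->
    let A : 'M[R]_3 := rotq R q in
    let Sg : R := (Sigma (@fcc R) A)%:R in
    let nq : R := (qnorm2 q)%:~R in
    [/\ SOC (@fcc R) A, packing_coincidence A,
      (qnorm2 q %% 4)%Z = 2 ->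
        [/\ coinc (@D3plus R) A = coinc (@fcc R) A,
            packing_index (@D3plus R) A (2 * Sg) & 2 * Sg = nq] &
      (qnorm2 q %% 2)%Z = 1 \/ (qnorm2 q %% 4)%Z = 0 ->
        [/\ packing_shifts A !=set0,
            forall l, packing_shifts A l ->
              coinc (@D3plus R) A =
                coinc (@fcc R) A `|` translate (xD3 R + l) (coinc (@fcc R) A),
            packing_index (@D3plus R) A Sg,
            (qnorm2 q %% 2)%Z = 1 -> Sg = nq &
            (qnorm2 q %% 4)%Z = 0 -> Sg = 4^-1 * nq]]) /\
  (* rotoreflections *)
  (forall q : quat int, primitive q ->
    let A : 'M[R]_3 := rotoreflq R q in
    let Sg : R := (Sigma (@fcc R) A)%:R in
    let nq : R := (qnorm2 q)%:~R in
    [/\ (OC (@fcc R) `\` SOC (@fcc R)) A, packing_coincidence A,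
      (qnorm2 q %% 2)%Z = 1 \/ (qnorm2 q %% 4)%Z = 0 ->
        [/\ coinc (@D3plus R) A = coinc (@fcc R) A,
            packing_index (@D3plus R) A (2 * Sg),
            (qnorm2 q %% 2)%Z = 1 -> 2 * Sg = 2 * nq &
            (qnorm2 q %% 4)%Z = 0 -> 2 * Sg = 2^-1 * nq] &
      (qnorm2 q %% 4)%Z = 2 ->
        [/\ packing_shifts A !=set0,
            forall l, packing_shifts A l ->
              coinc (@D3plus R) A =
                coinc (@fcc R) A `|` translate (xD3 R + l) (coinc (@fcc R) A),
            packing_index (@D3plus R) A Sg &
            Sg = 2^-1 * nq]]) /\
  (* the counting function *)
  [/\ forall m : nat, (0 < m)%N -> finite_set (@D3plus_csps R m),
      arith_multiplicative (fD3plus R) &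
      forall p r : nat, prime p -> (0 < r)%N ->
        fD3plus R (p ^ r) =
          if (p ^ r == 2)%N then 1%N
          else if (p == 2)%N && (1 < r)%N then 0%N
          else ((p + 1) * p ^ (r - 1))%N] /\
  (* the Dirichlet series *)
  (forall s : R[i], 2 < complex.Re s ->
    [/\ cvg (dirichlet_partial (fD3plus R) s @ \oo),
        dirichlet (fD3plus R) s =
          (1 + natcpow 2 (- s)) * dirichlet (fZ3 R) s &
        dirichlet (fD3plus R) s = zetaJ (s / 2) / zeta (2 * s)]) /\
  [seq fD3plus R m | m <- iota 1 17] =
    [:: 1; 1; 4; 0; 6; 4; 8; 0; 12; 6; 12; 0; 14; 8; 24; 0; 18]%N /\
  (* ERRATUM: the source prints 9 N^2 / (2 pi^2). This contradicts the
     generating function above: its residue at s = 2 is 15 / (2 pi^2), so the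
     number is asymptotically 15 N^2 / (4 pi^2). *)
  (\sum_(1 <= m < N.+1) fD3plus R m)%N%:R / (15 * N%:R ^+ 2 / (4 * pi ^+ 2))
    @[N --> \oo] --> (1 : R).
Proof.
have intr_norm (m : nat) (c n : int) : n = m%:Z * c ->
    (n%:~R : R) = m%:R * c%:~R by move=> ->; rewrite intrM.
split; [|split; [|split; [|split; [|split; [|split]]]]].
- by rewrite packing_coincidence_OC; split=> //; exact: mxgroup_OC_fcc.
- move=> q pq A Sg nq; have q0 := qnorm2_neq0 pq.
  have AE : A = 1%:~R *: rotq R q by rewrite scale1r.
  have OCA : OC (@fcc R) A by apply/OC_fcc; exists q; [|left].
  have [m [v [c [s [om iv]]]]] := pm_rotq_classification R pq (mulr1 1 : 1 * 1 = 1 :> int).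
  rewrite -AE mul1r => cA [qm cs] [H1 H2].
  have SgE : Sg = m%:R by rewrite /Sg (Sigma_fcc om iv cA).
  have [Hem Hxb] := D3plus_dichotomy om iv cA.
  have nqE : nq = m%:R * c%:~R by apply: intr_norm.
  have modd : (m%:Z %% 2)%Z = 1 by lia.
  split.
  + by split=> //; split; [exact: cA.1 | exact: det_rotq].
  + by rewrite packing_coincidence_OC.
  + move=> q2; have [cE sE] : c = 2 /\ s = -1 by case: cs => -[cE ?] //; lia.
    have [E idx] := Hem (H2 sE).
    by rewrite SgE nqE cE; split=> //; rewrite mulrC.
  move=> q2; have sE : s = 1 by case: cs => -[cE ?] //; lia.
  have [ne tr idx] := Hxb (H1 sE).
  rewrite SgE nqE; split=> // q4.
    have cE : c = 1 by case: cs => -[cE _] //; lia.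
    by rewrite cE mulr1.
  have cE : c = 4 by case: cs => -[cE _] //; lia.
  by rewrite cE mulrC mulfK // pnatr_eq0.
- move=> q pq A Sg nq; have q0 := qnorm2_neq0 pq.
  have AE : A = (-1)%:~R *: rotq R q by rewrite scaleN1r.
  have OCA : OC (@fcc R) A by apply/OC_fcc; exists q; [|right].
  have [m [v [c [s [om iv]]]]] := pm_rotq_classification R pq (mulrNN 1 1 : -1 * -1 = 1 :> int).
  rewrite -AE mulN1r => cA [qm cs] [H1 H2].
  have SgE : Sg = m%:R by rewrite /Sg (Sigma_fcc om iv cA).
  have [Hem Hxb] := D3plus_dichotomy om iv cA.
  have nqE : nq = m%:R * c%:~R by apply: intr_norm.
  have modd : (m%:Z %% 2)%Z = 1 by lia.
  split.
  + split=> // -[_ [_]]; rewrite /A /rotoreflq -scaleN1r detZ det_rotq // mulr1.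
    rewrite !exprS expr0 mulr1 mulrNN mulr1 mulr1 => /eqP; rewrite eq_sym -subr_eq0 opprK.
    by rewrite -mulr2n pnatr_eq0.
  + by rewrite packing_coincidence_OC.
  + move=> q2; have sE : s = 1 by case: cs => -[cE ?] //; lia.
    have [E idx] := Hem (H2 (congr1 -%R sE)).
    rewrite SgE nqE; split=> // q4.
      have cE : c = 1 by case: cs => -[cE _] //; lia.
      by rewrite cE mulr1.
    have cE : c = 4 by case: cs => -[cE _] //; lia.
    by rewrite cE; field.
  move=> q2; have [cE sE] : c = 2 /\ s = -1 by case: cs => -[cE ?] //; lia.
  have [ne tr idx] := Hxb (H1 (congr1 -%R sE)).
  by rewrite SgE nqE cE; split=> //; field.
- split; [exact: finite_D3plus_csps | exact: fD3plus_mult | exact: fD3plus_pfactor].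
- move=> s s2; split; [|exact: dirichlet_fD3plus_fZ3|].
    by apply: dirichlet_cvg; exact: fD3plus_abs_cvg.
  rewrite -dirichlet_csp_coef // /dirichlet.
  by rewrite (dirichlet_partial_ext s (@fD3plus_csp_coef R)).
- exact: fD3plus_values.
exact: fD3plus_asymptotic.
Qed.
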